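(* Let $\lambda>0$ and let $\mathcal K_n$ be the integral operator on $L^2(\Sigma,|dw|)$ defined in the context. Then for every integer $n\ge 0$, \[ \phi^{(1)}_n(\lambda)=2^{-n}\det(I-\mathcal K_n), \] and \[ \phi^{(2)}_{n+1}(\lambda)=\phi^{(1)}_n(\lambda)+\Bigl(-\frac{\partial}{\partial t}\Bigr)\Big|_{t=1}\Bigl[(1+\sqrt t)^{-n}\det(I-\sqrt t\,\mathcal K_n)\Bigr]. \]
   Context: For $N\ge1$ let $Y_N$ be the set of Young diagrams (partitions) $\mu$ of size $N$, and for $\mu\in Y_N$ let $d_\mu$ be the number of standard Young tableaux of shape $\mu$. Plancherel measure on $Y_N$ is $\mathrm{Prob}(\mu)=d_\mu^2/N!$. Let $l_N^{(k)}(\mu)$ be the number of boxes in the $k$-th row of $\mu$. For $N\ge1$, $n\ge0$ set $q^{(k)}_{n,N}=\mathrm{Prob}(l^{(k)}_N\le n)=\frac1{N!}\sum_{\mu\vdash N,\ l_N^{(k)}(\mu)\le n}d_\mu^2$, and $q^{(k)}_{n,0}=1$. Define $\phi^{(k)}_n(\lambda)=\sum_{N=0}^\infty \frac{e^{-\lambda}\lambda^N}{N!}q^{(k)}_{n,N}$. Let $\Sigma$ be the unit circle, oriented counterclockwise, and $\varphi(z)=e^{\sqrt\lambda(z-z^{-1})}$. For an integer $n$, $\mathcal K_n$ is the (trace class) operator on $L^2(\Sigma,|dw|)$ given by $(\mathcal K_nf)(z)=\int_\Sigma \mathcal K_n(z,w)f(w)\,dw$ with kernel $\mathcal K_n(z,w)=\dfrac{z^{-n}w^n-\varphi(z)\varphi(w)^{-1}}{2\pi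 i(z-w)}$; $\det$ denotes the Fredholm determinant. *)

(* Defs.v *)
From HB Require Import structures.
From mathcomp Require Import all_boot all_order all_algebra.
From mathcomp Require Import all_classical all_reals all_analysis.
From mathcomp Require Import complex.

Set Implicit Arguments.
Unset Strict Implicit.
Unset Printing Implicit Defensive.

Import Order.TTheory GRing.Theory Num.Theory.
Import numFieldNormedType.Exports.

Local Open Scope classical_set_scope.
Local Open Scope ring_scope.

(* A Young diagram of size N has at most N rows, each of length at most N: it
   is encoded by the nonincreasing N-tuple of its row lengths, padded with 0. *)
Definition young_diagram (N : nat) : {set N.-tuple 'I_N.+1} :=
  [set mu : N.-tuple 'I_N.+1 |
    sorted geq [seq val r | r <- mu] && (sumn [seq val r | r <- mu] == N)].

(* Rows are numbered from 1, so the length of row k is at index k.-1; rows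
   k > N are empty, which is the default value of nth. *)
Definition row_length (N : nat) (mu : N.-tuple 'I_N.+1) (k : nat) : nat :=
  nth 0%N [seq val r | r <- mu] k.-1.

(* The pair (i, j) is the box in row i + 1 and column j + 1. *)
Definition box (N : nat) (mu : N.-tuple 'I_N.+1) : finType :=
  {b : 'I_N * 'I_N | (b.2 < row_length mu b.1.+1)%N}.

(* Entries are 0, ..., N - 1 instead of 1, ..., N. A diagram of size N has N
   boxes, so that injective fillings are bijective. *)
Definition standard_tableau (N : nat) (mu : N.-tuple 'I_N.+1)
    (T : {ffun box mu -> 'I_N}) : bool :=
  [&& injectiveb T,
      [forall a : box mu, forall b : box mu,
        ((val a).1 == (val b).1) && ((val a).2 < (val b).2)%N
          ==> (T a < T b)%N]
    & [forall a : box mu, forall b : box mu,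
        ((val a).2 == (val b).2) && ((val a).1 < (val b).1)%N
          ==> (T a < T b)%N]].

Definition num_tableaux (N : nat) (mu : N.-tuple 'I_N.+1) : nat :=
  #|[set T : {ffun box mu -> 'I_N} | standard_tableau T]|.

Section Plancherel.
Variable R : realType.
Implicit Types (k n N : nat) (lambda : R).

Definition plancherel N (mu : N.-tuple 'I_N.+1) : R :=
  (num_tableaux mu)%:R ^+ 2 / N`!%:R.

Definition row_cdf k n N : R :=
  if N == 0%N then 1
  else \sum_(mu in young_diagram N | (row_length mu k <= n)%N) plancherel mu.

Definition phi k n lambda : R :=
  limn (series (fun N => expR (- lambda) * lambda ^+ N / N`!%:R
                         * row_cdf k n N)).

End Plancherel.

Section ComplexValued.
Variable R : realType.
Local Notation C := R[i].
Implicit Types (u : nat -> C) (g : R -> C) (F : C -> C).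

Definition climn u : C :=
  Complex (limn (fun k => complex.Re (u k))) (limn (fun k => complex.Im (u k))).

Definition cderivable g (t : R) : Prop :=
  derivable (fun s => complex.Re (g s)) t 1 /\
  derivable (fun s => complex.Im (g s)) t 1.

Definition cderive1 g (t : R) : C :=
  Complex (derive1 (fun s => complex.Re (g s)) t)
          (derive1 (fun s => complex.Im (g s)) t).

Definition cRintegral (D : set R) g : C :=
  Complex (\int[lebesgue_measure]_(x in D) complex.Re (g x))
          (\int[lebesgue_measure]_(x in D) complex.Im (g x)).

Definition cexp (z : C) : C :=
  (expR (complex.Re z))%:C%C
  * Complex (cos (complex.Im z)) (sin (complex.Im z)).

Definition circle (theta : R) : C := Complex (cos theta) (sin theta).

(* \oint F(w) dw over the unit circle, counterclockwise:
   w = exp(i theta) and dw = i w dtheta. *)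
Definition oint F : C :=
  cRintegral `[0, 2 * pi]
    (fun theta => F (circle theta) * ('i%C * circle theta)).

(* \oint ... \oint F([:: w_1; ...; w_k]) dw_k ... dw_1 *)
Fixpoint iter_oint (k : nat) (F : seq C -> C) : C :=
  if k is k'.+1 then oint (fun w => iter_oint k' (fun s => F (w :: s)))
  else F [::].

(* The Fredholm determinant det(I - s K) of the integral operator
   (K f)(z) = \oint K(z, w) f(w) dw on the unit circle, for a kernel K that is
   continuous on the product of the circle with itself, given by the Fredholm
   series
     \sum_k (-s)^k / k! \oint ... \oint det(K(z_i, z_j))_{i,j} dz_1 ... dz_k. *)
Definition fredholm_det (K : C -> C -> C) (s : C) : C :=
  climn (series (fun k : nat =>
    (- s) ^+ k / k`!%:R
    * iter_oint k (fun z => \det (\matrix_(i < k, j < k) K z`_i z`_j)))).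

Definition symbol (lambda : R) (z : C) : C :=
  cexp ((Num.sqrt lambda)%:C%C * (z - z^-1)).

(* The numerator vanishes at z = w, and the kernel is extended to the diagonal
   by continuity: the value there is 1 / (2 pi i) times the z-derivative of
   the numerator z^(-n) w^n - symbol(z) / symbol(w) at w = z, that is,
   - n / z - sqrt(lambda) (1 + z^(-2)). *)
Definition contour_kernel (lambda : R) (n : int) (z w : C) : C :=
  if z == w then
    - (n%:~R / z + (Num.sqrt lambda)%:C%C * (1 + z ^- 2))
    / (2 * pi%:C%C * 'i%C)
  else
    (z ^ (- n) * w ^ n - symbol lambda z / symbol lambda w)
    / (2 * pi%:C%C * 'i%C * (z - w)).

End ComplexValued.

(* Main.v *)
(** Write [a = sqrt lambda].  Conjugating the kernel by [exp (- a / z)] does not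
    change its Fredholm determinant and leaves
      [- (S(z,w) + A(z,w) + (w/z)^n / (z w) A(1/z,1/w)) / (2 pi i)],
    where [A(z,w) = (e^(a (z-w)) - 1) / (z-w)] is entire and [S] is a geometric sum.
    In the basis of the monomials the operator becomes block triangular: minus the
    identity of size [n] and an off-diagonal pair of blocks, so that
      [det (1 - s K_n) = (1 + s)^n det (1 - s^2 (T H)^2)]
    with [T] lower triangular Toeplitz and [H] Hankel, made of [(-a)^k/k!] and [a^k/k!].

    On the combinatorial side, [d_mu / N! = det [1/(mu_i - i + j)!]].  Give each
    [mu] the weight [prod_i (1 - t [mu_i > n + i])] with [i] counted from 0: it is
    [1 [l1 <= n]] at [t = 1], and up to [(1-t)^2] it equals
      [1 [l1 <= n] + (1 - t) (1 [l2 <= n+1] - 1 [l1 <= n])].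
    By the Cauchy-Binet formula, the poissonized sum of these weights over the
    diagrams in the [M x M] box is the determinant of a Gram matrix
      [L L^T + V V - t (gramR)],
    with [L] the inverse of [T] and [V], [gramR] made of Hankel matrices.  Up to
    terms in the far corner this is [L^T L (1 - t (T H)^2)].  The errors decay faster
    than any geometric sequence, so they survive multiplication by the exponentially
    large bounds available for the determinants, and as [M] tends to infinity
      [gf t = gf 0 * (1 + s)^(-n) det (1 - s K_n)] where [s = sqrt t],
    with [gf 0 = e^lambda] because the squares of the [d_mu] sum to [N!]. *)
Require Import Defs.
From mathcomp Require Import all_boot all_order all_algebra.
From mathcomp Require Import all_fingroup.
From mathcomp Require Import all_classical all_reals all_analysis.
From mathcomp Require Import complex.
From mathcomp Require Import zify ring lra.

Set Implicit Arguments.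
Unset Strict Implicit.
Unset Printing Implicit Defensive.

Import Order.TTheory GRing.Theory Num.Theory.
Import numFieldNormedType.Exports.

Local Open Scope ring_scope.

(** * Determinants *)

(** No operator theory enters. On the circle the kernel is a uniform limit of Laurent polynomials,
    and their contour integrals are coefficient extractions, so each term of the Fredholm series is
    a limit of sums of principal minors of finite matrices. The conjugation separates the two
    exponential factors of the symbol: each divided difference becomes a power series in [z, w] or
    in their inverses, whence the block form.

    The obstacle is that row sums control an M by M determinant only by [b^M], so every discarded
    error has to beat [b^M]; [a^k/k!] decays faster than [th^(-k)] for every [th], which allows [th]
    to be chosen after [b]. Moreover the corner part of the Gram matrix at [t = 0] is not
    negligible: [L^T L] has determinant 1, while that of the Gram matrix tends to [e^lambda]. Hence
    this matrix is kept whole as a factor, and its corner is estimated only after multiplication by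
    [T H].

    No derivative is exchanged with a limit: the expansion at [t = 1] is an inequality with
    remainder a constant times [(1-t)^2], which passes to the limit and then gives
    differentiability, the derivative and the value. *)

Lemma det_row_bound (F : numDomainType) m (A : 'M[F]_m) :
  `|\det A| <= \prod_i \sum_j `|A i j|.
Proof.
rewrite bigA_distr_bigA /=; apply: le_trans (ler_norm_sum _ _ _) _.
rewrite (eq_bigr (fun s : 'S_m => \prod_i `|A i (s i)|)); last first.
  by move=> s _; rewrite normrM normrX normrN normr1 expr1n mul1r normr_prod.
(* The product of the row sums expands over all maps from rows to columns; permutations are embedded
   among them. *)
pose h (s : 'S_m) : {ffun 'I_m -> 'I_m} := [ffun i => s i].
have hI : injective h by move=> s t /ffunP E; apply/permP => i; have := E i; rewrite !ffunE.
rewrite (eq_bigr (fun s => \prod_i `|A i (h s i)|)); last first.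
  by move=> s _; apply: eq_bigr => i _; rewrite ffunE.
rewrite -(big_imset (h := h) (A := predT) (fun f : {ffun 'I_m -> 'I_m} => \prod_i `|A i (f i)|)) /=; last first.
  by move=> x y _ _; apply: hI.
rewrite big_mkcond /=; apply: ler_sum => f _.
by case: ifP => // _; apply: prodr_ge0.
Qed.

(** The rows of [B] are replaced by those of [A] one at a time; by multilinearity each replacement
    costs a determinant with one row of differences. As [1 <= b], the other [m - 1] rows are bounded
    by [b ^+ m]. *)
Lemma det_sub_bound (F : numDomainType) m (A B : 'M[F]_m) (b d : F) : 1 <= b ->
  (forall i, \sum_j `|A i j| <= b) -> (forall i, \sum_j `|B i j| <= b) ->
  (forall i, \sum_j `|A i j - B i j| <= d) ->
  `|\det A - \det B| <= m%:R * (d * b ^+ m).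
Proof.
move=> b1 hA hB hd; have b0 : 0 <= b := le_trans ler01 b1.
pose N (k : nat) : 'M[F]_m := \matrix_(i, j) if (i < k)%N then A i j else B i j.
have -> : A = N m by apply/matrixP => i j; rewrite mxE ltn_ord.
have -> : B = N 0%N by apply/matrixP => i j; rewrite mxE.
rewrite -(telescope_sumr (fun k => \det (N k))) // big_mkord.
apply: le_trans (ler_norm_sum _ _ _) _.
apply: le_trans (_ : \sum_(k < m) (d * b ^+ m) <= _); last first.
  by rewrite sumr_const card_ord mulr_natl.
apply: ler_sum => k _.
pose C : 'M[F]_m := \matrix_(i, j) if i == k then A i j - B i j else N k i j.
have -> : \det (N k.+1) - \det (N k) = \det C.
  rewrite (@determinant_multilinear _ _ (N k.+1) (N k) C k 1 1).
  - by rewrite !mul1r addrAC subrr add0r.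
  - by apply/rowP => j; rewrite !mxE ltnSn ltnn eqxx !mul1r addrC subrK.
  - apply/matrixP => i j; rewrite !mxE.
    have nk : ((lift k i : nat) == k) = false by apply/negbTE; rewrite eq_sym; exact: neq_lift.
    by rewrite !ltnS [in RHS]leq_eqVlt nk.
  - apply/matrixP => i j; rewrite !mxE eq_sym (negbTE (neq_lift _ _)).
    have nk : ((lift k i : nat) == k) = false by apply/negbTE; rewrite eq_sym; exact: neq_lift.
    by rewrite !ltnS [in RHS]leq_eqVlt nk.
apply: le_trans (det_row_bound _) _; rewrite (bigD1 k) //=.
have d0 : 0 <= d by apply: le_trans (hd k); apply: sumr_ge0.
apply: ler_pM.
- by apply: sumr_ge0.
- by apply: prodr_ge0 => i _; apply: sumr_ge0.
- by apply: le_trans (hd k); apply: ler_sum => j _; rewrite mxE eqxx.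
apply: le_trans (_ : \prod_(i | i != k) b <= _).
  apply: ler_prod => i ik; rewrite sumr_ge0 //=.
  case: (ltnP i k) => h; [apply: le_trans (hA i)|apply: le_trans (hB i)];
  by apply: ler_sum => j _; rewrite !mxE (negbTE ik) ?h // ltnNge h.
rewrite prodr_const; apply: ler_weXn2l => //.
by rewrite (leq_trans (max_card _)) // card_ord.
Qed.

Lemma inj_same_image (T : finType) k (f g : 'I_k -> T) : injective f -> injective g ->
  f @: [set: 'I_k]%SET = g @: [set: 'I_k]%SET -> exists s : 'S_k, forall i, g i = f (s i).
Proof.
move=> fI gI E.
pose h i := odflt i [pick j | f j == g i].
have fh i : f (h i) = g i.
  rewrite /h; case: pickP => [j /eqP //|no].
  have : g i \in f @: [set: 'I_k]%SET by rewrite E imset_f.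
  by case/imsetP => j _ /esym/eqP; rewrite no.
have hI : injective h by move=> i j e; apply: gI; rewrite -!fh e.
by exists (perm hI) => i; rewrite permE fh.
Qed.

(** Turns sums over injections into sums over subsets, each subset being met [k!] times; used for
    the von Koch expansion and for the sum over diagrams. *)
Lemma sum_inj_image (V : nmodType) (T : finType) k (f0 : 'I_k -> T)
    (F : {ffun 'I_k -> T} -> V) (v : V) : injective f0 ->
  (forall g : {ffun 'I_k -> T}, injective g ->
     g @: [set: 'I_k]%SET = f0 @: [set: 'I_k]%SET -> F g = v) ->
  \sum_(g : {ffun 'I_k -> T} | injectiveb g && (g @: [set: 'I_k]%SET == f0 @: [set: 'I_k]%SET)) F g
  = v *+ k`!.
Proof.
move=> fI hF; rewrite (eq_bigr (fun=> v)); last first.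
  by move=> g /andP[/injectiveP gI /eqP E]; apply: hF.
rewrite sumr_const; congr (_ *+ _).
have := card_inj_ffuns_on 'I_k (mem (f0 @: [set: 'I_k]%SET)).
rewrite card_imset // cardsT card_ord ffactnn => <-.
apply: eq_card => g; rewrite unfold_in inE andbC.
case: (boolP (injectiveb g)) => [/injectiveP gI|]; rewrite ?andbF // !andbT.
apply/eqP/ffun_onP => [<- x|h].
  by rewrite imset_f.
apply/eqP; rewrite eqEcard !card_imset // leqnn andbT.
by apply/fintype.subsetP => x /imsetP[i _ ->]; apply: h.
Qed.

(** This is Cauchy-Binet over all maps instead of subsets, hence the factor [m!]: a map that repeats
    a row contributes zero. *)
Lemma Andreief (F : comNzRingType) m L (A B : 'M[F]_(L, m)) :
  \sum_(f : {ffun 'I_m -> 'I_L})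
     \det (\matrix_(i, j) A (f i) j) * \det (\matrix_(i, j) B (f i) j)
  = \det (A^T *m B) *+ m`!.
Proof.
pose P (f : {ffun 'I_m -> 'I_L}) (s : 'S_m) : F :=
  (-1) ^+ s * \prod_i A (f i) (s i) * \det (\matrix_(i, j) B (f i) j).
rewrite (eq_bigr (fun f => \sum_(s : 'S_m) P f s)); last first.
  move=> f _; rewrite {1}/determinant mulr_suml; apply: eq_bigr => s _.
  by congr (_ * _ * _); apply: eq_bigr => i _; rewrite mxE.
rewrite exchange_big /= -card_Sn -sumr_const.
apply: eq_big => [s|s _]; first by rewrite inE.
(* Substituting [g] composed with [s] for [f] makes the second determinant produce the sign of [s],
   so the [m!] Leibniz terms of the first one contribute equally. *)
have hbij : {on xpredT, bijective (fun g : {ffun 'I_m -> 'I_L} => [ffun i => g (s i)])}.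
  exists (fun g : {ffun 'I_m -> 'I_L} => [ffun i => g (s^-1%g i)]) => g _;
  by apply/ffunP => i; rewrite !ffunE ?permK ?permKV.
rewrite (reindex _ hbij) /=.
transitivity (\sum_(g : {ffun 'I_m -> 'I_L}) \prod_i A (g i) i * \det (\matrix_(i, j) B (g i) j)).
  apply: eq_bigr => g _; rewrite /P.
  have -> : \prod_i A ([ffun i => g (s i)] i) (s i) = \prod_i A (g i) i.
    rewrite [RHS](reindex_inj (@perm_inj _ s)) /=.
    by apply: eq_bigr => i _; rewrite ffunE.
  have -> : (\matrix_(i, j) B ([ffun i => g (s i)] i) j) = row_perm s (\matrix_(i, j) B (g i) j).
    by apply/matrixP => i j; rewrite !mxE ffunE.
  rewrite row_permE det_mulmx det_perm mulrAC mulrA -expr2 sqrr_sign mul1r mulrC.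
  by [].
rewrite /determinant.
under [RHS]eq_bigr => t _.
  under eq_bigr => i _ do rewrite !mxE.
  rewrite bigA_distr_bigA /= mulr_sumr.
  over.
rewrite exchange_big /=; apply: eq_bigr => g _.
rewrite mulr_sumr; apply: eq_bigr => t _.
rewrite mulrCA; congr (_ * _); rewrite -big_split /=.
by apply: eq_bigr => i _; rewrite !mxE.
Qed.

(** Expanding along an identity row, one outside the image of [f], lowers [D]. When none is left,
    [f] permutes rows and columns alike and the two signs cancel. *)
Lemma det_mixed (F : comNzRingType) D k (A : 'M[F]_D) (f : 'I_k -> 'I_D) : injective f ->
  \det (\matrix_(i, j) A (f i) (f j)) =
  \det (\matrix_(i, j) if i \in f @: [set: 'I_k]%SET then A i j else (i == j)%:R).
Proof.
elim: D k A f => [|D IH] k A f fI.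
  have k0 : k = 0%N by move: (leq_card f fI); rewrite !card_ord leqn0 => /eqP.
  by subst k; rewrite !det_mx00.
case: (pickP (fun i => i \notin f @: [set: 'I_k]%SET)) => [i0 hi0|full].
  have neq i : i0 != f i by apply: contraNneq hi0 => ->; rewrite imset_f.
  pose f' i := s2val (unlift_some (neq i)).
  have ff' i : f i = lift i0 (f' i) by rewrite /f'; case: (unlift_some (neq i)).
  have f'I : injective f' by move=> i j e; apply: fI; rewrite !ff' e.
  rewrite (expand_det_row _ i0) (bigD1 i0) //= big1 ?addr0; last first.
    by move=> j ji; rewrite mxE (negbTE hi0) eq_sym (negbTE ji) mul0r.
  rewrite mxE (negbTE hi0) eqxx mul1r /cofactor addnn -mul2n exprM sqrrN expr1n expr1n mul1r.
  have -> : (\matrix_(i, j) A (f i) (f j)) =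
     \matrix_(i, j) (\matrix_(i, j) A (lift i0 i) (lift i0 j)) (f' i) (f' j).
    by apply/matrixP => i j; rewrite !mxE -!ff'.
  rewrite IH //; congr (\det _); apply/matrixP => i j; rewrite !mxE.
  rewrite (inj_eq (@lift_inj _ i0)).
  have -> // : (i \in f' @: [set: 'I_k]%SET) = (lift i0 i \in f @: [set: 'I_k]%SET).
  apply/imsetP/imsetP => -[x _ e]; exists x => //.
    by rewrite ff' e.
  by apply: (@lift_inj _ i0); rewrite -ff'.
have kD : k = D.+1.
  have : #|f @: [set: 'I_k]%SET| = D.+1.
    rewrite -[RHS](card_ord D.+1); apply: eq_card => i.
    by have := full i; rewrite /= => /negbFE ->.
  by rewrite card_imset // cardsT card_ord.
subst k; pose s := perm fI.
have -> : (\matrix_(i, j) A (f i) (f j)) = row_perm s (col_perm s A).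
  by apply/matrixP => i j; rewrite !mxE !permE.
rewrite row_permE col_permE !det_mulmx !det_perm odd_permV mulrCA -expr2 sqrr_sign mulr1.
by congr (\det _); apply/matrixP => i j; rewrite mxE; have := full i => /= /negbFE ->.
Qed.

(** Splitting every row into its identity part and its part from [A] gives one principal minor per
    set of indices; a set of size [k] is the image of [k!] injections, and other maps give repeated
    rows. *)
Lemma von_koch (F : numFieldType) D (A : 'M[F]_D) :
  \det (1%:M + A) = \sum_(k < D.+1) (k`!)%:R^-1 *
     \sum_(f : {ffun 'I_k -> 'I_D}) \det (\matrix_(i, j) A (f i) (f j)).
Proof.
pose MS (S : {set 'I_D}) := \det (\matrix_(i, j) if i \in S then A i j else (i == j)%:R).
have E1 : \det (1%:M + A) = \sum_(S : {set 'I_D}) MS S.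
  rewrite /determinant.
  under eq_bigr => s _.
    under eq_bigr => i _ do rewrite !mxE addrC.
    rewrite bigA_distr /= mulr_sumr.
    over.
  rewrite exchange_big /=; apply: eq_bigr => S _; apply: eq_bigr => s _.
  by congr (_ * _); apply: eq_bigr => i _; rewrite mxE.
rewrite E1.
have cardS (S : {set 'I_D}) : (#|S| < D.+1)%N by rewrite ltnS -[X in (_ <= X)%N](card_ord D) max_card.
rewrite (partition_big (fun S : {set 'I_D} => Ordinal (cardS S)) xpredT) //=.
apply: eq_bigr => k _.
rewrite (bigID (fun f : {ffun 'I_k -> 'I_D} => injectiveb f)) /= [X in _ + X]big1 ?addr0; last first.
  move=> f /injectivePn[x [y xy e]].
  by apply: (determinant_alternate xy) => j; rewrite !mxE e.
rewrite (partition_big (fun f : {ffun 'I_k -> 'I_D} => f @: [set: 'I_k]%SET) xpredT) //=.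
rewrite mulr_sumr big_mkcond /=; apply: eq_bigr => S _.
case: ifPn => [/eqP/(congr1 val)/= hS|hS]; last first.
  rewrite big1 ?mulr0 // => f /andP[/injectiveP fI /eqP fS].
  by case/eqP: hS; apply: val_inj; rewrite /= -fS card_imset // cardsT card_ord.
pose f0 (i : 'I_k) : 'I_D := enum_val (cast_ord (esym hS) i).
have f0I : injective f0 by move=> i j /enum_val_inj /cast_ord_inj.
have f0S : f0 @: [set: 'I_k]%SET = S.
  apply/eqP; rewrite eqEcard card_imset // cardsT card_ord hS leqnn andbT.
  by apply/fintype.subsetP => x /imsetP[i _ ->]; apply: enum_valP.
have := @sum_inj_image F _ _ f0 (fun f => \det (\matrix_(i, j) A (f i) (f j))) (MS S) f0I.
rewrite f0S => ->; last by move=> g gI gS; rewrite det_mixed // gS.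
by rewrite -(mulr_natl (MS S)) mulrA mulVf ?mul1r // pnatr_eq0 -lt0n fact_gt0.
Qed.

(** * The determinantal formula for the number of standard tableaux *)

(** The inverse factorial of the integer [p - q], zero when it is negative. The two arguments stay
    separate because [r i - i + j] may be negative. *)
Definition rfact (F : fieldType) (p q : nat) : F :=
  if (q <= p)%N then ((p - q)`!%:R)^-1 else 0.

Definition fdet (F : fieldType) M (r : 'I_M -> nat) : F :=
  \det (\matrix_(i, j) rfact F (r i + j) i).

Definition row_dn M (r : 'I_M -> nat) (i k : 'I_M) : nat := (r k - (k == i))%N.
Definition row_up M (r : 'I_M -> nat) (i k : 'I_M) : nat := (r k + (k == i))%N.
Definition noninc M (r : 'I_M -> nat) : bool :=
  [forall i : 'I_M, forall j : 'I_M, (i <= j)%N ==> (r j <= r i)%N].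
Definition corner M (r : 'I_M -> nat) (i : 'I_M) : bool :=
  (0 < r i)%N && [forall k : 'I_M, (k == i.+1 :> nat) ==> (r k < r i)%N].
Definition addable M (r : 'I_M -> nat) (i : 'I_M) : bool :=
  [forall k : 'I_M, (k.+1 == i :> nat) ==> (r i < r k)%N].

Lemma nonincP M (r : 'I_M -> nat) :
  reflect (forall i j : 'I_M, (i <= j)%N -> (r j <= r i)%N) (noninc r).
Proof.
apply: (iffP forallP) => [h i j ij|h i]; first by have /forallP/(_ j)/implyP := h i; apply.
by apply/forallP => j; apply/implyP; apply: h.
Qed.

Lemma det_replace_row (F : comNzRingType) M (A B : 'M[F]_M) i :
  \det (\matrix_(k, j) if k == i then B k j else A k j) = \sum_j B i j * cofactor A i j.
Proof.
rewrite (expand_det_row _ i); apply: eq_bigr => j _; rewrite mxE eqxx; congr (_ * (_ * \det _)).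
by apply/matrixP => x y; rewrite !mxE eq_sym (negbTE (neq_lift _ _)).
Qed.

Lemma det_replace_col (F : comNzRingType) M (A B : 'M[F]_M) j :
  \det (\matrix_(k, l) if l == j then B k l else A k l) = \sum_i B i j * cofactor A i j.
Proof.
rewrite (expand_det_col _ j); apply: eq_bigr => i _; rewrite mxE eqxx; congr (_ * (_ * \det _)).
by apply/matrixP => x y; rewrite !mxE [lift j y == j]eq_sym (negbTE (neq_lift _ _)).
Qed.

(** Both sides are the derivative of the determinant at [A] in the direction [B], expanded in
    cofactors. *)
Lemma sum_replace_row_col (F : comNzRingType) M (A B : 'M[F]_M) :
  \sum_i \det (\matrix_(k, j) if k == i then B k j else A k j) =
  \sum_j \det (\matrix_(k, l) if l == j then B k l else A k l).
Proof.
under eq_bigr do rewrite det_replace_row.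
under [RHS]eq_bigr do rewrite det_replace_col.
by rewrite exchange_big.
Qed.

Lemma rfactS (F : numFieldType) p q :
  (p%:R - q%:R) * rfact F p q = rfact F p q.+1.
Proof.
rewrite /rfact; case: (ltngtP q p) => [lt|gt|->]; last by rewrite subrr mul0r.
  rewrite -natrB 1?ltnW // subnS; case: (p - q)%N (subn_gt0 q p) => [|m _ /=]; first by rewrite lt.
  by rewrite factS natrM invfM mulrA mulfV ?mul1r // pnatr_eq0.
by rewrite mulr0.
Qed.

(* [rfactS] turns the [i]-th term into the factor [r i - i + j] on row [i]; summed, the
   [- i] over rows and the [+ j] over columns cancel. This is the branching rule
   [d_mu = sum d_(mu - box)] for [d_mu = N! fdet]. *)
Lemma fdet_down (F : numFieldType) M (r : 'I_M -> nat) :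
  \sum_i \det (\matrix_(k, j) rfact F (r k + j) (if k == i then k.+1 else k))
  = (\sum_i r i)%:R * fdet F r.
Proof.
pose A : 'M[F]_M := \matrix_(i, j) rfact F (r i + j) i.
transitivity (\sum_i \sum_(j < M) (((r i)%:R - i%:R) + j%:R) * (A i j * cofactor A i j)).
  apply: eq_bigr => i _.
  transitivity (\det (\matrix_(k, j) if k == i then (\matrix_(k, j) rfact F (r k + j) k.+1) k j else A k j)).
    by congr (\det _); apply/matrixP => k j; rewrite !mxE; case: eqP.
  rewrite det_replace_row; apply: eq_bigr => j _.
  by rewrite !mxE -rfactS natrD; ring.
transitivity (\sum_i ((r i)%:R - i%:R) * \det A + \sum_(j < M) j%:R * \det A).
  under eq_bigr => i _ do under eq_bigr => j _ do rewrite mulrDl.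
  under eq_bigr => i _ do rewrite big_split /=.
  rewrite big_split /=; congr (_ + _).
    by apply: eq_bigr => i _; rewrite -mulr_sumr -expand_det_row.
  rewrite exchange_big /=; apply: eq_bigr => j _.
  by rewrite -mulr_sumr -expand_det_col.
by rewrite -!mulr_suml -mulrDl sumrB subrK natr_sum.
Qed.

(** The dual branching rule. Raising rows one by one amounts to shifting columns one by one; a
    shifted column repeats the next one, so only the last column contributes. The last row being
    empty, its only nonzero entry is the corner one, and expanding along it gives back
    [fdet F r]. *)
Lemma fdet_up (F : numFieldType) m (r : 'I_m.+1 -> nat) : r ord_max = 0%N ->
  \sum_i fdet F (row_up r i) = fdet F r.
Proof.
move=> r0.
pose A : 'M[F]_m.+1 := \matrix_(i, j) rfact F (r i + j) i.
pose B : 'M[F]_m.+1 := \matrix_(i, j) rfact F (r i + j).+1 i.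
transitivity (\sum_i \det (\matrix_(k, j) if k == i then B k j else A k j)).
  apply: eq_bigr => i _; congr (\det _); apply/matrixP => k j; rewrite !mxE /row_up.
  by case: eqP => _; rewrite ?addn0 // addn1 addSn.
rewrite sum_replace_row_col big_ord_recr /= big1 ?add0r; last first.
  move=> j _; rewrite -det_tr.
  have lt : (j.+1 < m.+1)%N by rewrite ltnS.
  apply: (@determinant_alternate _ _ _ (widen_ord (leqnSn m) j) (Ordinal lt)).
    by rewrite -(inj_eq val_inj) /= neq_ltn ltnSn.
  move=> k; rewrite !mxE eqxx -(inj_eq val_inj) /= gtn_eqF //.
  by rewrite addnS.
rewrite /fdet (expand_det_row _ ord_max) [RHS](expand_det_row _ ord_max).
have last0 (j : 'I_m.+1) : j != ord_max -> rfact F j m = 0.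
  move=> jm; rewrite /rfact leqNgt.
  suff -> : (j < m)%N by [].
  by rewrite ltn_neqAle -ltnS ltn_ord andbT.
apply: eq_bigr => j _; rewrite !mxE r0 !add0n.
case: eqP => [->|/eqP jm]; last by rewrite last0 // !mul0r.
(* Shifting turns the corner entry [1/0!] into [1/1!], the same value. *)
have -> : rfact F (ord_max : 'I_m.+1).+1 (ord_max : 'I_m.+1) = rfact F (ord_max : 'I_m.+1) (ord_max : 'I_m.+1).
  by rewrite /rfact /= leqnn leqnSn subnn subSnn !factS fact0.
congr (_ * _); rewrite /cofactor; congr (_ * _); congr (\det _).
apply/matrixP => x y; rewrite !mxE.
by rewrite [lift _ y == _]eq_sym (negbTE (neq_lift _ _)).
Qed.

Lemma fdet_corner (F : numFieldType) M (r : 'I_M -> nat) i : (0 < r i)%N ->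
  \det (\matrix_(k, j) rfact F (r k + j) (if k == i then k.+1 else k)) = fdet F (row_dn r i).
Proof.
move=> ri; congr (\det _); apply/matrixP => k j; rewrite !mxE /row_dn.
case: eqP => [->|_]; last by rewrite subn0.
by case: (r i) ri => // m _; rewrite subn1 /= /rfact addSn ltnS subSS.
Qed.

(** Either the next row has the same length, and the lowered row coincides with it, or the row is
    the last one and empty, and the lowered row vanishes. *)
Lemma fdet_noncorner (F : numFieldType) M (r : 'I_M -> nat) i : noninc r -> ~~ corner r i ->
  \det (\matrix_(k, j) rfact F (r k + j) (if k == i then k.+1 else k)) = 0.
Proof.
move=> /nonincP hr nc; case: (ltnP i.+1 M) => lt.
  pose i' := Ordinal lt.
  have e : r i' = r i.
    apply/eqP; rewrite eqn_leq hr ?leqnSn //=.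
    move: nc; rewrite negb_and -leqNgt leqn0 => /orP[/eqP -> //|/forallPn[k]].
    rewrite negb_imply -leqNgt => /andP[/eqP ki].
    by have -> : k = i' by apply: val_inj.
  have ne : i != i' by rewrite -(inj_eq val_inj) /= neq_ltn ltnSn.
  apply: (@determinant_alternate _ _ _ i i') => // k.
  by rewrite !mxE eqxx eq_sym (negbTE ne) e.
have r0 : r i = 0%N.
  move: nc; rewrite negb_and -leqNgt leqn0 => /orP[/eqP -> //|/forallPn[k]].
  rewrite negb_imply => /andP[/eqP ki _].
  by have := ltn_ord k; rewrite ki ltnNge lt.
rewrite (expand_det_row _ i) big1 // => j _; rewrite mxE eqxx r0 add0n /rfact.
by rewrite leqNgt (leq_trans (ltn_ord j)) ?mul0r // (leq_trans lt).
Qed.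

(** The raised row coincides with the row above it, which has the same length. *)
Lemma fdet_up_nonaddable (F : numFieldType) M (r : 'I_M -> nat) i : noninc r -> ~~ addable r i ->
  fdet F (row_up r i) = 0.
Proof.
move=> /nonincP hr /forallPn[k]; rewrite negb_imply -leqNgt => /andP[/eqP ki rk].
have e : r k = r i by apply/eqP; rewrite eqn_leq rk hr // -ki leqnSn.
have ne : i != k by rewrite -(inj_eq val_inj) /= -ki neq_ltn ltnSn orbT.
apply: (@determinant_alternate _ _ _ i k) => // j.
by rewrite !mxE /row_up eqxx eq_sym (negbTE ne) e addn0 addn1 addSn -ki /rfact ltnS subSS.
Qed.

Lemma fdet0 (F : numFieldType) M (r : 'I_M -> nat) : (forall i, r i = 0%N) -> fdet F r = 1.
Proof.
move=> r0; rewrite /fdet -det_tr det_trig.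
  by apply: big1 => i _; rewrite !mxE r0 add0n /rfact leqnn subnn invr1.
apply/is_trig_mxP => i j ij; rewrite !mxE r0 add0n /rfact.
by rewrite leqNgt ij.
Qed.

(** * Standard tableaux as fillings of a fixed square, and their branching rule *)

Definition prec K (x y : 'I_K * 'I_K) : bool :=
  (x.1 == y.1) && (x.2 < y.2)%N || (x.2 == y.2) && (x.1 < y.1)%N.

(* Entries start at 1, so that the value 0 marks the boxes outside [S]. *)
Definition fillings K k (S : {set 'I_K * 'I_K}) : {set {ffun 'I_K * 'I_K -> 'I_K.+1}} :=
  [set T : {ffun 'I_K * 'I_K -> 'I_K.+1} |
   [&& [forall x, (x \in S) == (0 < T x)%N], [forall x, (T x <= k)%N],
       [forall x, forall y, [&& x \in S, y \in S & T x == T y] ==> (x == y)] &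
       [forall x, forall y, [&& x \in S, y \in S & prec x y] ==> (T x < T y)%N]]].

Lemma fillingsP K k (S : {set 'I_K * 'I_K}) (T : {ffun 'I_K * 'I_K -> 'I_K.+1}) :
  reflect [/\ forall x, (x \in S) = (0 < T x)%N, forall x, (T x <= k)%N,
     forall x y, x \in S -> y \in S -> T x = T y -> x = y &
     forall x y, x \in S -> y \in S -> prec x y -> (T x < T y)%N]
  (T \in fillings k S).
Proof.
rewrite inE; apply: (iffP and4P) => -[h1 h2 h3 h4]; split.
- by move=> x; apply/eqP; apply: (forallP h1).
- exact: (forallP h2).
- move=> x y xS yS e; have /forallP/(_ y)/implyP := forallP h3 x.
  by rewrite xS yS e eqxx => /(_ isT)/eqP.
- move=> x y xS yS e; have /forallP/(_ y)/implyP := forallP h4 x.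
  by rewrite xS yS e => /(_ isT).
- by apply/forallP => x; rewrite h1.
- exact/forallP.
- apply/forallP => x; apply/forallP => y; apply/implyP => /and3P[xS yS /eqP e].
  by apply/eqP; apply: h3.
- apply/forallP => x; apply/forallP => y; apply/implyP => /and3P[xS yS e].
  by apply: h4.
Qed.

(** Pigeonhole: [k + 1] distinct positive values do not fit into [1, ..., k]. *)
Lemma fillings_has_max K k (S : {set 'I_K * 'I_K}) T : #|S| = k.+1 ->
  T \in fillings k.+1 S -> exists2 x, x \in S & T x = k.+1 :> nat.
Proof.
move=> cS /fillingsP[h1 h2 h3 _].
case: (pickP [pred x in S | T x == k.+1 :> nat]) => [x /andP[xS /eqP e]|no]; first by exists x.
have hk x : x \in S -> (0 < T x <= k)%N.
  move=> xS; rewrite -h1 xS /= -ltnS ltn_neqAle h2 andbT.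
  by have := no x; rewrite /= xS => /= ->.
have : (#|T @: S| <= #|(fun i : 'I_k => inord i.+1 : 'I_K.+1) @: [set: 'I_k]%SET|)%N.
  apply: subset_leq_card; apply/fintype.subsetP => v /imsetP[x /hk /andP[p q] ->].
  have lt : ((T x).-1 < k)%N by rewrite prednK.
  by apply/imsetP; exists (Ordinal lt); rewrite // /= prednK // inord_val.
rewrite card_in_imset ?cS; last by move=> x y xS yS; apply: h3.
move/leq_trans => /(_ _ (leq_imset_card _ _)).
by rewrite cardsT card_ord ltnn.
Qed.

(** The greatest entry can only sit in a box that is maximal for [prec]; erasing it, that is
    resetting its value to 0, is then a bijection. *)
Lemma card_fillings_at K k (S : {set 'I_K * 'I_K}) x : (k < K)%N -> x \in S ->
  #|[set T in fillings k.+1 S | T x == k.+1 :> nat]| =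
  if [forall y in S, ~~ prec x y] then #|fillings k (S :\ x)| else 0%N.
Proof.
move=> kK xS; case: ifP => [/forall_inP mx|/negbT]; last first.
  rewrite negb_forall_in => /exists_inP[y yS]; rewrite negbK => xy.
  apply: eq_card0 => T; rewrite inE; apply/negP => /andP[/fillingsP[_ h2 _ h4] /eqP e].
  by have := h4 _ _ xS yS xy; rewrite e ltnNge h2.
pose phi (T : {ffun 'I_K * 'I_K -> 'I_K.+1}) : {ffun 'I_K * 'I_K -> 'I_K.+1} :=
  [ffun y => if y == x then ord0 else T y].
rewrite -(@card_in_imset _ _ phi); last first.
  move=> T U; rewrite !inE => /andP[_ /eqP e1] /andP[_ /eqP e2] /ffunP e.
  apply/ffunP => y; case: (eqVneq y x) => [->|yx].
    by apply: val_inj; rewrite /= e1 e2.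
  by have := e y; rewrite !ffunE (negbTE yx).
congr #|pred_of_set _|; apply/setP => U; apply/imsetP/idP => [[T]|hU].
  rewrite inE => /andP[/fillingsP[h1 h2 h3 h4] /eqP e] ->.
  apply/fillingsP; split.
  - by move=> y; rewrite ffunE 2!inE; case: eqP => //= _; apply: h1.
  - move=> y; rewrite ffunE; case: eqP => // /eqP yx.
    rewrite -ltnS ltn_neqAle h2 andbT.
    case: (boolP (y \in S)) => yS; last by move: yS; rewrite h1 -leqNgt leqn0 => /eqP ->.
    by apply: contraNneq yx => ey; apply/eqP; apply: h3 => //; apply: val_inj; rewrite /= e ey.
  - move=> y z; rewrite !inE !ffunE => /andP[yx yS] /andP[zx zS].
    by rewrite (negbTE yx) (negbTE zx); apply: h3.
  - move=> y z; rewrite !inE !ffunE => /andP[yx yS] /andP[zx zS].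
    by rewrite (negbTE yx) (negbTE zx); apply: h4.
have vk : (inord k.+1 : 'I_K.+1) = k.+1 :> nat by rewrite inordK.
case/fillingsP: hU => h1 h2 h3 h4.
exists [ffun y => if y == x then inord k.+1 else U y]; last first.
  apply/ffunP => y; rewrite !ffunE; case: eqP => // ->.
  by apply: val_inj; have := h1 x; rewrite !inE eqxx /=; case: (nat_of_ord (U x)).
rewrite inE ffunE eqxx vk eqxx andbT.
have ne y : y \in S -> y != x -> y \in S :\ x by move=> yS yx; rewrite !inE yx.
apply/fillingsP; split.
- by move=> y; rewrite ffunE; case: eqP => [->|/eqP yx]; rewrite ?vk // -h1 !inE yx.
- by move=> y; rewrite ffunE; case: eqP => _; rewrite ?vk // ltnW // ltnS.
- move=> y z yS zS; rewrite !ffunE.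
  case: eqP => [->|/eqP yx]; case: eqP => [->|/eqP zx] //.
  + by move/(congr1 val); rewrite /= vk => e; have := h2 z; rewrite -e ltnn.
  + by move/(congr1 val); rewrite /= vk => e; have := h2 y; rewrite e ltnn.
  + by apply: h3; apply: ne.
- move=> y z yS zS yz; rewrite !ffunE.
  move: yz; case: eqP => [->|/eqP yx]; first by rewrite (negbTE (mx _ zS)).
  case: eqP => [-> _|/eqP zx]; first by rewrite vk ltnS.
  by move=> yz; apply: h4 => //; apply: ne.
Qed.

Lemma card_fillingsS K k (S : {set 'I_K * 'I_K}) : (k < K)%N -> #|S| = k.+1 ->
  #|fillings k.+1 S| = (\sum_(x in S | [forall y in S, ~~ prec x y]) #|fillings k (S :\ x)|)%N.
Proof.
move=> kK cS.
rewrite -sum1_card (eq_bigr (fun T : {ffun 'I_K * 'I_K -> 'I_K.+1} => (\sum_(x in S) (T x == k.+1 :> nat))%N)); last first.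
  move=> T hT; have [x xS e] := fillings_has_max cS hT.
  rewrite (bigD1 x) //= e eqxx big1 // => y /andP[yS yx].
  case/fillingsP: hT => _ _ h3 _; apply/eqP; rewrite eqb0.
  by apply: contraNneq yx => ey; apply/eqP; apply: h3 => //; apply: val_inj; rewrite /= e ey.
rewrite exchange_big /= [RHS]big_mkcondr /=; apply: eq_bigr => x xS.
rewrite -card_fillings_at // -sum1_card big_mkcond [RHS]big_mkcond /=.
apply: eq_bigr => T _; case: ifP => hT; rewrite inE hT //=.
Qed.

Definition shape K (r : 'I_K -> nat) : {set 'I_K * 'I_K} := [set b : 'I_K * 'I_K | (b.2 < r b.1)%N].

Lemma card_shape K (r : 'I_K -> nat) : (forall i, r i <= K)%N -> #|shape r| = (\sum_i r i)%N.
Proof.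
move=> rK; rewrite -sum1_card (eq_bigl (fun b : 'I_K * 'I_K => true && (b.2 < r b.1)%N)); last first.
  by move=> b; rewrite inE.
rewrite -(pair_big_dep xpredT (fun i j : 'I_K => (j < r i)%N) (fun _ _ => 1%N)) /=.
apply: eq_bigr => i _; rewrite -(big_ord_widen _ (fun=> 1%N)) //.
by rewrite sum1_card card_ord.
Qed.

Lemma shape_max K (r : 'I_K -> nat) x : noninc r -> (forall i, r i <= K)%N ->
  (x \in shape r) && [forall y in shape r, ~~ prec x y] = corner r x.1 && (x.2.+1 == r x.1 :> nat).
Proof.
move=> /nonincP hr rK; rewrite inE; apply/andP/andP => -[].
  move=> xr /forall_inP mx.
  have e : x.2.+1 == r x.1.
    rewrite eqn_leq xr leqNgt; apply/negP => lt.
    have lt' : (x.2.+1 < K)%N by apply: leq_trans lt _.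
    have := mx (x.1, Ordinal lt'); rewrite inE /= lt => /(_ isT).
    by rewrite /prec /= eqxx ltnSn.
  split=> //; rewrite /corner (leq_trans _ xr) //=.
  apply/forallP => k; apply/implyP => /eqP ek; rewrite -(eqP e) ltnS leqNgt; apply/negP => lt.
  have := mx (k, x.2); rewrite inE /= lt => /(_ isT).
  by rewrite /prec /= eqxx ek ltnSn orbT.
move=> /andP[r0 /forallP c] /eqP e; split; first by rewrite -e.
apply/forall_inP => y; rewrite inE => yr; rewrite /prec negb_or !negb_and.
apply/andP; split.
  case: eqP => //= e1; rewrite -leqNgt -ltnS e; apply: leq_trans yr _.
  by rewrite e1.
case: eqP => //= e2; rewrite -leqNgt leqNgt; apply/negP => lt.
have lt' : (x.1.+1 < K)%N := leq_ltn_trans lt (ltn_ord y.1).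
have := c (Ordinal lt'); rewrite /= eqxx /= -e ltnS leqNgt => /negP; apply.
by rewrite e2; apply: leq_trans yr _; apply: hr.
Qed.

Lemma shape_corner K (r : 'I_K -> nat) (x : 'I_K * 'I_K) : x.2.+1 = r x.1 ->
  shape r :\ x = shape (row_dn r x.1).
Proof.
move=> e; apply/setP => y; rewrite !inE /row_dn.
case: (eqVneq y.1 x.1) => [e1|n1].
  rewrite e1 -e subn1 /= ltnS leq_eqVlt.
  have -> : (y != x) = (y.2 != x.2 :> nat).
    by rewrite -pair_eqE /pair_eq e1 eqxx.
  by case: eqP => [->|] //=; rewrite ltnn.
rewrite subn0; case: eqP => [E|_] //=.
by rewrite E eqxx in n1.
Qed.

Lemma noninc_dn K (r : 'I_K -> nat) i : noninc r -> corner r i -> noninc (row_dn r i).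
Proof.
move=> /nonincP hr /andP[r0 /forallP c]; apply/nonincP => j k jk; rewrite /row_dn.
case: (eqVneq j i) => [ji|_]; last by rewrite subn0 (leq_trans (leq_subr _ _)) ?hr.
case: (eqVneq k i) => [->|ki]; first by rewrite ji.
have lt : (i < k)%N by rewrite ltn_neqAle -ji jk andbT ji eq_sym.
have lt' : (i.+1 < K)%N := leq_ltn_trans lt (ltn_ord k).
rewrite subn0 subn1 -ltnS prednK ?ji //.
have := c (Ordinal lt'); rewrite /= eqxx; apply: leq_ltn_trans; exact: hr.
Qed.

Lemma sum_row_dn K (r : 'I_K -> nat) i : (0 < r i)%N -> ((\sum_k row_dn r i k).+1 = \sum_k r k)%N.
Proof.
move=> ri; rewrite (bigD1 i) //= [RHS](bigD1 i) //= /row_dn eqxx subn1 -addSn prednK //.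
by congr addn; apply: eq_bigr => j /negbTE ->; rewrite subn0.
Qed.

(** Both sides obey the same recursion: removing the greatest entry on the left, [fdet_down] on the
    right. The ambient [K] stays fixed, so the type of fillings does not change along the
    induction. *)
Lemma card_fillings_shape (F : numFieldType) K k (r : 'I_K -> nat) : (k <= K)%N ->
  noninc r -> (forall i, r i <= K)%N -> (\sum_i r i)%N = k ->
  #|fillings k (shape r)|%:R = k`!%:R * fdet F r.
Proof.
elim: k r => [|k IH] r kK hr rK sr.
  have r0 i : r i = 0%N.
    by apply/eqP; move/eqP: sr; rewrite sum_nat_eq0 => /forallP/(_ i).
  rewrite fdet0 // mulr1 fact0; congr (_%:R).
  have s0 x : x \in shape r = false by rewrite inE r0.
  suff -> : fillings 0 (shape r) = [set [ffun=> ord0]]%SET by rewrite cards1.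
  apply/setP => T; rewrite finset.in_set1; apply/fillingsP/eqP => [[h _ _ _]|->].
    by apply/ffunP => x; rewrite ffunE; apply: val_inj; apply/eqP; rewrite /= -leqn0 leqNgt -h s0.
  by split=> [x|x|x y|x y]; rewrite ?s0 // ffunE.
have cS : #|shape r| = k.+1 by rewrite card_shape.
rewrite card_fillingsS // natr_sum.
(* A corner row has exactly one removable box, in column [r i - 1]: the sum over boxes becomes a sum
   over rows. *)
pose h (i : 'I_K) : 'I_K * 'I_K := (i, insubd i (r i).-1).
rewrite (eq_bigl (fun x : 'I_K * 'I_K => corner r x.1 && (x.2.+1 == r x.1 :> nat))); last first.
  by move=> x; rewrite shape_max.
rewrite (reindex_onto h fst) /=; last first.
  move=> [i j] /= /andP[/andP[r0 _] /eqP e]; congr (_, _).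
  by apply: val_inj; rewrite val_insubd -e /= ltn_ord.
have hval i : corner r i -> (insubd i (r i).-1 : 'I_K).+1 = r i.
  move=> /andP[r0 _]; rewrite val_insubd.
  by rewrite (leq_trans _ (rK i)) prednK.
rewrite (eq_bigl (corner r)); last first.
  move=> i /=; rewrite eqxx andbT.
  by case: (boolP (corner r i)) => //= c; rewrite hval // eqxx.
rewrite (eq_bigr (fun i => k`!%:R * fdet F (row_dn r i))); last first.
  move=> i c; rewrite shape_corner ?hval //= IH //.
  - exact: ltnW.
  - exact: noninc_dn.
  - by move=> j; rewrite /row_dn (leq_trans (leq_subr _ _)).
  - by apply: succn_inj; rewrite sum_row_dn //; case/andP: c.
rewrite -mulr_sumr factS natrM [X in _ = X * _]mulrC -mulrA; congr (_ * _).
rewrite -[k.+1 in RHS]sr -fdet_down big_mkcond /=; apply: eq_bigr => i _.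
case: ifP => [c|/negbT c]; last by rewrite fdet_noncorner.
by rewrite fdet_corner //; case/andP: c.
Qed.

(** [lift ord0] shifts the entries up by one, which frees the value 0 for the boxes outside the
    diagram. *)
Lemma num_tableaux_fillings N (mu : N.-tuple 'I_N.+1) :
  num_tableaux mu = #|fillings N (shape (fun i : 'I_N => row_length mu i.+1))|.
Proof.
pose phi (T : {ffun box mu -> 'I_N}) : {ffun 'I_N * 'I_N -> 'I_N.+1} :=
  [ffun b => if insub b is Some b' then lift ord0 (T (b' : box mu)) else ord0].
have phi1 T (b : box mu) : phi T (val b) = lift ord0 (T b) by rewrite ffunE valK.
have phi0 T (b : 'I_N * 'I_N) : ~~ (b.2 < row_length mu b.1.+1)%N -> phi T b = ord0.
  by move=> h; rewrite ffunE insubN.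
have inS (b : 'I_N * 'I_N) : (b \in shape (fun i : 'I_N => row_length mu i.+1)) = (b.2 < row_length mu b.1.+1)%N.
  by rewrite inE.
have phiI : injective phi.
  move=> T U /ffunP e; apply/ffunP => b; have := e (val b); rewrite !phi1.
  exact: lift_inj.
rewrite /num_tableaux -(card_imset _ phiI); congr #|pred_of_set _|; apply/setP => U.
apply/imsetP/fillingsP => [[T]|[h1 h2 h3 h4]].
  rewrite inE => /and3P[/injectiveP TI /forallP c1 /forallP c2] ->; split.
  - move=> x; rewrite inS; case: (boolP (x.2 < _)%N) => h; last by rewrite phi0.
    by rewrite (phi1 T (Sub x h)).
  - by move=> x; rewrite -ltnS ltn_ord.
  - move=> x y; rewrite !inS => hx hy.
    rewrite (phi1 T (Sub x hx)) (phi1 T (Sub y hy)) => /lift_inj /TI.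
    by move/(congr1 val).
  - move=> x y; rewrite !inS => hx hy.
    rewrite (phi1 T (Sub x hx)) (phi1 T (Sub y hy)) => xy.
    rewrite /= /bump /= !add1n ltnS.
    case/orP: xy => xy.
      by have /forallP/(_ (Sub y hy))/implyP := c1 (Sub x hx); apply.
    by have /forallP/(_ (Sub y hy))/implyP := c2 (Sub x hx); apply.
have neq (b : box mu) : ord0 != U (val b).
  have := h1 (val b); rewrite inS (valP b) -(inj_eq val_inj) /=.
  by move/esym; rewrite lt0n eq_sym.
pose T : {ffun box mu -> 'I_N} := [ffun b => s2val (unlift_some (neq b))].
have TE b : U (val b) = lift ord0 (T b) by rewrite ffunE; case: (unlift_some (neq b)).
have Tlt b c : (T b < T c)%N = (U (val b) < U (val c))%N.
  by rewrite !TE /= /bump /= !add1n ltnS.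
exists T.
  rewrite inE; apply/and3P; split.
  - apply/injectiveP => b c e; apply: val_inj; apply: h3; rewrite ?inS ?(valP b) ?(valP c) //.
    by rewrite !TE e.
  - apply/forallP => b; apply/forallP => c; apply/implyP => bc; rewrite Tlt; apply: h4;
    by rewrite ?inS ?(valP b) ?(valP c) // /prec bc.
  - apply/forallP => b; apply/forallP => c; apply/implyP => bc; rewrite Tlt; apply: h4;
    by rewrite ?inS ?(valP b) ?(valP c) // /prec bc orbT.
apply/ffunP => x; case: (boolP (x.2 < row_length mu x.1.+1)%N) => h.
  by rewrite (phi1 T (Sub x h)) -TE.
rewrite phi0 //; apply: val_inj; apply/eqP; rewrite /= -leqn0 leqNgt -h1 inS.
exact: h.
Qed.

(** Rows are counted from 0, unlike in [row_length], and are empty from [M] on: diagrams in boxes of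
    different sizes are compared as functions on [nat]. *)
Definition rown M (mu : M.-tuple 'I_M.+1) (i : nat) : nat := nth 0%N [seq val r | r <- mu] i.

Lemma rown_tnth M (mu : M.-tuple 'I_M.+1) (i : 'I_M) : rown mu i = tnth mu i.
Proof.
rewrite /rown (nth_map (tnth mu i)) ?size_tuple // -tnth_nth.
by [].
Qed.

Lemma rown_default M (mu : M.-tuple 'I_M.+1) i : (M <= i)%N -> rown mu i = 0%N.
Proof. by move=> h; rewrite /rown nth_default // size_map size_tuple. Qed.

Lemma rown_le M (mu : M.-tuple 'I_M.+1) i : (rown mu i <= M)%N.
Proof.
case: (ltnP i M) => h; last by rewrite rown_default.
by rewrite (rown_tnth mu (Ordinal h)) -ltnS ltn_ord.
Qed.

Lemma rown_mktuple M (f : 'I_M -> nat) (i : 'I_M) : (f i <= M)%N ->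
  rown [tuple (inord (f j) : 'I_M.+1) | j < M] i = f i.
Proof. by move=> h; rewrite rown_tnth tnth_mktuple inordK // ltnS. Qed.

Lemma rown_inj M (mu nu : M.-tuple 'I_M.+1) : (forall i : 'I_M, rown mu i = rown nu i) -> mu = nu.
Proof.
by move=> h; apply: eq_from_tnth => i; apply: val_inj; rewrite /= -!rown_tnth h.
Qed.

(** * Summation over diagrams *)

(** The diagrams of size [N] inside the [M] by [M] box. The two parameters are separate because all
    diagrams of a box must share determinants of one size [M], which later tends to infinity. *)
Definition yd M N : {set M.-tuple 'I_M.+1} :=
  [set mu | noninc (fun i : 'I_M => rown mu i) && (\sum_(i < M) rown mu i == N)%N].

Lemma young_diagramE N : young_diagram N = yd N N.
Proof.
apply/setP => mu; rewrite !inE.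
have sz : size [seq val r | r <- mu] = N by rewrite size_map size_tuple.
congr (_ && _).
  apply/idP/nonincP => [srt i j ij|h].
    have tr : transitive geq by move=> x y z h1 h2; exact: leq_trans h2 h1.
    by apply: (sorted_leq_nth tr (@leqnn) 0%N srt); rewrite ?inE ?sz.
  apply/(sortedP 0%N) => i; rewrite sz => lt.
  exact: (h (Ordinal (ltnW lt)) (Ordinal lt) (leqnSn i)).
congr (_ == _); rewrite sumnE (big_nth 0%N) sz big_mkord.
by apply: eq_bigr => i _.
Qed.

Lemma yd_row_le M N (mu : M.-tuple 'I_M.+1) i : mu \in yd M N -> (rown mu i <= N)%N.
Proof.
rewrite inE => /andP[_ /eqP <-]; case: (ltnP i M) => h; last by rewrite rown_default.
by rewrite (bigD1 (Ordinal h)) //= leq_addr.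
Qed.

Lemma yd_row0 M N (mu : M.-tuple 'I_M.+1) i : mu \in yd M N -> (N <= i)%N -> rown mu i = 0%N.
Proof.
move=> hmu; case: (ltnP i M) => h; last by rewrite rown_default.
case: (posnP (rown mu i)) => // pos; move: hmu; rewrite inE => /andP[/nonincP hr /eqP <-].
have : (\sum_(j < M | (j <= i)%N) 1 <= \sum_(j < M) rown mu j)%N.
  rewrite big_mkcond /=; apply: leq_sum => j _; case: ifP => // ji.
  exact: leq_trans pos (hr j (Ordinal h) ji).
rewrite (eq_bigl (fun j : 'I_M => (j < i.+1)%N)) // -(big_ord_widen _ (fun=> 1%N)) //.
by rewrite sum1_card card_ord => h1 h2; have := leq_trans h1 h2; rewrite ltnn.
Qed.

Definition tuple_up M (i : 'I_M) (mu : M.-tuple 'I_M.+1) : M.-tuple 'I_M.+1 :=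
  [tuple inord (row_up (fun k : 'I_M => rown mu k) i k) | k < M].
Definition tuple_dn M (i : 'I_M) (mu : M.-tuple 'I_M.+1) : M.-tuple 'I_M.+1 :=
  [tuple inord (row_dn (fun k : 'I_M => rown mu k) i k) | k < M].

Lemma rown_dn M (i : 'I_M) (mu : M.-tuple 'I_M.+1) (k : 'I_M) :
  rown (tuple_dn i mu) k = row_dn (fun k : 'I_M => rown mu k) i k.
Proof. by rewrite rown_mktuple // /row_dn (leq_trans (leq_subr _ _)) ?rown_le. Qed.

Lemma rown_up M (i : 'I_M) (mu : M.-tuple 'I_M.+1) (k : 'I_M) : (rown mu i < M)%N ->
  rown (tuple_up i mu) k = row_up (fun k : 'I_M => rown mu k) i k.
Proof.
move=> h; rewrite rown_mktuple // /row_up; case: eqP => [->|_]; first by rewrite addn1.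
by rewrite addn0 rown_le.
Qed.

Lemma eq_noninc M (r s : 'I_M -> nat) : r =1 s -> noninc r = noninc s.
Proof. by move=> e; apply: eq_forallb => i; apply: eq_forallb => j; rewrite !e. Qed.

Lemma eq_corner M (r s : 'I_M -> nat) i : r =1 s -> corner r i = corner s i.
Proof. by move=> e; rewrite /corner !e; congr (_ && _); apply: eq_forallb => j; rewrite !e. Qed.

Lemma eq_fdet (F : fieldType) M (r s : 'I_M -> nat) : r =1 s -> fdet F r = fdet F s.
Proof. by move=> e; congr (\det _); apply/matrixP => i j; rewrite !mxE e. Qed.

Lemma noninc_up K (r : 'I_K -> nat) i : noninc r -> addable r i -> noninc (row_up r i).
Proof.
move=> /nonincP hr /forallP c; apply/nonincP => j k jk; rewrite /row_up.
case: (eqVneq k i) => [ki|_]; last by rewrite addn0 (leq_trans (hr _ _ jk)) ?leq_addr.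
case: (eqVneq j i) => [->|ji]; first by rewrite ki.
have lt : (j < i)%N by rewrite ltn_neqAle -ki jk andbT ki ji.
have lt' : (i.-1 < K)%N by apply: leq_ltn_trans (ltn_ord i); exact: leq_pred.
have := c (Ordinal lt'); rewrite /= prednK ?eqxx /=; last by apply: leq_ltn_trans lt.
rewrite addn0 addn1 ki => h; apply: leq_trans h _; apply: hr => /=.
by rewrite -ltnS prednK //; apply: leq_ltn_trans lt.
Qed.

Lemma corner_up K (r : 'I_K -> nat) i : noninc r -> corner (row_up r i) i.
Proof.
move=> /nonincP hr; rewrite /corner /row_up eqxx addn1 /=.
apply/forallP => k; apply/implyP => /eqP e.
have -> : (k == i) = false by apply/eqP => E; move: e; rewrite E => /eqP; rewrite ltn_eqF.
by rewrite addn0 ltnS hr // e leqnSn.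
Qed.

Lemma addable_dn K (r : 'I_K -> nat) i : noninc r -> corner r i -> addable (row_dn r i) i.
Proof.
move=> /nonincP hr /andP[r0 _]; apply/forallP => k; apply/implyP => /eqP e; rewrite /row_dn eqxx.
have -> : (k == i) = false by apply/eqP => E; move: e; rewrite E => /eqP; rewrite gtn_eqF.
by rewrite subn0 subn1 prednK // hr // -e leqnSn.
Qed.

Lemma sum_row_up K (r : 'I_K -> nat) i : (\sum_k row_up r i k = (\sum_k r k).+1)%N.
Proof.
rewrite (bigD1 i) //= [in RHS](bigD1 i) //= /row_up eqxx addn1 addSn.
by congr (addn _ _).+1; apply: eq_bigr => j /negbTE ->; rewrite addn0.
Qed.

Lemma fdet_up_last (F : numFieldType) M (r : 'I_M -> nat) : (0 < M)%N ->
  (forall i : 'I_M, i.+1 = M -> r i = 0%N) -> \sum_i fdet F (row_up r i) = fdet F r.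
Proof. by case: M r => // m r _ h; apply: fdet_up; apply: h. Qed.

(** Double counting of the pairs where [nu] is [mu] plus one box, by [fdet_down] from [nu] and by
    [fdet_up] from [mu]. [N < M] leaves the last row of [mu] empty and room in every row. *)
Lemma sum_fdet_up_down (F : numFieldType) M N : (N < M)%N ->
  N.+1%:R * \sum_(nu in yd M N.+1) fdet F (fun i : 'I_M => rown nu i) ^+ 2
  = \sum_(mu in yd M N) fdet F (fun i : 'I_M => rown mu i) ^+ 2.
Proof.
move=> NM.
pose rf (mu : M.-tuple 'I_M.+1) (i : 'I_M) := rown mu i.
transitivity (\sum_(nu in yd M N.+1) \sum_(i | corner (rf nu) i) fdet F (rf nu) * fdet F (row_dn (rf nu) i)).
  rewrite mulr_sumr; apply: eq_bigr => nu; rewrite inE => /andP[hr /eqP e].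
  rewrite expr2 mulrCA -{1}e -fdet_down -mulr_sumr; congr (_ * _).
  rewrite [RHS]big_mkcond /=; apply: eq_bigr => i _; case: ifP => [c|/negbT c].
    by rewrite fdet_corner //; case/andP: c.
  by rewrite fdet_noncorner.
transitivity (\sum_(mu in yd M N) \sum_(i | addable (rf mu) i) fdet F (row_up (rf mu) i) * fdet F (rf mu)); last first.
  apply: eq_bigr => mu hmu; rewrite -mulr_suml expr2; congr (_ * _).
  have hr : noninc (rf mu) by move: hmu; rewrite inE => /andP[].
  rewrite big_mkcond /= (eq_bigr (fun i => fdet F (row_up (rf mu) i))); last first.
    by move=> i _; case: ifP => // /negbT c; rewrite fdet_up_nonaddable.
  apply: fdet_up_last; first exact: leq_ltn_trans NM.
  by move=> i e; rewrite /rf (yd_row0 hmu) // -ltnS e.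
under eq_bigr do rewrite big_mkcond; under [RHS]eq_bigr do rewrite big_mkcond.
rewrite exchange_big [RHS]exchange_big /=; apply: eq_bigr => i _.
rewrite -!big_mkcondr /=.
rewrite (reindex_onto (tuple_up i) (tuple_dn i)) /=; last first.
  move=> nu /andP[_ c]; apply: rown_inj => k.
  have r0 : (0 < rown nu i)%N by case/andP: c.
  rewrite rown_up; last by rewrite rown_dn /row_dn eqxx subn1 prednK // rown_le.
  rewrite /row_up rown_dn /row_dn; case: eqP => [->|_]; last by rewrite subn0 addn0.
  by rewrite subnK.
have dnup mu : (rown mu i < M)%N -> tuple_dn i (tuple_up i mu) = mu.
  move=> h; apply: rown_inj => k; rewrite rown_dn /row_dn rown_up // /row_up.
  by rewrite addnK.
have upE mu : (rown mu i < M)%N -> rf (tuple_up i mu) =1 row_up (rf mu) i.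
  by move=> h k; rewrite /rf rown_up.
apply: eq_big => [mu|mu].
  apply/andP/andP => [[/andP[hy c] /eqP e]|[hy ha]].
    move: hy; rewrite !inE => /andP[hr hs]; rewrite -e.
    have rE : rf (tuple_dn i (tuple_up i mu)) =1 row_dn (rf (tuple_up i mu)) i.
      by move=> k; rewrite /rf rown_dn.
    split; last first.
      rewrite /addable (eq_forallb (P2 := fun k : 'I_M => (k.+1 == i :> nat) ==> (row_dn (rf (tuple_up i mu)) i i < row_dn (rf (tuple_up i mu)) i k)%N)); last by move=> k; rewrite !rE.
      exact: addable_dn.
    rewrite (eq_noninc rE) noninc_dn //= -(eqP (_ : N.+1.-1 == N)) // -(eqP hs).
    rewrite (eq_bigr _ (fun k _ => rE k)) -(sum_row_dn (r := rf (tuple_up i mu)) (i := i)) //.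
    by case/andP: c.
  have lt : (rown mu i < M)%N by apply: leq_ltn_trans (yd_row_le _ hy) NM.
  rewrite dnup // eqxx; split=> //; move: hy; rewrite !inE => /andP[hr /eqP hs].
  rewrite (eq_noninc (upE _ lt)) noninc_up //= (eq_corner _ (upE _ lt)) corner_up // andbT.
  by rewrite (eq_bigr _ (fun k _ => upE _ lt k)) sum_row_up hs.
move=> /andP[_ /eqP e].
have lt : (rown mu i < M)%N.
  rewrite ltn_neqAle rown_le andbT; apply/eqP => E.
  have := congr1 (fun nu => rown nu i) e; rewrite rown_dn /row_dn eqxx E.
  rewrite rown_tnth tnth_mktuple /row_up eqxx E addn1.
  (* [M.+1] is out of range, so [inord] yields some [v <= M]; removing a box from it cannot give
     back length [M]. *)
  move: (inord M.+1 : 'I_M.+1) => v /=.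
  by have := ltn_ord v; have := ltn_ord i; lia.
have dE : row_dn (rf (tuple_up i mu)) i =1 rf mu.
  by move=> k; rewrite /row_dn (upE _ lt) /row_up addnK.
by rewrite (eq_fdet _ (upE _ lt)) (eq_fdet _ dE).
Qed.

(** The identity that the squares of the [d_mu] sum to [N!], divided by [N!^2]: Plancherel measure
    has total mass 1. *)
Lemma sum_fdet_sqr (F : numFieldType) M N : (N <= M)%N ->
  \sum_(mu in yd M N) fdet F (fun i : 'I_M => rown mu i) ^+ 2 = (N`!%:R)^-1.
Proof.
elim: N => [_|N IH NM].
  pose z : M.-tuple 'I_M.+1 := [tuple inord 0 | i < M].
  have z0 (i : 'I_M) : rown z i = 0%N by rewrite (@rown_mktuple M (fun=> 0%N)).
  rewrite (big_pred1 z) => [|mu].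
    by rewrite fdet0 // expr1n invr1.
  rewrite /= inE; apply/andP/eqP => [[_]|->].
    rewrite sum_nat_eq0 => /forallP h; apply: rown_inj => i; rewrite z0.
    by apply/eqP; exact: h.
  split; last by rewrite big1.
  by apply/nonincP => i j _; rewrite !z0.
have n0 : N.+1%:R != 0 :> F by rewrite pnatr_eq0.
apply: (mulfI n0); rewrite sum_fdet_up_down // IH 1?ltnW //.
by rewrite factS natrM invfM mulrA mulfV // mul1r.
Qed.

Lemma fdet_padS (F : numFieldType) M (r : nat -> nat) : r M = 0%N ->
  fdet F (fun i : 'I_M.+1 => r i) = fdet F (fun i : 'I_M => r i).
Proof.
move=> r0; rewrite /fdet (expand_det_row _ ord_max) (bigD1 ord_max) //= big1 ?addr0; last first.
  move=> j jM; rewrite mxE /= r0 add0n /rfact leqNgt.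
  have -> : (j < M)%N by rewrite ltn_neqAle -ltnS ltn_ord andbT.
  by rewrite mul0r.
rewrite mxE /= r0 add0n /rfact leqnn subnn invr1 mul1r /cofactor.
rewrite addnn -mul2n exprM sqrrN expr1n expr1n mul1r; congr (\det _).
by apply/matrixP => i j; rewrite !mxE !lift_max.
Qed.

Lemma fdet_pad (F : numFieldType) M M' (r : nat -> nat) : (M <= M')%N ->
  (forall i, (M <= i)%N -> r i = 0%N) ->
  fdet F (fun i : 'I_M' => r i) = fdet F (fun i : 'I_M => r i).
Proof.
move=> /subnKC <- h; elim: (M' - M)%N => [|d IH]; first by rewrite addn0.
by rewrite addnS fdet_padS // h // leq_addr.
Qed.

Lemma yd_noninc M N (mu : M.-tuple 'I_M.+1) i j : mu \in yd M N -> (i <= j)%N ->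
  (rown mu j <= rown mu i)%N.
Proof.
rewrite inE => /andP[/nonincP hr _] ij; case: (ltnP j M) => h; last by rewrite rown_default.
exact: (hr (Ordinal (leq_ltn_trans ij h)) (Ordinal h)).
Qed.

(** The two conditions on the right say that row [M] is empty and that the first row has length at
    most [M], that is, that the diagram fits into the smaller box. *)
Lemma sum_yd_pad (V : nmodType) M M' N (W : (nat -> nat) -> V) : (M <= M')%N ->
  \sum_(mu in yd M N) W (rown mu) =
  \sum_(mu in yd M' N | (rown mu M == 0%N) && (rown mu 0 <= M)%N) W (rown mu).
Proof.
move=> MM.
pose pad (mu : M.-tuple 'I_M.+1) : M'.-tuple 'I_M'.+1 := [tuple inord (rown mu i) | i < M'].
pose res (mu : M'.-tuple 'I_M'.+1) : M.-tuple 'I_M.+1 := [tuple inord (rown mu i) | i < M].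
have padE mu : rown (pad mu) = rown mu.
  apply/funext => i; case: (ltnP i M') => h; last by rewrite !rown_default // (leq_trans MM).
  by rewrite (@rown_mktuple M' (fun i => rown mu i) (Ordinal h)) // (leq_trans (rown_le _ _)).
have resE mu : mu \in yd M' N -> rown mu M == 0%N -> (rown mu 0 <= M)%N -> rown (res mu) = rown mu.
  move=> hy /eqP rM r0; apply/funext => i; case: (ltnP i M) => h.
    rewrite (@rown_mktuple M (fun i => rown mu i) (Ordinal h)) //.
    by apply: leq_trans r0; apply: yd_noninc hy _.
  rewrite rown_default //; apply/esym/eqP; rewrite -leqn0 -rM.
  exact: yd_noninc hy _.
rewrite [RHS](reindex_onto pad res) /=; last first.
  move=> mu /andP[hy /andP[rM r0]]; apply: rown_inj => i.
  by rewrite padE resE.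
apply: eq_big => [mu|mu _]; last by rewrite padE.
have sE : (\sum_(i < M') rown (pad mu) i = \sum_(i < M) rown mu i)%N.
  rewrite padE (big_ord_widen _ (fun i => rown mu i) MM) [RHS]big_mkcond /=.
  by apply: eq_bigr => i _; case: ltnP => // h; rewrite rown_default.
apply/idP/andP => [hy|[/andP[hy _] /eqP e]].
  have hp : pad mu \in yd M' N.
    move: (hy); rewrite !inE sE => /andP[_ ->]; rewrite andbT.
    by apply/nonincP => i j ij; rewrite padE; apply: yd_noninc hy ij.
  have h0 : rown (pad mu) M == 0%N by rewrite padE rown_default.
  have h1 : (rown (pad mu) 0 <= M)%N by rewrite padE rown_le.
  rewrite hp h0 h1; split=> //; apply/eqP/rown_inj => i.
  by rewrite resE // padE.
move: (hy); rewrite !inE sE => /andP[_ ->]; rewrite andbT.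
by apply/nonincP => i j ij; have := yd_noninc hy ij; rewrite padE.
Qed.

(** * Poissonized sums over diagrams in a box and the cutoff generating function *)

Section Weights.
Variable R : realType.
Implicit Types (P : (nat -> nat) -> bool) (lambda t : R).

(** This is [(d_mu / N!)^2], so that [level_sum P N N] is the Plancherel probability of [P] divided
    by [N!], ready for the Poisson weights. *)
Definition dim2 M (r : nat -> nat) : R := fdet R (fun i : 'I_M => r i) ^+ 2.

Definition level_sum P M N : R := \sum_(mu in yd M N | P (rown mu)) dim2 M (rown mu).

Lemma dim2_ge0 M r : 0 <= dim2 M r. Proof. exact: sqr_ge0. Qed.

Lemma level_sum_ge0 P M N : 0 <= level_sum P M N.
Proof. by apply: sumr_ge0 => mu _; apply: dim2_ge0. Qed.

Lemma level_sum_pad P M M' N : (M <= M')%N -> level_sum P M N =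
  \sum_(mu in yd M' N | [&& rown mu M == 0, rown mu 0 <= M & P (rown mu)]%N) dim2 M' (rown mu).
Proof.
move=> MM; rewrite /level_sum big_mkcondr /=.
under eq_bigr => mu _.
  rewrite /dim2 -(fdet_pad _ MM) => [|i]; last exact: rown_default.
  over.
rewrite (sum_yd_pad N (fun r => if P r then dim2 M' r else 0) MM) -big_mkcondr.
by apply: eq_bigl => mu; rewrite -!andbA.
Qed.

Lemma level_sum_ge P M N : (N <= M)%N -> level_sum P M N = level_sum P N N.
Proof.
move=> NM; rewrite [RHS](level_sum_pad _ _ NM); apply: eq_bigl => mu.
case: (boolP (mu \in yd M N)) => //= hy.
by rewrite (yd_row0 hy) // (yd_row_le _ hy).
Qed.

Lemma level_sum_le P M N : level_sum P M N <= level_sum P N N.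
Proof.
case: (leqP N M) => h; first by rewrite level_sum_ge.
rewrite (level_sum_pad _ _ (ltnW h)) /level_sum big_mkcond [leRHS]big_mkcond /=.
apply: ler_sum => mu _; case: (mu \in _) => //=; case: (P _); rewrite ?andbF ?andbT //.
by case: ifP => _ //; apply: dim2_ge0.
Qed.

Lemma level_sum_bound P N : level_sum P N N <= (N`!%:R)^-1.
Proof.
rewrite -(sum_fdet_sqr R (leqnn N)) /level_sum big_mkcondr /=.
by apply: ler_sum => mu _; case: ifP => // _; apply: dim2_ge0.
Qed.

Lemma level_sumT N : level_sum (fun=> true) N N = (N`!%:R)^-1.
Proof. by rewrite -(sum_fdet_sqr R (leqnn N)) /level_sum; apply: eq_bigl => mu; rewrite andbT. Qed.

Definition tot M (r : nat -> nat) : nat := (\sum_(i < M) r i)%N.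
Definition ydiag M : {set M.-tuple 'I_M.+1} := [set mu | noninc (fun i : 'I_M => rown mu i)].

Definition box_sum P lambda M : R :=
  \sum_(mu in ydiag M | P (rown mu)) lambda ^+ tot M (rown mu) * dim2 M (rown mu).

Lemma box_sumE P lambda M :
  box_sum P lambda M = \sum_(N < (M * M).+1) lambda ^+ N * level_sum P M N.
Proof.
have lt (mu : M.-tuple 'I_M.+1) : (tot M (rown mu) < (M * M).+1)%N.
  rewrite ltnS /tot; apply: (@leq_trans (\sum_(i < M) M)%N).
    by apply: leq_sum => i _; apply: rown_le.
  by rewrite sum_nat_const card_ord.
rewrite /box_sum (partition_big (fun mu : M.-tuple 'I_M.+1 => Ordinal (lt mu)) xpredT) //=.
apply: eq_bigr => N _; rewrite mulr_sumr; apply: eq_big => [mu|mu].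
  by rewrite !inE -(inj_eq val_inj) /= -!andbA; congr (_ && _); rewrite andbC.
by move=> /andP[_ /eqP <-].
Qed.

Definition full_sum P lambda : nat -> R := series (fun N => lambda ^+ N * level_sum P N N).

Lemma full_sum_cvg P lambda : 0 <= lambda -> cvgn (full_sum P lambda).
Proof.
move=> l0; apply: nondecreasing_is_cvgn.
  by apply: nondecreasing_series => k _ _; rewrite mulr_ge0 ?exprn_ge0 ?level_sum_ge0.
exists (expR lambda) => _ [k _ <-].
apply: le_trans (nondecreasing_cvgn_le _ (is_cvg_series_exp_coeff lambda) k); last first.
  by apply: nondecreasing_series => j _ _; apply: exp_coeff_ge0.
rewrite /full_sum /series /=; apply: ler_sum => N _; rewrite /exp_coeff.
by rewrite ler_wpM2l ?exprn_ge0 ?level_sum_bound.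
Qed.

(** Every diagram with at most [M] boxes fits into the [M] by [M] box, and a diagram in this box has
    at most [M * M] boxes. *)
Lemma box_sum_bounds P lambda M : 0 <= lambda ->
  full_sum P lambda M.+1 <= box_sum P lambda M <= full_sum P lambda (M * M).+1.
Proof.
move=> l0; rewrite box_sumE /full_sum /series /= !big_mkord; apply/andP; split; last first.
  by apply: ler_sum => N _; rewrite ler_wpM2l ?exprn_ge0 ?level_sum_le.
have le : (M.+1 <= (M * M).+1)%N by case: (M) => // m; rewrite ltnS leq_pmull.
rewrite (big_ord_widen _ (fun N => lambda ^+ N * level_sum P N N) le) big_mkcond /=.
apply: ler_sum => N _; case: ltnP => h; last by rewrite mulr_ge0 ?exprn_ge0 ?level_sum_ge0.
by rewrite level_sum_ge.
Qed.

Lemma box_sum_cvg P lambda : 0 <= lambda ->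
  (box_sum P lambda M @[M --> \oo] --> limn (full_sum P lambda))%classic.
Proof.
move=> l0; have hc := @full_sum_cvg P lambda l0.
apply: (@squeeze_cvgr _ _ _ _ (fun M => full_sum P lambda M.+1) (fun M => full_sum P lambda (M * M).+1)).
- by near=> M; apply: box_sum_bounds.
- by rewrite (cvg_shiftS (full_sum P lambda)).
- apply: (@cvg_comp _ _ _ (fun M => (M * M).+1) (full_sum P lambda) _ \oo%classic) => //.
  apply/cvgnyPge => A; near=> M.
  have : (A <= M)%N by near: M; apply: nbhs_infty_ge.
  by move=> h; rewrite (leq_trans h) // leqW // -{1}(muln1 M) leq_mul2l; case: (M).
Unshelve. all: end_near. Qed.

Lemma full_sumT lambda : limn (full_sum (fun=> true) lambda) = expR lambda.
Proof.
rewrite /expR /full_sum; congr (limn (series _)); apply/funext => N.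
by rewrite level_sumT.
Qed.

Lemma num_tableaux_fdet N (mu : N.-tuple 'I_N.+1) : mu \in yd N N ->
  (num_tableaux mu)%:R = N`!%:R * fdet R (fun i : 'I_N => rown mu i).
Proof.
move=> hy; rewrite num_tableaux_fillings; apply: card_fillings_shape => //.
- by move: hy; rewrite inE => /andP[].
- by move=> i; apply: rown_le.
- by move: hy; rewrite inE => /andP[_ /eqP].
Qed.

Lemma phiE k n lambda : 0 <= lambda ->
  phi k n lambda = expR (- lambda) * limn (full_sum (fun r => (r k.-1 <= n)%N) lambda).
Proof.
move=> l0; rewrite /phi.
have -> : (fun N => expR (- lambda) * lambda ^+ N / N`!%:R * row_cdf R k n N) =
  expR (- lambda) *: (fun N => lambda ^+ N * level_sum (fun r => (r k.-1 <= n)%N) N N).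
  apply/funext => N; rewrite /= -[RHS]/(expR (- lambda) * (lambda ^+ N * level_sum (fun r => (r k.-1 <= n)%N) N N)).
  rewrite -!mulrA; congr (_ * (_ * _)).
  have n0 : N`!%:R != 0 :> R by rewrite pnatr_eq0 -lt0n fact_gt0.
  rewrite /row_cdf; case: eqP => [->|_].
    rewrite mulr1 -(level_sumT 0) /level_sum; apply: eq_bigl => mu.
    by rewrite [rown mu k.-1]rown_default.
  rewrite mulr_sumr /level_sum young_diagramE; apply: eq_big => // mu /andP[hy _].
  by rewrite /plancherel num_tableaux_fdet // /dim2 exprMn; field.
rewrite seriesZ; apply: cvg_lim => //.
apply: (@cvgM _ _ _ _ (fun=> expR (- lambda)) (full_sum (fun r => (r k.-1 <= n)%N) lambda)).
  exact: cvg_cst.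
exact: full_sum_cvg.
Qed.

Definition cutoff_weight n t M (r : nat -> nat) : R :=
  \prod_(i < M) (if (n + i < r i)%N then 1 - t else 1).

Definition box_gf n lambda t M : R :=
  \sum_(mu in ydiag M) lambda ^+ tot M (rown mu) * dim2 M (rown mu) * cutoff_weight n t M (rown mu).

(** As [r i - i] decreases strictly, the rows with [r i > n + i] form an initial segment, and the
    weight is [1 - t] to the power of its length. Lengths 0 and 1 are reproduced exactly by the
    linear expression; from 2 on, both indicators vanish and the weight is at most
    [(1 - t) ^+ 2]. *)
Lemma cutoff_weight_quad n t M (r : nat -> nat) : `|1 - t| <= 1 ->
  (forall i j, (i <= j)%N -> (r j <= r i)%N) -> (forall i, (M <= i)%N -> r i = 0%N) ->
  `|cutoff_weight n t M r - (r 0 <= n)%N%:R - (1 - t) * ((r 1 <= n.+1)%N%:R - (r 0 <= n)%N%:R)| <= (1 - t) ^+ 2.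
Proof.
move=> t1 hr hM.
have tail (p : nat) : (r p <= n + p)%N ->
  \prod_(i < M | (p <= i)%N) (if (n + i < r i)%N then 1 - t else 1) = 1 :> R.
  move=> hp; apply: big1 => i pi; rewrite ltnNge.
  by rewrite (leq_trans (hr _ _ pi)) // (leq_trans hp) // leq_add2l.
have split_ (p : nat) : (n + p < r p)%N ->
  \prod_(i < M | (p <= i)%N) (if (n + i < r i)%N then 1 - t else 1) =
  (1 - t) * \prod_(i < M | (p.+1 <= i)%N) (if (n + i < r i)%N then 1 - t else 1) :> R.
  move=> hp; have pM : (p < M)%N by rewrite ltnNge; apply/negP => /hM e; rewrite e in hp.
  rewrite (bigD1 (Ordinal pM)) //= hp; congr (_ * _); apply: eq_bigl => i.
  by rewrite -(inj_eq val_inj) /= ltn_neqAle andbC eq_sym.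
have -> : cutoff_weight n t M r = \prod_(i < M | (0 <= i)%N) (if (n + i < r i)%N then 1 - t else 1) by [].
case: (leqP (r 0) n) => h0.
  rewrite tail ?addn0 //.
  have -> : (r 1 <= n.+1)%N by rewrite (leq_trans (hr 0%N 1%N _)) // ltnW.
  by rewrite !subrr mulr0 subr0 normr0 sqr_ge0.
rewrite split_ ?addn0 //; case: (leqP (r 1) n.+1) => h1.
  by rewrite tail ?addn1 // !subr0 !mulr1 subrr normr0 sqr_ge0.
rewrite split_ ?addn1 // !subr0 mulr0 subr0 mulrA -expr2 normrM ger0_norm ?sqr_ge0 //.
rewrite ler_piMr ?sqr_ge0 // normr_prod.
rewrite -[leRHS](expr1n _ #|[pred i : 'I_M | (1 < i)%N]|) -prodr_const; apply: ler_prod => i _.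
by rewrite normr_ge0 /=; case: ifP; rewrite ?normr1.
Qed.

Lemma box_gf_quad n lambda t M : 0 <= lambda -> `|1 - t| <= 1 ->
  `|box_gf n lambda t M - box_sum (fun r => (r 0 <= n)%N) lambda M
    - (1 - t) * (box_sum (fun r => (r 1 <= n.+1)%N) lambda M - box_sum (fun r => (r 0 <= n)%N) lambda M)|
  <= (1 - t) ^+ 2 * box_sum (fun=> true) lambda M.
Proof.
move=> l0 t1.
have E P : box_sum P lambda M = \sum_(mu in ydiag M) lambda ^+ tot M (rown mu) * dim2 M (rown mu) * (P (rown mu))%:R.
  rewrite /box_sum big_mkcondr /=; apply: eq_bigr => mu _.
  by case: (P _); rewrite ?mulr1 ?mulr0.
rewrite !E /box_gf -!sumrB mulr_sumr -sumrB mulr_sumr.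
apply: le_trans (ler_norm_sum _ _ _) _; apply: ler_sum => mu hy.
have X0 : 0 <= lambda ^+ tot M (rown mu) * dim2 M (rown mu).
  by apply: mulr_ge0; [exact: exprn_ge0 | exact: dim2_ge0].
set X := _ * dim2 _ _ in X0 *.
rewrite (_ : _ - _ - _ = X * (cutoff_weight n t M (rown mu) - (rown mu 0 <= n)%N%:R -
  (1 - t) * ((rown mu 1 <= n.+1)%N%:R - (rown mu 0 <= n)%N%:R))); last by ring.
rewrite normrM ger0_norm // mulr1 [leRHS]mulrC; apply: ler_wpM2l => //.
have hy' : mu \in yd M (tot M (rown mu)) by move: hy; rewrite !inE eqxx andbT.
apply: cutoff_weight_quad => // [i j ij|i]; last exact: rown_default.
exact: yd_noninc hy' ij.
Qed.

End Weights.

(** * Gram determinants *)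

Definition expc (F : fieldType) (a : F) (p q : nat) : F :=
  if (q <= p)%N then a ^+ (p - q) / (p - q)`!%:R else 0.

Lemma expc_shift (F : fieldType) (a : F) p q d : expc a (p + d) (q + d) = expc a p q.
Proof. by rewrite /expc leq_add2r subnDr. Qed.

Lemma det_scale (F : comNzRingType) M (A : 'M[F]_M) (u v : 'I_M -> F) :
  \det (\matrix_(i, j) (u i * A i j * v j)) = (\prod_i u i) * \det A * \prod_i v i.
Proof.
have -> : \matrix_(i, j) (u i * A i j * v j) = diag_mx (\row_i u i) *m A *m diag_mx (\row_i v i).
  apply/matrixP => i j; rewrite mxE mul_mx_diag mul_diag_mx !mxE.
  by [].
rewrite !det_mulmx !det_diag; congr (_ * _ * _); apply: eq_bigr => i _; by rewrite mxE.
Qed.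

(** Row [i] carries the factor [a ^ (r i - i)] and column [j] the factor [a ^ j]; the staircase
    powers cancel. *)
Lemma det_expc (F : fieldType) (a : F) M (r : 'I_M -> nat) : a != 0 ->
  \det (\matrix_(i, j) expc a (r i + j) i) = a ^+ (\sum_i r i)%N * fdet F r.
Proof.
move=> a0.
have -> : \matrix_(i, j) expc a (r i + j) i =
   \matrix_(i, j) (a ^+ r i / a ^+ i * (\matrix_(i, j) rfact F (r i + j) i) i j * a ^+ j) :> 'M[F]_M.
  apply/matrixP => i j; rewrite !mxE /expc /rfact; case: ifP => h; last by rewrite mulr0 mul0r.
  rewrite [RHS]mulrAC; congr (_ * _).
  have ai : a ^+ i != 0 by rewrite expf_neq0.
  by apply: (mulIf ai); rewrite -exprD subnK // exprD [RHS]mulrAC divfK.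
rewrite det_scale big_split /= prodfV mulrAC -/(fdet F r).
have ai : \prod_(i < M) a ^+ i != 0 by apply/prodf_neq0 => i _; rewrite expf_neq0.
by rewrite divfK // prodrXr.
Qed.

Lemma decr_step M (l : nat -> nat) : (forall i j, (i < j < M)%N -> (l j < l i)%N) ->
  forall i j, (i <= j < M)%N -> (l j + (j - i) <= l i)%N.
Proof.
move=> h i j; elim: j => [|j IH] /andP[ij jM].
  by move: ij; rewrite leqn0 => /eqP ->; rewrite addn0.
move: ij; rewrite leq_eqVlt => /orP[/eqP ->|ij]; first by rewrite subnn addn0.
have := IH; rewrite -ltnS ij ltnW //= => /(_ isT).
have := h j j.+1; rewrite ltnSn jM => /(_ isT).
by lia.
Qed.

(** The beta numbers (positions of the particles of the Maya diagram): adding a staircase turns a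
    diagram in the box into an [M]-subset of the first [2M] integers. *)
Definition beta_num M (mu : M.-tuple 'I_M.+1) (i : 'I_M) : nat := (rown mu i + (M - i.+1))%N.

Lemma beta_num_lt M (mu : M.-tuple 'I_M.+1) (i : 'I_M) : (beta_num mu i < M + M)%N.
Proof. by rewrite /beta_num; have := rown_le mu i; have := ltn_ord i; lia. Qed.

Definition beta_ord M (mu : M.-tuple 'I_M.+1) : {ffun 'I_M -> 'I_(M + M)} :=
  [ffun i => Ordinal (beta_num_lt mu i)].

Lemma beta_num_decr M (mu : M.-tuple 'I_M.+1) (i j : 'I_M) : mu \in ydiag M -> (i < j)%N ->
  (beta_num mu j < beta_num mu i)%N.
Proof.
rewrite inE => /nonincP hr ij; have := hr i j (ltnW ij); rewrite /beta_num.
by have := ltn_ord i; have := ltn_ord j; lia.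
Qed.

Lemma beta_ord_inj M (mu : M.-tuple 'I_M.+1) : mu \in ydiag M -> injective (beta_ord mu).
Proof.
move=> hy i j /(congr1 val); rewrite /= !ffunE /= => e.
apply/eqP; case: (ltngtP i j) => h; last by apply/eqP/val_inj.
  by have := beta_num_decr hy h; rewrite e ltnn.
by have := beta_num_decr hy h; rewrite e ltnn.
Qed.

Definition beta_set M (mu : M.-tuple 'I_M.+1) : {set 'I_(M + M)} := beta_ord mu @: [set: 'I_M]%SET.

Lemma sorted_beta M (mu : M.-tuple 'I_M.+1) : mu \in ydiag M ->
  sorted gtn [seq val (beta_ord mu i) | i <- enum 'I_M].
Proof.
move=> hy; apply/(sortedP 0%N) => i; rewrite size_map size_enum_ord => lt.
have E k (h : (k < M)%N) : nth 0%N [seq val (beta_ord mu i) | i <- enum 'I_M] k = beta_num mu (Ordinal h).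
  rewrite (nth_map (Ordinal h)) ?size_enum_ord // ffunE /=; congr beta_num.
  by apply: val_inj; rewrite /= nth_enum_ord.
by rewrite (E _ (ltnW lt)) (E _ lt) /= beta_num_decr.
Qed.

Lemma beta_set_inj M : {in ydiag M &, injective (@beta_set M)}.
Proof.
move=> mu nu hm hn e.
have : [seq val (beta_ord mu i) | i <- enum 'I_M] = [seq val (beta_ord nu i) | i <- enum 'I_M].
  apply: (@irr_sorted_eq _ gtn).
  - by move=> x y z h1 h2; apply: ltn_trans h2 h1.
  - by move=> x; rewrite /= ltnn.
  - exact: sorted_beta.
  - exact: sorted_beta.
  move=> x; apply/mapP/mapP => -[i _ ->].
    have : beta_ord mu i \in beta_set nu by rewrite -e imset_f.
    by case/imsetP => j _ ->; exists j; rewrite ?mem_enum.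
  have : beta_ord nu i \in beta_set mu by rewrite e imset_f.
  by case/imsetP => j _ ->; exists j; rewrite ?mem_enum.
move/eq_in_map => h; apply: rown_inj => i.
by have := h i; rewrite mem_enum => /(_ isT); rewrite !ffunE /= /beta_num => /addIn.
Qed.

(** The inverse map: the image of [f] is sorted decreasingly and the staircase is subtracted.
    [decr_step] keeps the resulting lengths between 0 and [M]. *)
Lemma beta_set_surj M (f : {ffun 'I_M -> 'I_(M + M)}) : injective f ->
  exists2 mu, mu \in ydiag M & beta_set mu = f @: [set: 'I_M]%SET.
Proof.
move=> fI.
pose s := sort geq [seq val (f i) | i <- enum 'I_M].
have sz : size s = M by rewrite size_sort size_map size_enum_ord.
have srt : sorted gtn s.
  rewrite gtn_sorted_uniq_geq sort_sorted; last by move=> x y; apply: leq_total.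
  rewrite sort_uniq map_inj_uniq ?enum_uniq // => i j /val_inj; exact: fI.
have tr : transitive gtn by move=> x y z h1 h2; apply: ltn_trans h2 h1.
pose l i := nth 0%N s i.
have ldec i j : (i < j < M)%N -> (l j < l i)%N.
  move=> /andP[ij jM]; apply: (sorted_ltn_nth tr 0%N srt) => //; rewrite inE sz //.
  exact: ltn_trans jM.
have lst := decr_step ldec.
have llt i : (i < M)%N -> (l i < M + M)%N.
  move=> iM; have : l i \in s by rewrite mem_nth ?sz.
  by rewrite mem_sort => /mapP[j _ ->]; apply: ltn_ord.
have lup i : (i < M)%N -> (l i <= M + (M - i.+1))%N.
  move=> iM; have := lst 0%N i; rewrite iM => /(_ isT).
  by have := llt 0%N (leq_ltn_trans (leq0n _) iM); lia.
have llo i : (i < M)%N -> (M - i.+1 <= l i)%N.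
  move=> iM; have := lst i M.-1; have -> : (i <= M.-1 < M)%N by lia.
  by move=> /(_ isT); lia.
pose mu : M.-tuple 'I_M.+1 := [tuple inord (l i - (M - i.+1)) | i < M].
have muE (i : 'I_M) : rown mu i = (l i - (M - i.+1))%N.
  by rewrite (@rown_mktuple M (fun i => l i - (M - i.+1))%N) // leq_subLR addnC lup.
have bE (i : 'I_M) : beta_num mu i = l i by rewrite /beta_num muE subnK // llo.
have hy : mu \in ydiag M.
  rewrite inE; apply/nonincP => i j ij; rewrite !muE.
  by have := lst i j; rewrite ij ltn_ord => /(_ isT); have := ltn_ord j; lia.
exists mu => //; apply/eqP; rewrite eqEcard !card_imset //; last exact: beta_ord_inj.
rewrite leqnn andbT; apply/fintype.subsetP => x /imsetP[i _ ->].
have : l i \in s by rewrite mem_nth ?sz.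
rewrite mem_sort => /mapP[j _ e]; apply/imsetP; exists j => //.
by apply: val_inj; rewrite ffunE /= bE e.
Qed.

Lemma sum_inj_beta (V : nmodType) M (F : {ffun 'I_M -> 'I_(M + M)} -> V) :
  (forall (f : {ffun 'I_M -> 'I_(M + M)}) (s : 'S_M), F [ffun i => f (s i)] = F f) ->
  (forall f : {ffun 'I_M -> 'I_(M + M)}, ~~ injectiveb f -> F f = 0) ->
  \sum_f F f = (\sum_(mu in ydiag M) F (beta_ord mu)) *+ M`!.
Proof.
move=> hs h0.
rewrite (bigID (fun f : {ffun 'I_M -> 'I_(M + M)} => injectiveb f)) /= [X in _ + X]big1 ?addr0; last first.
  by move=> f; apply: h0.
rewrite (partition_big (fun f : {ffun 'I_M -> 'I_(M + M)} => f @: [set: 'I_M]%SET)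
   (mem [set beta_set mu | mu in ydiag M])) /=; last first.
  move=> f /injectiveP /beta_set_surj[mu hy <-]; exact: imset_f.
rewrite big_imset /=; last exact: beta_set_inj.
rewrite -sumrMnl; apply: eq_bigr => mu hy.
apply: sum_inj_image; first exact: beta_ord_inj.
move=> g gI /esym e; have [s hg] := inj_same_image (beta_ord_inj hy) gI e.
rewrite -(hs (beta_ord mu) s); congr F; apply/ffunP => i; rewrite hg.
by rewrite [RHS]ffunE.
Qed.

Section GF.
Variable R : realType.
Implicit Types a t : R.

(** The index [l] runs over the possible beta numbers. In this coordinate the cutoff [n + i < r i]
    reads [M + n <= l] whatever the row, so the weight is a product over points and can be absorbed
    into the sum. *)
Definition gram n a t M : 'M[R]_M := \matrix_(j, j')
  \sum_(l < M + M) (if (M + n <= l)%N then 1 - t else 1) *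
     (expc a (l + j.+1) M * expc a (l + j'.+1) M).

(** Each of the two determinants in Cauchy-Binet brings [a] to the size of the diagram, hence the
    parameter [a ^+ 2]. *)
Lemma box_gf_det n a t M : 0 < a -> box_gf n (a ^+ 2) t M = \det (gram n a t M).
Proof.
move=> a0.
pose g (l : 'I_(M + M)) : R := if (M + n <= l)%N then 1 - t else 1.
pose B : 'M[R]_(M + M, M) := \matrix_(l, j) expc a (l + j.+1) M.
pose A : 'M[R]_(M + M, M) := \matrix_(l, j) (g l * B l j).
have fM0 : (M`!%:R : R) != 0 by rewrite pnatr_eq0 -lt0n fact_gt0.
apply: (mulIf fM0); rewrite !mulr_natr.
have -> : gram n a t M = A^T *m B.
  by apply/matrixP => j j'; rewrite !mxE; apply: eq_bigr => l _; rewrite !mxE mulrA.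
rewrite -Andreief.
have detA (f : 'I_M -> 'I_(M + M)) :
  \det (\matrix_(i, j) A (f i) j) = (\prod_i g (f i)) * \det (\matrix_(i, j) B (f i) j).
  have := det_scale (\matrix_(i, j) B (f i) j) (fun i => g (f i)) (fun=> 1).
  rewrite [\prod_i 1]big1 // mulr1 => <-.
  by congr (\det _); apply/matrixP => i j; rewrite !mxE mulr1.
under eq_bigr => f _ do rewrite detA -mulrA -expr2.
rewrite sum_inj_beta; last 2 first.
- move=> f s; congr (_ * _).
    by rewrite [RHS](reindex_inj (@perm_inj _ s)) /=; apply: eq_bigr => i _; rewrite ffunE.
  have -> : (\matrix_(i, j) B ([ffun i => f (s i)] i) j) = row_perm s (\matrix_(i, j) B (f i) j).
    by apply/matrixP => i j; rewrite !mxE ffunE.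
  by rewrite row_permE det_mulmx det_perm exprMn sqrr_sign mul1r.
- move=> f /injectivePn[x [y xy e]]; rewrite [X in X ^+ 2](determinant_alternate xy) ?expr0n ?mulr0 //.
  by move=> j; rewrite !mxE e.
congr (_ *+ _); apply: eq_bigr => mu hy.
have -> : \det (\matrix_(i, j) B (beta_ord mu i) j) = a ^+ tot M (rown mu) * fdet R (fun i : 'I_M => rown mu i).
  rewrite /tot -det_expc ?gt_eqF //; congr (\det _); apply/matrixP => i j; rewrite !mxE ffunE /= /beta_num.
  rewrite -(expc_shift _ _ i (M - i)); congr (expc _ _ _); have := ltn_ord i; lia.
rewrite [LHS]mulrC; congr (_ * _); last by rewrite [RHS]exprMn /dim2 exprAC.
apply: eq_bigr => i _; rewrite /g ffunE /= /beta_num.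
have -> // : (M + n <= rown mu i + (M - i.+1))%N = (n + i < rown mu i)%N.
by have := ltn_ord i; lia.
Qed.

End GF.

(** * The maximal row sum as a matrix norm *)

Section RowNorm.
Variable R : realType.

Definition row_norm_le m p (A : 'M[R]_(m, p)) (b : R) := forall i, \sum_j `|A i j| <= b.

Lemma row_norm_mul m p q (A : 'M[R]_(m, p)) (B : 'M[R]_(p, q)) b c : 0 <= c ->
  row_norm_le A b -> row_norm_le B c -> row_norm_le (A *m B) (b * c).
Proof.
move=> c0 hA hB i.
apply: (@le_trans _ _ (\sum_j \sum_k `|A i k| * `|B k j|)).
  apply: ler_sum => j _; rewrite mxE; apply: le_trans (ler_norm_sum _ _ _) _.
  by apply: ler_sum => k _; rewrite normrM.
rewrite exchange_big /=; apply: (@le_trans _ _ (\sum_k `|A i k| * c)).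
  by apply: ler_sum => k _; rewrite -mulr_sumr ler_wpM2l.
by rewrite -mulr_suml ler_wpM2r.
Qed.

Lemma row_norm_add m p (A B : 'M[R]_(m, p)) b c :
  row_norm_le A b -> row_norm_le B c -> row_norm_le (A + B) (b + c).
Proof.
move=> hA hB i; apply: le_trans (lerD (hA i) (hB i)); rewrite -big_split /=.
by apply: ler_sum => j _; rewrite mxE ler_normD.
Qed.

Lemma row_norm_scale m p (A : 'M[R]_(m, p)) b t :
  row_norm_le A b -> row_norm_le (t *: A) (`|t| * b).
Proof.
move=> hA i; apply: le_trans (ler_wpM2l (normr_ge0 t) (hA i)); rewrite mulr_sumr.
by apply: ler_sum => j _; rewrite mxE normrM.
Qed.

Lemma row_norm1 m : row_norm_le (1%:M : 'M[R]_m) 1.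
Proof.
move=> i; rewrite (bigD1 i) //= big1 ?addr0; last first.
  by move=> j ji; rewrite mxE eq_sym (negbTE ji) normr0.
by rewrite mxE eqxx normr1.
Qed.

Lemma row_norm_entry m p (A : 'M[R]_(m, p)) d :
  (forall i j, `|A i j| <= d) -> row_norm_le A (p%:R * d).
Proof.
move=> h i; apply: (@le_trans _ _ (\sum_(j < p) d)); first exact: ler_sum.
by rewrite sumr_const card_ord mulr_natl.
Qed.

End RowNorm.

(** * Toeplitz and Hankel matrices of exponential coefficients *)

Definition ec (F : fieldType) (a : F) (k : nat) : F := a ^+ k / k`!%:R.

Section Toeplitz.
Variable R : realType.
Implicit Types a x th : R.

Lemma expcE a p q : expc a p q = if (q <= p)%N then ec a (p - q) else 0.
Proof. by []. Qed.

Lemma norm_ec a k : `|ec a k| = ec `|a| k.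
Proof. by rewrite /ec normrM normrX normrV ?unitfE ?pnatr_eq0 -?lt0n ?fact_gt0 // normr_nat. Qed.

Lemma ec_ge0 a k : 0 <= a -> 0 <= ec a k.
Proof. by move=> a0; rewrite /ec divr_ge0 ?exprn_ge0. Qed.

Lemma sum_ec_le a K : 0 <= a -> \sum_(k < K) ec a k <= expR a.
Proof.
move=> a0; have := nondecreasing_cvgn_le _ (is_cvg_series_exp_coeff a) K.
rewrite /series /= big_mkord; apply.
by apply: nondecreasing_series => j _ _; apply: exp_coeff_ge0.
Qed.

Lemma sum_norm_ec a K : \sum_(k < K) `|ec a k| <= expR `|a|.
Proof. by under eq_bigr do rewrite norm_ec; apply: sum_ec_le. Qed.

Lemma ec_le_expR a k : 0 <= a -> ec a k <= expR a.
Proof.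
move=> a0; apply: le_trans (sum_ec_le k.+1 a0); rewrite big_ord_recr /= lerDr.
by apply: sumr_ge0 => i _; apply: ec_ge0.
Qed.

(** [th] is free: factorial decay beats every geometric rate, at the price of the constant
    [expR (th * |a|)], which does not depend on [k]. *)
Lemma ec_decay a th k : 0 < th -> `|ec a k| <= th ^- k * expR (th * `|a|).
Proof.
move=> t0; have tk : 0 < th ^+ k by rewrite exprn_gt0.
rewrite norm_ec ler_pdivlMl //.
have -> : th ^+ k * ec `|a| k = ec (th * `|a|) k by rewrite /ec exprMn mulrA.
by apply: ec_le_expR; rewrite mulr_ge0 // ltW.
Qed.

Lemma expc_decay a th p q : 0 < th -> `|expc a p q| <= th ^- (p - q) * expR (th * `|a|).
Proof.
move=> t0; rewrite expcE; case: ifP => _; first exact: ec_decay.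
by rewrite normr0 mulr_ge0 ?expR_ge0 // invr_ge0 exprn_ge0 // ltW.
Qed.

Lemma sum_shift_le (f : nat -> R) M d : (forall k, 0 <= f k) ->
  \sum_(j < M) f (d + j)%N <= \sum_(k < d + M) f k.
Proof. by move=> f0; rewrite big_split_ord /= lerDr sumr_ge0. Qed.

Definition lowT a M : 'M[R]_M := \matrix_(i, j) expc a i j.
Definition hankel a n M : 'M[R]_M := \matrix_(i, j) ec a (i + j + n).+1.

Lemma row_norm_lowT a M : row_norm_le (lowT a M) (expR `|a|).
Proof.
move=> i; apply: le_trans (sum_norm_ec a i.+1).
rewrite (eq_bigr (fun j : 'I_M => if (j < i.+1)%N then `|ec a (i - j)| else 0)); last first.
  by move=> j _; rewrite mxE expcE ltnS; case: ifP => // _; rewrite normr0.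
rewrite -big_mkcond /= -(big_ord_widen _ (fun j => `|ec a (i - j)|)) //.
rewrite (reindex_inj rev_ord_inj) /=.
by rewrite le_eqVlt; apply/orP; left; apply/eqP; apply: eq_bigr => j _; rewrite subSS subKn // -ltnS.
Qed.

Lemma row_norm_lowTt a M : row_norm_le (lowT a M)^T (expR `|a|).
Proof.
move=> j; apply: le_trans (sum_norm_ec a M).
under eq_bigr => i _ do rewrite !mxE.
apply: (@le_trans _ _ (\sum_(i < j + M) `|expc a i j|)).
  rewrite (big_ord_widen _ (fun i => `|expc a i j|) (leq_addl j M)) big_mkcond /=.
  by apply: ler_sum => i _; case: ifP.
rewrite big_split_ord /= big1 ?add0r; last first.
  by move=> i _; rewrite expcE leqNgt ltn_ord normr0.
by apply: ler_sum => i _; rewrite expcE leq_addr addKn.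
Qed.

Lemma row_norm_hankel a n M : row_norm_le (hankel a n M) (expR `|a|).
Proof.
move=> i; apply: le_trans (sum_norm_ec a ((i + n).+1 + M)).
apply: le_trans (sum_shift_le _ _ (fun k => normr_ge0 (ec a k))).
by apply: ler_sum => j _; rewrite mxE addSn addnAC.
Qed.

Lemma sum_ec_alt a k : \sum_(i < k.+1) ec a i * ec (- a) (k - i) = (k == 0%N)%:R.
Proof.
have f0 j : j`!%:R != 0 :> R by rewrite pnatr_eq0 -lt0n fact_gt0.
apply: (mulIf (f0 k)); rewrite mulr_suml.
transitivity ((- a + a) ^+ k).
  rewrite exprDn; apply: eq_bigr => i _.
  have le : (i <= k)%N by rewrite -ltnS.
  rewrite /ec -(bin_fact le) !natrM -mulr_natr.
  by have := f0 i; have := f0 (k - i)%N; move: (_ ^+ _) => x; move: (_ ^+ _) => y h1 h2; field; apply/andP.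
by rewrite addNr expr0n; case: eqP => [->|_]; rewrite ?fact0 ?mulr1 ?mul0r.
Qed.

(** Lower triangular Toeplitz matrices multiply like truncated power series, here those of [e^(a x)]
    and [e^(- a x)]; the identity is exact for each [M]. *)
Lemma lowT_inv a M : lowT a M *m lowT (- a) M = 1%:M.
Proof.
apply/matrixP => i j; rewrite !mxE.
under eq_bigr => k _ do rewrite !mxE !expcE.
case: (ltnP i j) => ij.
  have -> : (i == j) = false by apply/eqP => e; rewrite e ltnn in ij.
  apply: big1 => k _; case: ifP => h1; rewrite ?mul0r //; case: ifP => h2; rewrite ?mulr0 //.
  by have := leq_trans h2 h1; rewrite leqNgt ij.
transitivity (\sum_(k < M) if (j <= k < j + (i - j).+1)%N then ec a (i - k) * ec (- a) (k - j) else 0).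
  apply: eq_bigr => k _; rewrite addnS subnKC // ltnS.
  by case: (leqP k i) => h1; case: (leqP j k) => h2; rewrite ?mul0r ?mulr0 ?mulr1.
transitivity (\sum_(k < (i - j).+1) ec a ((i - j) - k) * ec (- a) k).
  have le : (j + (i - j).+1 <= M)%N by rewrite addnS subnKC.
  rewrite -big_mkcond /=.
  rewrite (eq_bigl (fun k : 'I_M => (j <= k)%N && (k < j + (i - j).+1)%N)) // big_mkcondl /=.
  rewrite -(big_ord_widen _ (fun k => if (j <= k)%N then ec a (i - k) * ec (- a) (k - j) else 0) le).
  rewrite big_split_ord /= big1 ?add0r; last by move=> k _; rewrite leqNgt ltn_ord.
  by apply: eq_bigr => k _; rewrite leq_addr addKn subnDA.
rewrite (reindex_inj rev_ord_inj) /=.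
transitivity (\sum_(k < (i - j).+1) ec a k * ec (- a) ((i - j) - k)).
  by apply: eq_bigr => k _; rewrite subSS subKn // -ltnS.
rewrite sum_ec_alt subn_eq0; have -> // : (i <= j)%N = (i == j).
by apply/idP/eqP => [h|->//]; apply: val_inj; apply/eqP; rewrite eqn_leq h ij.
Qed.

Definition TH a n M : 'M[R]_M := lowT (- a) M *m hankel a n M.
(* [hankel a n M *m hankel a n M] up to the truncation [p < M]. *)
Definition gramR a n M : 'M[R]_M :=
  \matrix_(j, j') \sum_(n <= p < M) ec a (p + j).+1 * ec a (p + j').+1.

(** The sum over [l] is cut at [M]: [l = M - 1 - q] gives the entries of [lowT], [l = M + p] those
    of the Hankel matrix, and the cutoff [n <= p] lies in the second half. *)
Lemma gramE n a t M : gram n a t M =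
  lowT a M *m (lowT a M)^T + hankel a 0 M *m hankel a 0 M - t *: gramR a n M.
Proof.
apply/matrixP => j j'; rewrite !mxE big_split_ord /= -addrA; congr (_ + _).
  rewrite (reindex_inj rev_ord_inj) /=; apply: eq_bigr => q _; rewrite !mxE.
  have -> : (M + n <= M - q.+1)%N = false by apply/negbTE; rewrite -ltnNge; have := ltn_ord q; lia.
  rewrite mul1r; congr (_ * _).
    rewrite -(expc_shift _ j q (M - q)); congr expc; have := ltn_ord q; lia.
  rewrite -(expc_shift _ j' q (M - q)); congr expc; have := ltn_ord q; lia.
rewrite (_ : \sum_(n <= p < M) _ = \sum_(p < M) if (n <= p)%N then ec a (p + j).+1 * ec a (p + j').+1 else 0); last first.
  by rewrite (big_nat_widenl _ 0) // big_mkord big_mkcond.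
rewrite mulr_sumr -sumrB.
apply: eq_bigr => p _; rewrite !mxE leq_add2l.
have hh q : expc a (M + p + q.+1) M = ec a (p + q).+1.
  by rewrite (_ : M + p + q.+1 = (p + q).+1 + M)%N; [rewrite expcE leq_addl addnK | lia].
rewrite !hh !addn0 [(j + p)%N]addnC.
by case: ifP => _; ring.
Qed.

End Toeplitz.

(** * Comparison of the Gram matrix with the Toeplitz-Hankel operator *)

Section GramAsymptotics.
Variable R : realType.
Implicit Types (a t th : R) (n M : nat).

Lemma submxE m q (A B : 'M[R]_(m, q)) i j : (A - B) i j = A i j - B i j.
Proof. by rewrite !mxE. Qed.

(** The defect caused by truncation: for the infinite matrices the two sums agree with the product
    of transpose and [lowT]. *)
Definition gram_corner a M : 'M[R]_M :=
  lowT a M *m (lowT a M)^T + hankel a 0 M *m hankel a 0 M - (lowT a M)^T *m lowT a M.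

(** Both terms sum the same [F] over windows of indices [Q]. [F] vanishes below [M + j] and
    [M + j'], so the windows differ only at their upper end, from [2M] on. *)
Lemma gram_cornerE a M j j' : gram_corner a M j j' =
  \sum_(l < (j + j').+1) expc a (M + M + l) (M + j') * expc a (M + M + l) (M + j).
Proof.
pose F Q := expc a Q (M + j') * expc a Q (M + j).
have -> : gram_corner a M j j' = gram 0 a 0 M j j' - ((lowT a M)^T *m lowT a M) j j'.
  by rewrite gramE scale0r subr0 !mxE.
have -> : gram 0 a 0 M j j' = \sum_(l < M + M) F ((j + j').+1 + l)%N.
  rewrite mxE; apply: eq_bigr => l _; rewrite subr0 if_same mul1r /F.
  rewrite -(expc_shift a (l + j.+1) M j') -(expc_shift a (l + j'.+1) M j).
  by congr (expc _ _ _ * expc _ _ _); lia.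
have -> : ((lowT a M)^T *m lowT a M) j j' = \sum_(q < M) F (M + q)%N.
  rewrite mxE; apply: eq_bigr => q _; rewrite !mxE /F mulrC.
  by rewrite -(expc_shift a q j M) -(expc_shift a q j' M) ![(_ + M)%N]addnC.
have z Q : (Q < M + j)%N \/ (Q < M + j')%N -> F Q = 0.
  move=> [h|h]; first by rewrite /F (expcE a Q (M + j)) leqNgt h mulr0.
  by rewrite /F (expcE a Q (M + j')) leqNgt h mul0r.
have e1 : \sum_(Q < (j + j').+1 + (M + M)) F Q = \sum_(l < M + M) F ((j + j').+1 + l)%N.
  rewrite big_split_ord /= big1 ?add0r // => Q _; apply: z; have := ltn_ord Q; have := ltn_ord j; lia.
have e2 : \sum_(Q < M + M) F Q = \sum_(q < M) F (M + q)%N.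
  rewrite big_split_ord /= big1 ?add0r // => Q _; apply: z; have := ltn_ord Q; lia.
rewrite -e1 -e2 [((j + j').+1 + _)%N]addnC big_split_ord /=.
by rewrite [X in X - _]addrC addrK.
Qed.

(** Again two windows of one sum, shifted by [p] and by [j]: moving the Toeplitz factor across the
    Hankel matrix is exact up to indices at least [M]. *)
Lemma lowTt_hankel a n M j p :
  ((lowT a M)^T *m hankel a n M - hankel a n M *m lowT a M) j p =
  \sum_(l < p) expc a (M + l) (j + p) * ec a (M + l + n).+1 -
  \sum_(l < j) expc a (M + l) (j + p) * ec a (M + l + n).+1.
Proof.
pose F Q := expc a Q (j + p) * ec a (Q + n).+1.
have e1 : ((lowT a M)^T *m hankel a n M) j p = \sum_(Q < M) F Q + \sum_(l < p) F (M + l)%N.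
  transitivity (\sum_(Q < M + p) F Q); last by rewrite big_split_ord.
  transitivity (\sum_(Q < p + M) F Q); last by rewrite addnC.
  rewrite big_split_ord /= big1 ?add0r => [|Q _]; last first.
    by rewrite /F expcE leqNgt (leq_trans (ltn_ord Q) (leq_addl _ _)) mul0r.
  rewrite mxE; apply: eq_bigr => q _; rewrite !mxE /F.
  rewrite -(expc_shift a q j p); congr (expc _ _ _ * ec _ _); lia.
have e2 : (hankel a n M *m lowT a M) j p = \sum_(Q < M) F Q + \sum_(l < j) F (M + l)%N.
  transitivity (\sum_(Q < M + j) F Q); last by rewrite big_split_ord.
  transitivity (\sum_(Q < j + M) F Q); last by rewrite addnC.
  rewrite big_split_ord /= big1 ?add0r => [|Q _]; last first.
    by rewrite /F expcE leqNgt (leq_trans (ltn_ord Q) (leq_addr _ _)) mul0r.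
  rewrite mxE; apply: eq_bigr => q _; rewrite !mxE /F mulrC.
  rewrite -(expc_shift a q p j); congr (expc _ _ _ * ec _ _); lia.
by rewrite submxE e1 e2 /F; ring.
Qed.

Lemma hankel_sqr_gramR a n M j j' : (n <= M)%N ->
  (hankel a n M *m hankel a n M - gramR a n M) j j' =
  \sum_(l < n) ec a (M + l + j).+1 * ec a (M + l + j').+1.
Proof.
move=> nM; pose f p := ec a (p + j).+1 * ec a (p + j').+1.
rewrite submxE [gramR _ _ _ _ _]mxE.
have -> : (hankel a n M *m hankel a n M) j j' = \sum_(p < M) f (n + p)%N.
  rewrite mxE; apply: eq_bigr => p _; rewrite !mxE /f.
  by congr (ec _ _ * ec _ _); lia.
have e1 : \sum_(p < n + M) f p = \sum_(p < n) f p + \sum_(p < M) f (n + p)%N by rewrite big_split_ord.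
have e2 : \sum_(p < M + n) f p = \sum_(p < M) f p + \sum_(p < n) f (M + p)%N by rewrite big_split_ord.
have e3 : \sum_(p < M) f p = \sum_(p < n) f p + \sum_(n <= p < M) f p.
  by rewrite -(big_mkord xpredT f) (big_cat_nat (n := n)) //= big_mkord.
rewrite addnC e2 e3 in e1; rewrite -/(f _).
rewrite (_ : \sum_(p < M) f (n + p)%N = \sum_(n <= p < M) f p + \sum_(p < n) f (M + p)%N); last first.
  by apply: (addrI (\sum_(p < n) f p)); rewrite addrA e1.
by rewrite addrC addKr.
Qed.

(** A nonzero term has total exponent [(i - k) + (k + j + n + 1)], at least [i]. The decay in the
    row index compensates for [gram_corner], which is largest in its last columns. *)
Lemma TH_entry_bound a n M th (i j : 'I_M) : 0 <= a -> 1 <= th ->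
  `|TH a n M i j| <= M%:R * (th ^- i * expR (th * a) ^+ 2).
Proof.
move=> a0 t1; have t0 : 0 < th by apply: lt_le_trans t1.
rewrite mxE; apply: le_trans (ler_norm_sum _ _ _) _.
apply: (@le_trans _ _ (\sum_(k < M) th ^- i * expR (th * a) ^+ 2)); last first.
  by rewrite sumr_const card_ord mulr_natl.
apply: ler_sum => k _; rewrite !mxE normrM.
have p0 m : 0 < th ^+ m by rewrite exprn_gt0.
case: (leqP k i) => ki; last first.
  rewrite expcE leqNgt ki normr0 mul0r mulr_ge0 ?sqr_ge0 // invr_ge0 ltW //.
have h1 := expc_decay (- a) i k t0; rewrite normrN (ger0_norm a0) in h1.
have h2 := ec_decay a (k + j + n).+1 t0; rewrite (ger0_norm a0) in h2.
apply: le_trans (ler_pM _ _ h1 h2) _ => //.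
rewrite mulrACA -expr2 -invfM -exprD; apply: ler_wpM2r; first exact: sqr_ge0.
rewrite lef_pV2 ?posrE //; apply: ler_weXn2l => //; lia.
Qed.

(* The entries of [gram_corner] are large only in the last columns, where the rows of
   [TH] are small: only the product is uniformly small. *)
Lemma gram_corner_bound a M th (j j' : 'I_M) : 0 <= a -> 1 <= th ->
  `|gram_corner a M j j'| <= (M + M)%:R * (th ^- (M - j') * expR (th * a) ^+ 2).
Proof.
move=> a0 t1; have t0 : 0 < th by apply: lt_le_trans t1.
have p0 m : 0 < th ^+ m by rewrite exprn_gt0.
rewrite gram_cornerE; apply: le_trans (ler_norm_sum _ _ _) _.
apply: (@le_trans _ _ (\sum_(l < (j + j').+1) th ^- (M - j') * expR (th * a) ^+ 2)).
  apply: ler_sum => l _; rewrite normrM.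
  have h1 := expc_decay a (M + M + l) (M + j') t0; rewrite (ger0_norm a0) in h1.
  have h2 := expc_decay a (M + M + l) (M + j) t0; rewrite (ger0_norm a0) in h2.
  apply: le_trans (ler_pM _ _ h1 h2) _ => //.
  rewrite mulrACA -expr2 -invfM -exprD; apply: ler_wpM2r; first exact: sqr_ge0.
  rewrite lef_pV2 ?posrE //; apply: ler_weXn2l => //; lia.
rewrite sumr_const card_ord -[leLHS]mulr_natl; apply: ler_wpM2r.
  by rewrite mulr_ge0 ?sqr_ge0 // invr_ge0 ltW.
rewrite ler_nat; have := ltn_ord j; have := ltn_ord j'; lia.
Qed.

Lemma lowTt_hankel_bound a n M th (j p : 'I_M) : 0 <= a -> 1 <= th ->
  `|((lowT a M)^T *m hankel a n M - hankel a n M *m lowT a M) j p|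
  <= (M + M)%:R * (th ^- M * expR (th * a) ^+ 2).
Proof.
move=> a0 t1; have t0 : 0 < th by apply: lt_le_trans t1.
have p0 m : 0 < th ^+ m by rewrite exprn_gt0.
have key (q : 'I_M) : `|\sum_(l < q) expc a (M + l) (j + p) * ec a (M + l + n).+1|
    <= M%:R * (th ^- M * expR (th * a) ^+ 2).
  apply: le_trans (ler_norm_sum _ _ _) _.
  apply: (@le_trans _ _ (\sum_(l < q) th ^- M * expR (th * a) ^+ 2)).
    apply: ler_sum => l _; rewrite normrM.
    have h1 := expc_decay a (M + l) (j + p) t0; rewrite (ger0_norm a0) in h1.
    have h2 := ec_decay a (M + l + n).+1 t0; rewrite (ger0_norm a0) in h2.
    apply: le_trans (ler_pM _ _ h1 h2) _ => //.
    rewrite mulrACA -expr2 -invfM -exprD; apply: ler_wpM2r; first exact: sqr_ge0.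
    rewrite lef_pV2 ?posrE //; apply: ler_weXn2l => //; lia.
  rewrite sumr_const card_ord -[leLHS]mulr_natl; apply: ler_wpM2r.
    by rewrite mulr_ge0 ?sqr_ge0 // invr_ge0 ltW.
  by rewrite ler_nat ltnW.
rewrite lowTt_hankel; apply: le_trans (ler_normB _ _) _.
by rewrite natrD mulrDl lerD.
Qed.

Lemma hankel_sqr_bound a n M th (j j' : 'I_M) : (n <= M)%N -> 0 <= a -> 1 <= th ->
  `|(hankel a n M *m hankel a n M - gramR a n M) j j'| <= M%:R * (th ^- M * expR (th * a) ^+ 2).
Proof.
move=> nM a0 t1; have t0 : 0 < th by apply: lt_le_trans t1.
have p0 m : 0 < th ^+ m by rewrite exprn_gt0.
rewrite hankel_sqr_gramR //; apply: le_trans (ler_norm_sum _ _ _) _.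
apply: (@le_trans _ _ (\sum_(l < n) th ^- M * expR (th * a) ^+ 2)).
  apply: ler_sum => l _; rewrite normrM.
  have h1 := ec_decay a (M + l + j).+1 t0; rewrite (ger0_norm a0) in h1.
  have h2 := ec_decay a (M + l + j').+1 t0; rewrite (ger0_norm a0) in h2.
  apply: le_trans (ler_pM _ _ h1 h2) _ => //.
  rewrite mulrACA -expr2 -invfM -exprD; apply: ler_wpM2r; first exact: sqr_ge0.
  rewrite lef_pV2 ?posrE //; apply: ler_weXn2l => //; lia.
rewrite sumr_const card_ord -[leLHS]mulr_natl; apply: ler_wpM2r.
  by rewrite mulr_ge0 ?sqr_ge0 // invr_ge0 ltW.
by rewrite ler_nat.
Qed.

(** With [L = lowT a M] and [H = hankel a n M] one has [L (TH) = H], so [L^T L (TH)^2] is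
    [L^T H (TH)], close to [H L (TH) = H^2], close to [gramR]. The right-hand side collects the
    defects of these steps and the corner. *)
Lemma gram_errE a n M :
  gramR a n M - gram n a 0 M *m (TH a n M *m TH a n M) =
  - (hankel a n M *m hankel a n M - gramR a n M)
  - ((lowT a M)^T *m hankel a n M - hankel a n M *m lowT a M + gram_corner a M *m TH a n M) *m TH a n M.
Proof.
have -> : gram n a 0 M = (lowT a M)^T *m lowT a M + gram_corner a M.
  by rewrite gramE scale0r subr0 /gram_corner [RHS]addrC subrK.
have LTH : lowT a M *m TH a n M = hankel a n M by rewrite /TH mulmxA lowT_inv mul1mx.
set E2 := _ - hankel a n M *m lowT a M.
rewrite mulmxA; have -> : ((lowT a M)^T *m lowT a M + gram_corner a M) *m TH a n M =
    hankel a n M *m lowT a M + (E2 + gram_corner a M *m TH a n M).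
  by rewrite mulmxDl -mulmxA LTH addrA /E2 [_ + (_ - _)]addrC subrK.
by rewrite [in LHS]mulmxDl -(mulmxA (hankel a n M)) LTH opprB opprD addrA.
Qed.

Lemma gram_err_bound a n M th (j j' : 'I_M) : (n <= M)%N -> 0 <= a -> 1 <= th ->
  `|(gramR a n M - gram n a 0 M *m (TH a n M *m TH a n M)) j j'|
  <= 5 * M%:R ^+ 5 * expR (th * a) ^+ 6 * th ^- M.
Proof.
move=> nM a0 t1; have t0 : 0 < th by apply: lt_le_trans t1.
have p0 m : 0 < th ^+ m by rewrite exprn_gt0.
set B := expR (th * a).
have B1 : 1 <= B by rewrite /B -[leLHS]expR0 ler_expR mulr_ge0 // ltW.
have M1 : 1 <= M%:R :> R by rewrite ler1n (leq_ltn_trans _ (ltn_ord j)).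
have M0 : 0 <= M%:R :> R by [].
have B0 : 0 <= B := le_trans ler01 B1.
have v0 m : 0 <= th ^- m by rewrite invr_ge0 ltW.
have hTH (i k : 'I_M) : `|TH a n M i k| <= M%:R * B ^+ 2.
  apply: le_trans (TH_entry_bound _ _ _ a0 t1) _; rewrite ler_wpM2l // ler_piMl ?sqr_ge0 //.
  by rewrite invf_le1 // exprn_ege1.
have hE1 (i k : 'I_M) : `|(gram_corner a M *m TH a n M) i k| <= 2 * M%:R ^+ 3 * B ^+ 4 * th ^- M.
  rewrite mxE; apply: le_trans (ler_norm_sum _ _ _) _.
  apply: (@le_trans _ _ (\sum_(l < M) 2 * M%:R ^+ 2 * B ^+ 4 * th ^- M)); last first.
    by rewrite sumr_const card_ord -mulr_natl le_eqVlt; apply/orP; left; apply/eqP; ring.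
  apply: ler_sum => l _; rewrite normrM.
  apply: le_trans (ler_pM _ _ (gram_corner_bound i l a0 t1) (TH_entry_bound n l k a0 t1)) _ => //.
  (* Column [l] of the corner gives the first factor, row [l] of [TH] the second. *)
  have -> : th ^- M = th ^- (M - l) * th ^- l.
    by rewrite -invfM -exprD subnK // ltnW.
  by rewrite -/B natrD le_eqVlt; apply/orP; left; apply/eqP; ring.
have hE2 (i k : 'I_M) : `|((lowT a M)^T *m hankel a n M - hankel a n M *m lowT a M) i k| <= 2 * M%:R * B ^+ 2 * th ^- M.
  apply: le_trans (lowTt_hankel_bound _ _ _ a0 t1) _.
  by rewrite -/B natrD le_eqVlt; apply/orP; left; apply/eqP; ring.
have hE (i k : 'I_M) : `|((lowT a M)^T *m hankel a n M - hankel a n M *m lowT a M + gram_corner a M *m TH a n M) i k|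
   <= 4 * M%:R ^+ 3 * B ^+ 4 * th ^- M.
  rewrite mxE; apply: le_trans (ler_normD _ _) _; apply: le_trans (lerD (hE2 i k) (hE1 i k)) _.
  rewrite -mulrDl ler_wpM2r //.
  have : M%:R * B ^+ 2 <= M%:R ^+ 3 * B ^+ 4.
    apply: ler_pM => //; rewrite ?sqr_ge0 //; first exact: ler_eXnr.
    by apply: ler_weXn2l.
  lra.
rewrite gram_errE submxE; apply: le_trans (ler_normB _ _) _.
have h3 := hankel_sqr_bound j j' nM a0 t1; rewrite -/B in h3.
apply: (@le_trans _ _ (M%:R * (th ^- M * B ^+ 2) + 4 * M%:R ^+ 5 * B ^+ 6 * th ^- M)).
  rewrite mxE normrN; apply: lerD => //.
  rewrite mxE; apply: le_trans (ler_norm_sum _ _ _) _.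
  apply: (@le_trans _ _ (\sum_(l < M) 4 * M%:R ^+ 4 * B ^+ 6 * th ^- M)); last first.
    by rewrite sumr_const card_ord -mulr_natl le_eqVlt; apply/orP; left; apply/eqP; ring.
  apply: ler_sum => l _; rewrite normrM.
  apply: le_trans (ler_pM _ _ (hE j l) (hTH l j')) _ => //.
  by rewrite le_eqVlt; apply/orP; left; apply/eqP; ring.
have : M%:R * B ^+ 2 <= M%:R ^+ 5 * B ^+ 6.
  apply: ler_pM => //; rewrite ?sqr_ge0 //; first exact: ler_eXnr.
  by apply: ler_weXn2l.
move=> /(ler_wpM2r (v0 M)).
lra.
Qed.

(** [b] bounds the row sums of both matrices independently of [M], so [det_sub_bound] loses
    [b ^+ M]; choosing [th] as a large multiple of [b] absorbs that loss and the polynomial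
    factors. *)
Lemma gram_det_bound a n t M b th : (n <= M)%N -> 0 <= a ->
  b = 2 * expR a ^+ 2 * (1 + `|t| * expR a ^+ 4) -> th = 256 * b ->
  `|\det (gram n a t M) - \det (gram n a 0 M) * \det (1%:M - t *: (TH a n M *m TH a n M))|
  <= 5 * `|t| * expR (th * a) ^+ 6 * 2 ^- M.
Proof.
move=> nM a0 bE thE.
have e1 : 1 <= expR a by rewrite -[leLHS]expR0 ler_expR.
have e0 : 0 <= expR a := expR_ge0 a.
have b2 : 2 <= b.
  rewrite bE -[leLHS]mulr1; apply: ler_pM => //.
    by rewrite -[leLHS]mulr1 ler_wpM2l // exprn_ege1.
  by rewrite lerDl mulr_ge0 // exprn_ge0.
have b1 : 1 <= b by apply: le_trans b2; rewrite ler1n.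
have t1 : 1 <= th by rewrite thE -[leLHS]mulr1 ler_pM // ler1n.
have t0 : 0 < th by apply: lt_le_trans t1.
have aa : `|a| = a by rewrite ger0_norm.
rewrite -det_mulmx.
set G := gram n a 0 M; set K := TH a n M *m TH a n M.
have hL := @row_norm_lowT R a M; rewrite aa in hL.
have hLt := @row_norm_lowTt R a M; rewrite aa in hLt.
have hT := @row_norm_lowT R (- a) M; rewrite normrN aa in hT.
have hV := @row_norm_hankel R a 0 M; rewrite aa in hV.
have hH := @row_norm_hankel R a n M; rewrite aa in hH.
have hG : row_norm_le G (2 * expR a ^+ 2).
  rewrite /G gramE scale0r subr0 mulr2n mulrDl !mul1r expr2.
  by apply: row_norm_add; apply: row_norm_mul.
have hK : row_norm_le K (expR a ^+ 4).
  rewrite -[4%N]/(2 + 2)%N exprD; apply: row_norm_mul; first exact: sqr_ge0.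
    by rewrite expr2; apply: row_norm_mul.
  by rewrite expr2; apply: row_norm_mul.
(* All entries are nonnegative, and [gramR] is a partial sum of the square of [hankel a 0 M]. *)
have hR : row_norm_le (gramR a n M) (expR a ^+ 2).
  move=> i; have hVV : row_norm_le (hankel a 0 M *m hankel a 0 M) (expR a ^+ 2).
    by rewrite expr2; apply: row_norm_mul.
  apply: le_trans (hVV i); apply: ler_sum => j _; rewrite !mxE.
  have ge0 p : 0 <= ec a (p + i).+1 * ec a (p + j).+1 by rewrite mulr_ge0 ?ec_ge0.
  rewrite !ger0_norm; last 2 first.
  - by apply: sumr_ge0 => p _; rewrite !mxE mulr_ge0 ?ec_ge0.
  - by apply: sumr_ge0 => p _.
  rewrite (big_nat_widenl _ 0) // big_mkord big_mkcond /=; apply: ler_sum => p _.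
  rewrite !mxE !addn0 [(i + p)%N]addnC; case: ifP => // _; exact: ge0.
have hA : row_norm_le (gram n a t M) b.
  have -> : gram n a t M = G + (- t) *: gramR a n M by rewrite /G !gramE scale0r subr0 scaleNr.
  move=> i; apply: le_trans (row_norm_add hG (row_norm_scale (- t) hR) i) _.
  rewrite normrN bE mulrDr mulr1 lerD2l [leRHS]mulrCA ler_wpM2l //.
  rewrite -mulrA -exprD -[leLHS]mul1r; apply: ler_pM; rewrite ?exprn_ge0 //; first by rewrite ler1n.
  by apply: ler_weXn2l.
have hB : row_norm_le (G *m (1%:M - t *: K)) b.
  rewrite bE; have c0 : 0 <= 1 + `|t| * expR a ^+ 4 by rewrite addr_ge0 // mulr_ge0 // exprn_ge0.
  apply: (row_norm_mul c0 hG).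
  rewrite -scaleNr -[`|t|]normrN; apply: row_norm_add; first exact: row_norm1.
  exact: row_norm_scale.
set d := 5 * M%:R ^+ 5 * expR (th * a) ^+ 6 * th ^- M.
have hd : row_norm_le (gram n a t M - G *m (1%:M - t *: K)) (`|t| * (M%:R * d)).
  have -> : gram n a t M - G *m (1%:M - t *: K) = (- t) *: (gramR a n M - G *m K).
    have -> : gram n a t M = G - t *: gramR a n M by rewrite /G !gramE scale0r subr0.
    rewrite mulmxBr mulmx1 -scalemxAr scaleNr scalerBr.
    by rewrite opprB addrC opprB addrA addrC addrA -addrA; apply/matrixP => i j; rewrite !mxE; ring.
  rewrite -[`|t|]normrN; apply: row_norm_scale; apply: row_norm_entry => i j.
  exact: gram_err_bound.
have hd' (i : 'I_M) : \sum_j `|gram n a t M i j - (G *m (1%:M - t *: K)) i j| <= `|t| * (M%:R * d).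
  by apply: le_trans (hd i); apply: ler_sum => j _; rewrite submxE.
apply: le_trans (det_sub_bound b1 hA hB hd') _.
rewrite /d thE.
have bM : 0 < b ^+ M by rewrite exprn_gt0 // (lt_le_trans _ b1).
rewrite [(256 * b) ^+ M]exprMn invfM.
rewrite (_ : M%:R * _ = 5 * `|t| * expR (256 * b * a) ^+ 6 * (M%:R ^+ 7 / 256 ^+ M) * (b ^- M * b ^+ M)); last by ring.
rewrite mulVf ?gt_eqF // mulr1; apply: ler_wpM2l.
  apply: mulr_ge0; first by apply: mulr_ge0; [exact: ler0n | exact: normr_ge0].
  by apply: exprn_ge0; apply: expR_ge0.
rewrite ler_pdivrMr ?exprn_gt0 // mulrC -ler_pdivrMr ?invr_gt0 ?exprn_gt0 // invrK.
(* Origin of 256: the factor [M ^ 7] is at most [(2 ^ M) ^ 7], and one more [2 ^ M] is kept for the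
   final decay. *)
apply: (@le_trans _ _ ((2 ^+ M) ^+ 7 * 2 ^+ M)).
  apply: ler_wpM2r; first exact: exprn_ge0.
  by apply: lerXn2r; rewrite ?nnegrE // -natrX ler_nat ltnW // ltn_expl.
by rewrite -exprSr -exprM mulnC exprM -natrX.
Qed.

End GramAsymptotics.

(** * Contour integrals of Laurent polynomials *)

Section ContourIntegral.
Variable R : realType.
Local Notation C := R[i].
Implicit Types (x y t : R) (f g : R -> R) (G : R -> C) (w z : C).

Lemma circleD x y : circle (x + y) = circle x * circle y :> C.
Proof. by apply/eqP; rewrite eq_complex /= cosD sinD [cos x * sin y + _]addrC !eqxx. Qed.

Lemma circle0 : circle 0 = 1 :> C.
Proof. by rewrite /circle cos0 sin0. Qed.

Lemma normr_circle x : `|circle x : C| = 1.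
Proof. by rewrite normc_def /= cos2Dsin2 sqrtr1. Qed.

Lemma circle_neq0 x : circle x != 0 :> C.
Proof. by rewrite -normr_eq0 normr_circle oner_eq0. Qed.

Lemma circleN x : circle (- x) = (circle x)^-1 :> C.
Proof.
by apply: (mulIf (circle_neq0 x)); rewrite -circleD addNr circle0 mulVf ?circle_neq0.
Qed.

Lemma circleX x (m : int) : circle x ^ m = circle (m%:~R * x) :> C.
Proof.
have nat_case (k : nat) : circle x ^+ k = circle (k%:R * x) :> C.
  elim: k => [|k IH]; first by rewrite expr0 mul0r circle0.
  by rewrite exprSr IH -circleD -natr1 mulrDl mul1r.
case: m => k; first exact: nat_case.
by rewrite NegzE -exprnN nat_case mulrNz mulNr circleN.
Qed.

Lemma circle_2pi (m : int) : circle (m%:~R * (2 * pi)) = 1 :> C.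
Proof.
rewrite -circleX (_ : circle (2 * pi) = 1 :> C) ?exp1rz //.
by rewrite /circle mulr_natl cos2pi sin2pi.
Qed.

Lemma two_pi_gt0 : 0 < 2 * pi :> R.
Proof. by rewrite mulr_gt0 // pi_gt0. Qed.

Lemma continuous_integrable f : continuous f ->
  lebesgue_measure.-integrable `[0, 2 * pi]%classic (EFin \o f).
Proof.
move=> cf; apply: continuous_compact_integrable; first exact: segment_compact.
exact: continuous_subspaceT.
Qed.

Lemma FTC2_2pi f F : continuous f -> (forall x, is_derive x 1 F (f x)) ->
  \int[lebesgue_measure]_(x in `[0, 2 * pi]%classic) f x = F (2 * pi) - F 0.
Proof.
move=> cf dF; rewrite /Rintegral (continuous_FTC2 (F := F)) //.
- exact: two_pi_gt0.
- exact: continuous_subspaceT.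
- have cF x : {for x, continuous F}.
    by apply: differentiable_continuous; apply/derivable1_diffP; case: (dF x).
  split.
  + by move=> x _; case: (dF x).
  + exact/cvg_at_right_filter/cF.
  + exact/cvg_at_left_filter/cF.
- by move=> x _; rewrite derive1E; case: (dF x).
Qed.

Lemma is_derive_mull (c x : R) : is_derive x 1 (fun y => c * y) c.
Proof.
have h := @is_deriveZ R R R id c x 1 1 (is_derive_id _ _).
by rewrite /GRing.scale /= mulr1 in h.
Qed.

Lemma Rintegral_const_2pi (e : R) :
  \int[lebesgue_measure]_(x in `[0, 2 * pi]%classic) e = e * (2 * pi).
Proof.
have ce : continuous (fun _ : R => e) by move=> x; exact: cvg_cst.
by rewrite (FTC2_2pi ce (is_derive_mull e)) mulr0 subr0.
Qed.

Lemma Rintegral_bound f (e : R) : continuous f -> (forall x, `|f x| <= e) ->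
  `|\int[lebesgue_measure]_(x in `[0, 2 * pi]%classic) f x| <= e * (2 * pi).
Proof.
move=> cf fe; have mI : measurable (`[0, 2 * pi]%classic : set R) by exact: measurable_itv.
apply: (@le_trans _ _ (\int[lebesgue_measure]_(x in `[0, 2 * pi]%classic) `|f x|)).
  by apply: le_normr_Rintegral => //; exact: continuous_integrable.
have ci : lebesgue_measure.-integrable `[0, 2 * pi]%classic (EFin \o (fun x => `|f x|)).
  by apply: continuous_integrable => x; apply: continuous_comp; [exact: cf | exact: norm_continuous].
apply: (@le_trans _ _ (\int[lebesgue_measure]_(x in `[0, 2 * pi]%classic) e)).
  apply: le_Rintegral => //.
  by apply: continuous_integrable => x; exact: cvg_cst.
by rewrite Rintegral_const_2pi.
Qed.

Definition ccontinuous G := continuous (fun x => complex.Re (G x)) /\ continuous (fun x => complex.Im (G x)).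

Lemma complexReM w z : complex.Re (w * z) = complex.Re w * complex.Re z - complex.Im w * complex.Im z.
Proof. by case: w => a b; case: z. Qed.
Lemma complexImM w z : complex.Im (w * z) = complex.Re w * complex.Im z + complex.Im w * complex.Re z.
Proof. by case: w => a b; case: z. Qed.
Lemma complexReD w z : complex.Re (w + z) = complex.Re w + complex.Re z.
Proof. by case: w => a b; case: z. Qed.
Lemma complexImD w z : complex.Im (w + z) = complex.Im w + complex.Im z.
Proof. by case: w => a b; case: z. Qed.
Lemma complexReN w : complex.Re (- w) = - complex.Re w. Proof. by case: w. Qed.
Lemma complexImN w : complex.Im (- w) = - complex.Im w. Proof. by case: w. Qed.
Lemma complexP w z : complex.Re w = complex.Re z -> complex.Im w = complex.Im z -> w = z.
Proof. by case: w => a b; case: z => c d /= -> ->. Qed.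

Lemma ccontinuousZ w G : ccontinuous G -> ccontinuous (fun x => w * G x).
Proof.
move=> [h1 h2]; split => x.
  rewrite (_ : (fun x => _) = (fun x => complex.Re w * complex.Re (G x) - complex.Im w * complex.Im (G x))); last first.
    by apply/funext => y; rewrite complexReM.
  by apply: cvgB; apply: cvgM; [exact: cvg_cst|exact: h1|exact: cvg_cst|exact: h2].
rewrite (_ : (fun x => _) = (fun x => complex.Re w * complex.Im (G x) + complex.Im w * complex.Re (G x))); last first.
  by apply/funext => y; rewrite complexImM.
by apply: cvgD; apply: cvgM; [exact: cvg_cst|exact: h2|exact: cvg_cst|exact: h1].
Qed.

Lemma ccontinuousD G H : ccontinuous G -> ccontinuous H -> ccontinuous (fun x => G x + H x).
Proof.
move=> [h1 h2] [h3 h4]; split => x.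
  rewrite (_ : (fun x => _) = (fun x => complex.Re (G x) + complex.Re (H x))); last first.
    by apply/funext => y; rewrite complexReD.
  by apply: cvgD; [exact: h1|exact: h3].
rewrite (_ : (fun x => _) = (fun x => complex.Im (G x) + complex.Im (H x))); last first.
  by apply/funext => y; rewrite complexImD.
by apply: cvgD; [exact: h2|exact: h4].
Qed.

Lemma ccontinuous0 : ccontinuous (fun=> 0).
Proof. by split=> x; exact: cvg_cst. Qed.

Lemma ccontinuous_circle t : ccontinuous (fun x => circle (t * x)).
Proof.
have ct : continuous (fun x : R => t * x).
  by move=> x; apply: cvgM; [exact: cvg_cst | exact: cvg_id].
by split => x /=; apply: continuous_comp; [exact: ct|exact: continuous_cos|exact: ct|exact: continuous_sin].
Qed.

Local Notation I2pi := (`[0, 2 * pi]%classic : set R).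

Lemma measurable_I2pi : measurable I2pi. Proof. exact: measurable_itv. Qed.

Lemma cRintegralD G H : ccontinuous G -> ccontinuous H ->
  cRintegral I2pi (fun x => G x + H x) = cRintegral I2pi G + cRintegral I2pi H.
Proof.
move=> [h1 h2] [h3 h4]; have mI := measurable_I2pi; apply: complexP; rewrite ?complexReD ?complexImD /=.
  rewrite -RintegralD //; try exact: continuous_integrable.
  by apply: eq_Rintegral => x _; rewrite complexReD.
rewrite -RintegralD //; try exact: continuous_integrable.
by apply: eq_Rintegral => x _; rewrite complexImD.
Qed.

Lemma cRintegralZ w G : ccontinuous G ->
  cRintegral I2pi (fun x => w * G x) = w * cRintegral I2pi G.
Proof.
move=> [h1 h2]; have mI := measurable_I2pi.
have cM a f : continuous f -> continuous (fun x => a * f x).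
  by move=> cf x; apply: cvgM; [exact: cvg_cst|exact: cf].
apply: complexP; rewrite ?complexReM ?complexImM /=.
  rewrite -!RintegralZl //; try exact: continuous_integrable.
  rewrite -RintegralB //; try by apply: continuous_integrable; exact: cM.
  by apply: eq_Rintegral => x _; rewrite complexReM.
rewrite -!RintegralZl //; try exact: continuous_integrable.
rewrite -RintegralD //; try by apply: continuous_integrable; exact: cM.
by apply: eq_Rintegral => x _; rewrite complexImM.
Qed.

Lemma cRintegral0 : cRintegral I2pi (fun=> 0) = 0 :> C.
Proof. by apply: complexP; rewrite /= Rintegral_const_2pi mul0r. Qed.

Lemma cRintegral_circle (m : int) :
  cRintegral I2pi (fun x => circle (m%:~R * x)) = if m == 0 then (2 * pi)%:C%C else 0.
Proof.
case: eqP => [->|/eqP m0].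
  apply: complexP => /=.
    rewrite (@eq_Rintegral _ _ _ lebesgue_measure I2pi (fun=> 1)); last by move=> x _; rewrite mul0r cos0.
    by rewrite Rintegral_const_2pi mul1r.
  rewrite (@eq_Rintegral _ _ _ lebesgue_measure I2pi (fun=> 0)); last by move=> x _; rewrite mul0r sin0.
  by rewrite Rintegral_const_2pi mul0r.
have c0 : (m%:~R : R) != 0 by rewrite intr_eq0.
set c : R := m%:~R in c0 *.
have [e1 e2] : cos (c * (2 * pi)) = 1 /\ sin (c * (2 * pi)) = 0.
  by have := circle_2pi m; rewrite /circle => -[].
have [cc cs] := ccontinuous_circle c.
have dc := is_derive_mull c.
have ds x : is_derive x 1 (fun y => c^-1 * sin (c * y)) (cos (c * x)).
  have h := @is_derive1_comp R sin (fun y => c * y) x (cos (c * x)) c (is_derive_sin _) (dc x).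
  have h2 := @is_deriveZ R R R (fun y => sin (c * y)) c^-1 x 1 (cos (c * x) * c) h.
  by rewrite /GRing.scale /= mulrCA mulVf // mulr1 in h2.
have dk x : is_derive x 1 (fun y => - c^-1 * cos (c * y)) (sin (c * x)).
  have h := @is_derive1_comp R cos (fun y => c * y) x (- sin (c * x)) c (is_derive_cos _) (dc x).
  have h2 := @is_deriveZ R R R (fun y => cos (c * y)) (- c^-1) x 1 (- sin (c * x) * c) h.
  rewrite /GRing.scale /= in h2.
  have e3 : - c^-1 * (- sin (c * x) * c) = sin (c * x) by field.
  by rewrite e3 in h2.
apply: complexP => /=.
  by rewrite (FTC2_2pi cc ds) e2 !mulr0 sin0 mulr0 subrr.
by rewrite (FTC2_2pi cs dk) e1 mulr0 cos0 subrr.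
Qed.

End ContourIntegral.

(** * Laurent polynomials in several variables and iterated contour integrals *)

Section LaurentIntegral.
Variable R : realType.
Local Notation C := R[i].
Local Notation I2pi := (`[0, 2 * pi]%classic : set R).
Implicit Types (w z : C) (F : seq C -> C).

Lemma normC_Re_le z (e : R) : `|z| <= e%:C%C -> `|complex.Re z| <= e.
Proof. by move=> h; rewrite -lecR; apply: le_trans (normc_ge_Re z) h. Qed.

Lemma normC_Im_le z (e : R) : `|z| <= e%:C%C -> `|complex.Im z| <= e.
Proof.
move=> h; have := @normC_Re_le (- 'i%C * z) e.
rewrite normrM normrN (_ : `|'i%C : C| = 1) ?mul1r; last first.
  by rewrite normc_def /= expr0n /= add0r expr1n sqrtr1.
by move=> /(_ h); rewrite complexReM /= oppr0 mul0r mulN1r sub0r opprK.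
Qed.

Lemma normC_le_ReIm z : `|z| <= (`|complex.Re z| + `|complex.Im z|)%:C%C.
Proof.
rewrite [in X in X <= _](complexE z) rmorphD /=; apply: le_trans (ler_normD _ _) _.
rewrite normrM (_ : `|'i%C : C| = 1) ?mul1r; last first.
  by rewrite normc_def /= expr0n /= add0r expr1n sqrtr1.
by rewrite !normc_def /= expr0n /= !addr0 !sqrtr_sqr.
Qed.

Lemma unif_lim_continuous (f : R -> R) :
  (forall e, 0 < e -> exists2 g : R -> R, continuous g & forall x, `|f x - g x| <= e) -> continuous f.
Proof.
move=> h x; apply/cvgrPdist_le => e e0.
have e3 : 0 < e / 3 by rewrite divr_gt0.
have [g cg hg] := h _ e3.
have /cvgrPdist_le/(_ _ e3) := cg x.
apply: filterS => y hy.
have := hg x; have := hg y; rewrite (distrC (f y)) => h1 h2.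
have -> : f x - f y = (f x - g x) + (g x - g y) + (g y - f y) by ring.
apply: le_trans (ler_normD _ _) _; apply: le_trans (lerD (ler_normD _ _) (lexx _)) _.
by apply: le_trans (lerD (lerD h2 hy) h1) _; lra.
Qed.

Lemma ccontinuous_unif (G : R -> C) :
  (forall e : R, 0 < e -> exists2 H, ccontinuous H & forall x, `|G x - H x| <= e%:C%C) -> ccontinuous G.
Proof.
move=> h; split; apply: unif_lim_continuous => e /h[H [h1 h2] hH].
  exists (fun x => complex.Re (H x)) => // x.
  by have := normC_Re_le (hH x); rewrite complexReD complexReN.
exists (fun x => complex.Im (H x)) => // x.
by have := normC_Im_le (hH x); rewrite complexImD complexImN.
Qed.

Lemma cRintegral_dist (G H : R -> C) (e : R) : ccontinuous G -> ccontinuous H ->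
  (forall x, `|G x - H x| <= e%:C%C) ->
  `|cRintegral I2pi G - cRintegral I2pi H| <= (8 * pi * e)%:C%C.
Proof.
move=> cG cH hGH.
have cD : ccontinuous (fun x => G x + (-1) * H x) by apply: ccontinuousD => //; apply: ccontinuousZ.
rewrite -[X in _ - X]mul1r -mulNr -cRintegralZ // -cRintegralD //; last exact: ccontinuousZ.
have hD x : `|G x + (-1) * H x| <= e%:C%C by rewrite mulN1r.
have e0 : 0 <= e by rewrite -ler0c; apply: le_trans (hD 0).
apply: le_trans (normC_le_ReIm _) _; rewrite lecR /=.
have h1 := Rintegral_bound cD.1 (fun x => normC_Re_le (hD x)).
have h2 := Rintegral_bound cD.2 (fun x => normC_Im_le (hD x)).
apply: le_trans (lerD h1 h2) _.
have : 0 <= e * pi by rewrite mulr_ge0 // pi_ge0.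
lra.
Qed.

(* A pair (c, [:: m_1; ...; m_k]) encodes the monomial c * w_1 ^ m_1 * ... * w_k ^ m_k. *)
Definition monomial (m : seq int) (s : seq C) : C := \prod_(p <- zip s m) p.1 ^ p.2.
Definition lpoly (l : seq (C * seq int)) (s : seq C) : C := \sum_(x <- l) x.1 * monomial x.2 s.
Definition lpoly_oint (k : nat) (l : seq (C * seq int)) : C :=
  \sum_(x <- l) if all (pred1 (-1)) x.2 then x.1 * (2 * pi%:C%C * 'i%C) ^+ k else 0.
Definition lpoly_arity (k : nat) (l : seq (C * seq int)) := all (fun x => size x.2 == k) l.
Definition on_circle w := exists t : R, w = circle t.

(** On the circle [dw] raises the exponent by one, and only the exponent 0 has a nonzero mean: the
    residue of a Laurent polynomial. *)
Lemma oint_laurent (l : seq (C * int)) :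
  oint (fun w => \sum_(x <- l) x.1 * w ^ x.2) =
  \sum_(x <- l) if x.2 == -1 then x.1 * (2 * pi%:C%C * 'i%C) else 0.
Proof.
have E : (fun t => (\sum_(x <- l) x.1 * (circle t : C) ^ x.2) * ('i%C * circle t)) =
  (fun t : R => \sum_(x <- l) (x.1 * 'i%C) * circle ((x.2 + 1)%:~R * t)).
  apply/funext => t; rewrite mulr_suml; apply: eq_bigr => x _.
  by rewrite circleX rmorphD /= mulrDl mul1r circleD mulrACA.
rewrite /oint E; elim: l {E} => [|x l IH].
  under [X in cRintegral _ X]eq_fun do rewrite big_nil.
  by rewrite big_nil cRintegral0.
under [X in cRintegral _ X]eq_fun do rewrite big_cons.
rewrite big_cons cRintegralD; last 2 first.
- by apply: ccontinuousZ; apply: ccontinuous_circle.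
- elim: l {IH} => [|y l IH].
    under [X in ccontinuous X]eq_fun do rewrite big_nil.
    exact: ccontinuous0.
  under [X in ccontinuous X]eq_fun do rewrite big_cons.
  by apply: ccontinuousD => //; apply: ccontinuousZ; apply: ccontinuous_circle.
rewrite IH cRintegralZ; last exact: ccontinuous_circle.
rewrite cRintegral_circle addr_eq0; case: eqP => _; rewrite ?mulr0 //.
by rewrite rmorphM /= rmorph_nat -mulrA [X in _ * X]mulrC.
Qed.

Lemma ccontinuous_laurent (l : seq (C * int)) :
  ccontinuous (fun t => (\sum_(x <- l) x.1 * (circle t : C) ^ x.2) * ('i%C * circle t)).
Proof.
rewrite (_ : (fun t => _) = (fun t : R => \sum_(x <- l) (x.1 * 'i%C) * circle ((x.2 + 1)%:~R * t))); last first.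
  apply/funext => t; rewrite mulr_suml; apply: eq_bigr => x _.
  by rewrite circleX rmorphD /= mulrDl mul1r circleD mulrACA.
elim: l => [|y l IH].
  under [X in ccontinuous X]eq_fun do rewrite big_nil.
  exact: ccontinuous0.
under [X in ccontinuous X]eq_fun do rewrite big_cons.
by apply: ccontinuousD => //; apply: ccontinuousZ; apply: ccontinuous_circle.
Qed.

(** Approximability to every precision makes [h] continuous on the circle, so that the integral is
    additive; the single approximation [l] is compared afterwards. *)
Lemma oint_approx (h : C -> C) :
  (forall e : R, 0 < e -> exists l : seq (C * int), forall w, on_circle w ->
     `|h w - \sum_(x <- l) x.1 * w ^ x.2| <= e%:C%C) ->
  forall (l : seq (C * int)) (e : R),
  (forall w, on_circle w -> `|h w - \sum_(x <- l) x.1 * w ^ x.2| <= e%:C%C) ->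
  `|oint h - oint (fun w => \sum_(x <- l) x.1 * w ^ x.2)| <= (8 * pi * e)%:C%C.
Proof.
move=> happ l e hl.
have key (l' : seq (C * int)) (e' : R) : (forall w, on_circle w -> `|h w - \sum_(x <- l') x.1 * w ^ x.2| <= e'%:C%C) ->
  forall t : R, `|h (circle t) * ('i%C * circle t) - (\sum_(x <- l') x.1 * (circle t : C) ^ x.2) * ('i%C * circle t)| <= e'%:C%C.
  move=> hl' t; rewrite -mulrBl !normrM normr_circle mulr1.
  rewrite (_ : `|'i%C : C| = 1) ?mulr1; last by rewrite normc_def /= expr0n /= add0r expr1n sqrtr1.
  by apply: hl'; exists t.
apply: cRintegral_dist; last exact: key.
- apply: ccontinuous_unif => e' /happ[l' hl']; exists (fun t => (\sum_(x <- l') x.1 * (circle t : C) ^ x.2) * ('i%C * circle t)).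
    exact: ccontinuous_laurent.
  exact: key.
- exact: ccontinuous_laurent.
Qed.

Definition lpoly_at w (l : seq (C * seq int)) : seq (C * seq int) :=
  [seq (x.1 * w ^ head 0 x.2, behead x.2) | x <- l].

Lemma lpoly_cons k l w s : lpoly_arity k.+1 l -> lpoly l (w :: s) = lpoly (lpoly_at w l) s.
Proof.
move=> /allP ar; rewrite /lpoly big_map !big_seq; apply: eq_bigr => x /ar.
case: x => c [|m ms] //= _; rewrite /monomial /= big_cons /=.
by rewrite mulrA.
Qed.

Lemma lpoly_arity_at k l w : lpoly_arity k.+1 l -> lpoly_arity k (lpoly_at w l).
Proof.
move=> /allP ar; apply/allP => _ /mapP[x /ar + ->] /=.
by case: x.2.
Qed.

(** What remains of a Laurent polynomial once all variables but the first are integrated out. *)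
Definition lpoly_head k (l : seq (C * seq int)) : seq (C * int) :=
  [seq (if all (pred1 (-1)) (behead x.2) then x.1 * (2 * pi%:C%C * 'i%C) ^+ k else 0, head 0 x.2) | x <- l].

Lemma lpoly_oint_at k l w :
  lpoly_oint k (lpoly_at w l) = \sum_(x <- lpoly_head k l) x.1 * w ^ x.2.
Proof.
rewrite /lpoly_oint !big_map; apply: eq_bigr => x _ /=.
by case: ifP => _; rewrite ?mul0r // mulrAC.
Qed.

Lemma oint_lpoly_head k l : lpoly_arity k.+1 l ->
  oint (fun w => \sum_(x <- lpoly_head k l) x.1 * w ^ x.2) = lpoly_oint k.+1 l.
Proof.
move=> /allP ar; rewrite oint_laurent big_map /lpoly_oint !big_seq; apply: eq_bigr => x /ar /=.
case: x => c [|m ms] //= _; case: eqP => _ //=.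
by case: ifP => _; rewrite ?mul0r // exprSr [RHS]mulrA.
Qed.

Definition circle_seq (s : seq C) := forall w, w \in s -> on_circle w.

Definition unif_approx k F := forall e : R, 0 < e -> exists2 l, lpoly_arity k l &
  forall s, size s = k -> circle_seq s -> `|F s - lpoly l s| <= e%:C%C.

(** By induction the inner integral, as a function of the first variable, is itself a uniform limit
    of Laurent polynomials, namely of the [lpoly_head], so [oint_approx] applies to it. Each
    integration costs a factor [8 * pi]. *)
Lemma iter_oint_approx k F : unif_approx k F ->
  forall l (e : R), lpoly_arity k l ->
  (forall s, size s = k -> circle_seq s -> `|F s - lpoly l s| <= e%:C%C) ->
  `|iter_oint k F - lpoly_oint k l| <= ((8 * pi) ^+ k * e)%:C%C.
Proof.
have p0 k' : 0 < (8 * pi : R) ^+ k' by rewrite exprn_gt0 // mulr_gt0 // pi_gt0.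
elim: k F => [|k IH] F happ l e ar hl /=.
  rewrite expr0 mul1r (_ : lpoly_oint 0 l = lpoly l [::]); first exact: hl.
  rewrite /lpoly_oint /lpoly !big_seq; apply: eq_bigr => x /(allP ar).
  by case: x => c [] //= _; rewrite expr0 /monomial /= big_nil.
have step (w : C) : on_circle w -> forall l' e', lpoly_arity k.+1 l' ->
    (forall s, size s = k.+1 -> circle_seq s -> `|F s - lpoly l' s| <= e'%:C%C) ->
    `|iter_oint k (fun s => F (w :: s)) - \sum_(x <- lpoly_head k l') x.1 * w ^ x.2| <= ((8 * pi) ^+ k * e')%:C%C.
  move=> hw l' e' ar' hl'; rewrite -lpoly_oint_at.
  have cs s : circle_seq s -> circle_seq (w :: s).
    by move=> h v; rewrite inE => /orP[/eqP ->|/h].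
  apply: IH.
  - move=> d /happ[l2 ar2 hl2]; exists (lpoly_at w l2); first exact: lpoly_arity_at.
    by move=> s ss hs; rewrite -(lpoly_cons w s ar2); apply: hl2; [rewrite /= ss|exact: cs].
  - exact: lpoly_arity_at.
  - by move=> s ss hs; rewrite -(lpoly_cons w s ar'); apply: hl'; [rewrite /= ss|exact: cs].
rewrite -oint_lpoly_head // exprS -mulrA.
apply: oint_approx; last by move=> w hw; apply: step.
move=> d d0; have d1 : 0 < d / (8 * pi) ^+ k by rewrite divr_gt0.
have [l' ar' hl'] := happ _ d1; exists (lpoly_head k l') => w hw.
by have := step w hw l' _ ar' hl'; rewrite mulrC divfK ?gt_eqF.
Qed.

End LaurentIntegral.

(** * Power series of the complex exponential and of its divided difference *)

Lemma sum_from (V : nmodType) N i (f : nat -> V) : (i <= N)%N ->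
  \sum_(k < N) (if (i <= k)%N then f (k - i)%N else 0) = \sum_(j < N - i) f j.
Proof.
move=> le; have [d ->] : exists d, N = (i + d)%N by exists (N - i)%N; rewrite subnKC.
rewrite addKn big_split_ord /= big1 ?add0r; last by move=> k _; rewrite leqNgt ltn_ord.
by apply: eq_bigr => k _; rewrite leq_addr addKn.
Qed.

Lemma sum_triangle (V : nmodType) N (f : nat -> nat -> V) :
  \sum_(k < N) \sum_(i < k.+1) f i (k - i)%N =
  \sum_(i < N) \sum_(j < N) if (i + j < N)%N then f i j else 0.
Proof.
transitivity (\sum_(k < N) \sum_(i < N) if (i <= k)%N then f i (k - i)%N else 0).
  apply: eq_bigr => k _; rewrite (big_ord_widen _ (fun i => f i (k - i)%N) (ltn_ord k)).
  by rewrite big_mkcond.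
rewrite exchange_big /=; apply: eq_bigr => i _.
rewrite (sum_from (f i) (ltnW (ltn_ord i))).
rewrite (big_ord_widen _ (f i) (leq_subr i N)) big_mkcond /=.
by apply: eq_bigr => j _; rewrite ltn_subRL.
Qed.

Section ComplexExp.
Variable R : realType.
Local Notation C := R[i].
Implicit Types (x y a : R) (u v w z : C) (N D : nat).

Definition ctends (s : nat -> C) (l : C) := forall e : R, 0 < e ->
  exists N0 : nat, forall N, (N0 <= N)%N -> `|s N - l| <= e%:C%C.

Lemma norm_real_complex x : 0 <= x -> `|x%:C%C : C| = x%:C%C.
Proof. by move=> x0; rewrite ger0_norm // ler0c. Qed.

Lemma normc_ec z (p : R) k : `|z| <= p%:C%C -> `|ec z k| <= (ec p k)%:C%C.
Proof.
move=> h; rewrite /ec normrM normrX normfV normr_nat fmorph_div rmorphXn /= rmorph_nat.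
by apply: ler_wpM2r; [rewrite invr_ge0 | apply: lerXn2r; rewrite ?nnegrE // (le_trans _ h)].
Qed.

Lemma ec_scale2 (p : R) k : ec p k = 2 ^- k * ec (2 * p) k.
Proof. by rewrite /ec exprMn !mulrA mulVf ?mul1r // expf_neq0. Qed.

(* Cauchy product: the defect of multiplicativity of the partial sums of exp lives in total degree >= N. *)
Lemma exp_partial_mul u v (p q : R) N : 0 <= p -> 0 <= q -> `|u| <= p%:C%C -> `|v| <= q%:C%C ->
  `|(\sum_(k < N) ec u k) * (\sum_(k < N) ec v k) - \sum_(k < N) ec (u + v) k|
  <= (2 ^- N * (expR (2 * p) * expR (2 * q)))%:C%C.
Proof.
move=> p0 q0 hu hv.
have -> : \sum_(k < N) ec (u + v) k = \sum_(i < N) \sum_(j < N) if (i + j < N)%N then ec u i * ec v j else 0.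
  rewrite -(sum_triangle N (fun i j => ec u i * ec v j)); apply: eq_bigr => k _.
  rewrite /ec addrC exprDn mulr_suml; apply: eq_bigr => i _.
  have le : (i <= k)%N by rewrite -ltnS.
  have f0 j : j`!%:R != 0 :> C by rewrite pnatr_eq0 -lt0n fact_gt0.
  rewrite -(bin_fact le) !natrM -mulr_natr.
  have := f0 i; have := f0 (k - i)%N.
  have b0 : 'C(k, i)%:R != 0 :> C by rewrite pnatr_eq0 -lt0n bin_gt0.
  by move: (_ ^+ _) => s; move: (_ ^+ _) => t h1 h2; field; rewrite b0 h1 h2.
rewrite big_distrlr /= -sumrB; apply: le_trans (ler_norm_sum _ _ _) _.
have bnd (i j : nat) : `|ec u i * ec v j - (if (i + j < N)%N then ec u i * ec v j else 0)|
    <= (2 ^- N * (ec (2 * p) i * ec (2 * q) j))%:C%C.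
  have g0 : 0 <= ec (2 * p) i * ec (2 * q) j by rewrite mulr_ge0 // ec_ge0 // mulr_ge0.
  case: ltnP => h.
    by rewrite subrr normr0 ler0c mulr_ge0 // invr_ge0 exprn_ge0.
  rewrite subr0 normrM; apply: le_trans (ler_pM _ _ (normc_ec i hu) (normc_ec j hv)) _ => //.
  rewrite -rmorphM lecR /= (ec_scale2 p) (ec_scale2 q) mulrACA -invfM -exprD; apply: ler_wpM2r => //.
  by rewrite lef_pV2 ?posrE ?exprn_gt0 //; apply: ler_weXn2l => //; rewrite ler1n.
apply: (@le_trans _ _ (\sum_(i < N) \sum_(j < N) (2 ^- N * (ec (2 * p) i * ec (2 * q) j))%:C%C)).
  apply: ler_sum => i _; rewrite -sumrB; apply: le_trans (ler_norm_sum _ _ _) _.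
  by apply: ler_sum => j _; apply: bnd.
rewrite (_ : \sum_(i < N) _ = (2 ^- N * ((\sum_(i < N) ec (2 * p) i) * (\sum_(j < N) ec (2 * q) j)))%:C%C); last first.
  rewrite big_distrlr /= mulr_sumr rmorph_sum /=; apply: eq_bigr => i _.
  by rewrite mulr_sumr rmorph_sum.
rewrite lecR; apply: ler_wpM2l; first by rewrite invr_ge0 exprn_ge0.
by apply: ler_pM; rewrite ?sum_ec_le ?mulr_ge0 // sumr_ge0 // => i _; rewrite ec_ge0 // mulr_ge0.
Qed.

Lemma exp_partial_real x N : \sum_(k < N) ec (x%:C%C : C) k = (\sum_(k < N) ec x k)%:C%C.
Proof.
rewrite rmorph_sum; apply: eq_bigr => k _.
by rewrite /ec fmorph_div rmorphXn /= rmorph_nat.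
Qed.

Lemma exp_partial_imag y N : \sum_(k < N) ec ('i%C * y%:C%C : C) k =
  Complex (\sum_(k < N) cos_coeff y k) (\sum_(k < N) sin_coeff y k).
Proof.
elim: N => [|N IH]; first by rewrite !big_ord0.
rewrite !big_ord_recr /= IH; apply/eqP; rewrite eq_complex /=.
suff -> : ec ('i%C * y%:C%C : C) N = Complex (cos_coeff y N) (sin_coeff y N) by rewrite /= !eqxx.
have i2 (j : nat) : ('i%C : C) ^+ j.*2 = ((-1) ^+ j)%:C%C.
  by rewrite -mul2n exprM sqr_i rmorphXn rmorphN1.
rewrite /ec exprMn /cos_coeff /sin_coeff /=.
have e : ('i%C : C) ^+ N = Complex ((~~ odd N)%:R * (-1) ^+ N./2) ((odd N)%:R * (-1) ^+ N.-1./2).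
  rewrite -{1}(odd_double_half N) exprD i2; case: (boolP (odd N)) => o /=.
    have -> : N.-1./2 = N./2 by rewrite -{1}(odd_double_half N) o /= doubleK.
    by apply: complexP; rewrite ?complexReM ?complexImM ?expr1 /=; ring.
  by apply: complexP; rewrite ?complexReM ?complexImM ?expr0 /=; ring.
have h : (y%:C%C : C) ^+ N / N`!%:R = (y ^+ N / N`!%:R)%:C%C.
  by rewrite fmorph_div rmorphXn /= rmorph_nat.
rewrite -[LHS]mulrA h e; apply: complexP; rewrite ?complexReM ?complexImM /= -?exprnP; ring.
Qed.

Lemma ctends_real (f g : nat -> R) a b : (f n @[n --> \oo] --> a)%classic -> (g n @[n --> \oo] --> b)%classic ->
  ctends (fun n => Complex (f n) (g n)) (Complex a b).
Proof.
move=> ha hb e e0; have e2 : 0 < e / 2 by rewrite divr_gt0.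
move/cvgrPdist_le : ha => /(_ _ e2) [N1 _ h1]; move/cvgrPdist_le : hb => /(_ _ e2) [N2 _ h2].
exists (maxn N1 N2) => N; rewrite geq_max => /andP[le1 le2].
apply: le_trans (normC_le_ReIm _) _; rewrite lecR /= distrC (distrC (g N)).
by apply: le_trans (lerD (h1 _ le1) (h2 _ le2)) _; rewrite -splitr.
Qed.

Lemma half_pow_small (K e : R) : 0 <= K -> 0 < e -> exists N0 : nat, forall N, (N0 <= N)%N -> 2 ^- N * K <= e.
Proof.
move=> K0 e0; exists (Num.truncn (K / e)).+1 => N hN.
rewrite ler_pdivrMl ?exprn_gt0 // mulrC -ler_pdivrMl // mulrC.
apply: (@le_trans _ _ N%:R).
  apply: ltW; apply: lt_le_trans (_ : (Num.truncn (K / e)).+1%:R <= _); last by rewrite ler_nat.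
  by apply: truncnS_gt.
by rewrite -natrX ler_nat ltnW // ltn_expl.
Qed.

(** [cexp] is defined by real exponential, cosine and sine; its power series comes from theirs,
    since the defect bounded in [exp_partial_mul] tends to 0. *)
Lemma exp_series_rect x y : ctends (fun N => \sum_(k < N) ec (x%:C%C + 'i%C * y%:C%C : C) k)
  (Complex (expR x * cos y) (expR x * sin y)).
Proof.
have nx : `|x%:C%C : C| <= (`|x|)%:C%C by rewrite normc_def /= expr0n addr0 sqrtr_sqr.
have ny : `|'i%C * y%:C%C : C| <= (`|y|)%:C%C.
  rewrite normrM (_ : `|'i%C : C| = 1) ?mul1r; last by rewrite normc_def /= expr0n /= add0r expr1n sqrtr1.
  by rewrite normc_def /= expr0n addr0 sqrtr_sqr.
pose E N := \sum_(k < N) ec x k; pose c N := \sum_(k < N) cos_coeff y k; pose s N := \sum_(k < N) sin_coeff y k.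
have toE : (E n @[n --> \oo] --> expR x)%classic.
  have := is_cvg_series_exp_coeff x; rewrite /expR /series /=.
  by under eq_fun do rewrite big_mkord.
have toc : (c n @[n --> \oo] --> cos y)%classic.
  have := @is_cvg_series_cos_coeff R y; rewrite unlock /series /=.
  by under eq_fun do rewrite big_mkord.
have tos : (s n @[n --> \oo] --> sin y)%classic.
  have := @is_cvg_series_sin_coeff R y; rewrite unlock /series /=.
  by under eq_fun do rewrite big_mkord.
move=> e e0; have e2 : 0 < e / 2 by rewrite divr_gt0.
have [N1 h1] := ctends_real (cvgM toE toc) (cvgM toE tos) e2.
have K0 : 0 <= expR (2 * `|x|) * expR (2 * `|y|) by rewrite mulr_ge0 ?expR_ge0.
have [N2 h2] := half_pow_small K0 e2.
exists (maxn N1 N2) => N; rewrite geq_max => /andP[le1 le2].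
have := exp_partial_mul N (normr_ge0 x) (normr_ge0 y) nx ny.
rewrite [X in X * _ - _]exp_partial_real [X in _ * X - _]exp_partial_imag => h3.
have := h1 _ le1.
rewrite (_ : Complex (E N * c N) (E N * s N) = (E N)%:C%C * Complex (c N) (s N)); last first.
  by apply/eqP; rewrite eq_complex /= !mul0r subr0 addr0 !eqxx.
move=> h4; rewrite -[X in `|X|](subrKA ((E N)%:C%C * Complex (c N) (s N))).
apply: le_trans (ler_normD _ _) _; rewrite [X in X + _]distrC.
rewrite [e in leRHS]splitr rmorphD /=; apply: lerD => //.
by apply: le_trans h3 _; rewrite lecR; apply: h2.
Qed.

Lemma cexp_series z : ctends (fun N => \sum_(k < N) ec z k) (cexp z).
Proof.
have -> : cexp z = Complex (expR (complex.Re z) * cos (complex.Im z)) (expR (complex.Re z) * sin (complex.Im z)).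
  by apply/eqP; rewrite /cexp eq_complex /= !mul0r subr0 addr0 !eqxx.
rewrite [X in ctends (fun N => \sum_(k < N) ec X k)](complexE z).
exact: exp_series_rect.
Qed.

Lemma cexpD z w : cexp (z + w) = cexp z * cexp w.
Proof.
case: z => x y; case: w => x' y'; rewrite /cexp /= expRD rmorphM mulrACA; congr (_ * _).
exact: circleD.
Qed.

Lemma cexp0 : cexp (0 : C) = 1.
Proof. by rewrite /cexp /= expR0 mul1r cos0 sin0. Qed.

Lemma cexp_neq0 z : cexp z != 0.
Proof.
have : cexp z * cexp (- z) != 0 by rewrite -cexpD subrr cexp0 oner_neq0.
by rewrite mulf_eq0 negb_or => /andP[].
Qed.

Lemma cexpN z : cexp (- z) = (cexp z)^-1.
Proof. by apply: (mulfI (cexp_neq0 z)); rewrite -cexpD subrr cexp0 divff // cexp_neq0. Qed.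

(** The entire function [(e^z - 1) / z], with its removable singularity filled; it treats the
    diagonal of the kernel together with the rest. *)
Definition exp_quot z : C := if z == 0 then 1 else (cexp z - 1) / z.

Lemma exp_quot_series z : ctends (fun N => \sum_(k < N) z ^+ k / (k.+1)`!%:R) (exp_quot z).
Proof.
rewrite /exp_quot; case: eqP => [->|/eqP z0] e e0.
  exists 1%N => -[//|N] _; rewrite big_ord_recl /= expr0 divr1 big1 ?addr0.
    by rewrite subrr normr0 ler0c ltW.
  by move=> k _; rewrite exprS mul0r mul0r.
have nz : 0 < complex.Re `|z|.
  by have : 0 < `|z| by [rewrite normr_gt0]; rewrite normc_def /= ltcR.
have nzE : `|z| = (complex.Re `|z|)%:C%C by rewrite normc_def.
have [N0 h] := cexp_series z (mulr_gt0 e0 nz).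
exists N0 => N hN; have := h N.+1 (leqW hN).
rewrite big_ord_recl /= {1}/ec expr0 fact0 divr1 => h1.
have -> : \sum_(k < N) z ^+ k / (k.+1)`!%:R - (cexp z - 1) / z =
    (1 + \sum_(i < N) ec z (bump 0 i) - cexp z) / z.
  have E1 : (\sum_(k < N) z ^+ k / (k.+1)`!%:R) * z = \sum_(i < N) ec z (bump 0 i).
    rewrite mulr_suml; apply: eq_bigr => k _; rewrite /ec /bump leq0n add1n exprSr.
    by rewrite mulrAC.
  by apply: (mulIf z0); rewrite mulrBl !divfK // E1; ring.
rewrite normrM normfV ler_pdivrMr ?normr_gt0 // nzE -rmorphM.
exact: h1.
Qed.

(* Taylor coefficients of [(e^(a (z - w)) - 1) / (z - w)] at [z^r w^c]. *)
Definition frob a (r c : nat) : R := (-1) ^+ c * a ^+ (r + c).+1 / ((r + c).+1 * (r`! * c`!))%:R.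

Lemma frob_bound a r c : 0 <= a -> `|frob a r c| <= a * (ec a r * ec a c).
Proof.
move=> a0; rewrite /frob !normrM normrX normrN1 expr1n mul1r normfV normr_nat ger0_norm ?exprn_ge0 //.
have -> : ec a r * ec a c = a ^+ (r + c) / (r`! * c`!)%:R by rewrite /ec exprD natrM invfM; ring.
rewrite exprS -mulrA; apply: ler_wpM2l => //; apply: ler_wpM2l; first exact: exprn_ge0.
rewrite lef_pV2 ?posrE ?ltr0n ?muln_gt0 ?fact_gt0 // ler_nat.
by rewrite leq_pmull.
Qed.

Lemma exp_quot_rect a z w D D' : 0 <= a -> `|z| = 1 -> `|w| = 1 -> (D <= D')%N ->
  `|a%:C%C * exp_quot (a%:C%C * (z - w)) - \sum_(r < D) \sum_(c < D') (frob a r c)%:C%C * z ^+ r * w ^+ c|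
  <= (2 ^- D * (a * expR (2 * a) ^+ 2))%:C%C.
Proof.
move=> a0 nz nw DD.
set S := \sum_(r < D) _; set B : R := 2 ^- D * _.
pose T N := \sum_(k < N) (a%:C%C * (z - w)) ^+ k / (k.+1)`!%:R.
have TE N : a%:C%C * T N = \sum_(r < N) \sum_(c < N) if (r + c < N)%N then (frob a r c)%:C%C * z ^+ r * w ^+ c else 0.
  rewrite -(sum_triangle N (fun r c => (frob a r c)%:C%C * z ^+ r * w ^+ c)) mulr_sumr.
  apply: eq_bigr => k _; rewrite [z - w]addrC exprMn exprDn mulrA mulrA -exprS -mulrA mulr_suml mulr_sumr.
  apply: eq_bigr => i _; have le : (i <= k)%N by rewrite -ltnS.
  rewrite /frob subnKC // fmorph_div !rmorphM !rmorphXn rmorphN1 /= rmorph_nat exprNn.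
  have f0 j : j`!%:R != 0 :> C by rewrite pnatr_eq0 -lt0n fact_gt0.
  have b0 : 'C(k, i)%:R != 0 :> C by rewrite pnatr_eq0 -lt0n bin_gt0.
  have k0 : k.+1%:R != 0 :> C by rewrite pnatr_eq0.
  rewrite factS -(bin_fact le) !natrM -mulr_natr.
  have := f0 i; have := f0 (k - i)%N.
  move: (_ ^+ _) (_ ^+ _) (_ ^+ _) (_ ^+ _) => s1 s2 s3 s4 h1 h2.
  by field; rewrite b0 h1 h2 nat1r k0.
have bnd N : (D + D' <= N)%N -> `|a%:C%C * T N - S| <= B%:C%C.
  move=> hN; have hD : (D <= N)%N by apply: leq_trans hN; rewrite leq_addr.
  have hD' : (D' <= N)%N by apply: leq_trans hN; rewrite leq_addl.
  have -> : S = \sum_(r < N) \sum_(c < N) if (r < D)%N && (c < D')%N then (frob a r c)%:C%C * z ^+ r * w ^+ c else 0.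
    rewrite /S (big_ord_widen _ (fun r => \sum_(c < D') (frob a r c)%:C%C * z ^+ r * w ^+ c) hD) big_mkcond /=.
    apply: eq_bigr => r _; case: ltnP => _ /=; last by rewrite big1.
    by rewrite (big_ord_widen _ (fun c => (frob a r c)%:C%C * z ^+ r * w ^+ c) hD') big_mkcond.
  rewrite TE -sumrB; apply: le_trans (ler_norm_sum _ _ _) _.
  apply: (@le_trans _ _ (\sum_(r < N) \sum_(c < N) (2 ^- D * (a * (ec (2 * a) r * ec (2 * a) c)))%:C%C)).
    apply: ler_sum => r _; rewrite -sumrB; apply: le_trans (ler_norm_sum _ _ _) _.
    apply: ler_sum => c _.
    have g1 : 0 <= ec (2 * a) r * ec (2 * a) c by apply: mulr_ge0; apply: ec_ge0; apply: mulr_ge0.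
    have g0 : 0 <= a * (ec (2 * a) r * ec (2 * a) c) by apply: mulr_ge0.
    have B0 : 0 <= (2 ^- D * (a * (ec (2 * a) r * ec (2 * a) c)))%:C%C :> C.
      by rewrite ler0c mulr_ge0 // invr_ge0 exprn_ge0.
    have big : (D <= r + c)%N -> `|(frob a r c)%:C%C * z ^+ r * w ^+ c| <= (2 ^- D * (a * (ec (2 * a) r * ec (2 * a) c)))%:C%C.
      move=> h; rewrite !normrM !normrX nz nw !expr1n !mulr1 normc_def /= expr0n addr0 sqrtr_sqr lecR.
      apply: le_trans (frob_bound r c a0) _; rewrite [leRHS]mulrCA; apply: ler_wpM2l => //.
      rewrite (ec_scale2 a r) (ec_scale2 a c) mulrACA -invfM -exprD; apply: ler_wpM2r => //.
      by rewrite lef_pV2 ?posrE ?exprn_gt0 //; apply: ler_weXn2l => //; rewrite ler1n.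
    case: (boolP ((r < D)%N && (c < D')%N)) => [/andP[h1 h2]|].
      by rewrite (leq_trans _ hN) ?subrr ?normr0 // -addSn leq_add // ltnW.
    rewrite negb_and -!leqNgt => h; rewrite subr0; case: ifP => _; last by rewrite normr0.
    apply: big; case/orP: h => h; first by rewrite (leq_trans h) // leq_addr.
    by rewrite (leq_trans DD) // (leq_trans h) // leq_addl.
  rewrite (_ : \sum_(r < N) _ = (2 ^- D * (a * ((\sum_(r < N) ec (2 * a) r) * (\sum_(c < N) ec (2 * a) c))))%:C%C); last first.
    rewrite big_distrlr /= !mulr_sumr rmorph_sum /=; apply: eq_bigr => i _.
    by rewrite !mulr_sumr rmorph_sum.
  rewrite lecR /B; apply: ler_wpM2l; first by rewrite invr_ge0 exprn_ge0.
  apply: ler_wpM2l => //; rewrite expr2.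
  by apply: ler_pM; rewrite ?sum_ec_le ?mulr_ge0 // sumr_ge0 // => i _; rewrite ec_ge0 // mulr_ge0.
(* [bnd] is uniform in [N], so letting the triangle grow costs only an arbitrary [e]. *)
have key (e : R) : 0 < e -> `|a%:C%C * exp_quot (a%:C%C * (z - w)) - S| <= (B + e)%:C%C.
  move=> e0; have e1 : 0 < e / (a + 1) by rewrite divr_gt0 // ltr_wpDl.
  have [N0 h] := exp_quot_series (a%:C%C * (z - w)) e1.
  have h1 := h _ (leq_maxl N0 (D + D')); have h2 := bnd _ (leq_maxr N0 (D + D')).
  rewrite -[X in `|X|](subrKA (a%:C%C * T (maxn N0 (D + D')))).
  apply: le_trans (ler_normD _ _) _; rewrite addrC rmorphD; apply: lerD => //.
  rewrite distrC -mulrBr normrM norm_real_complex //.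
  apply: le_trans (ler_wpM2l _ h1) _; first by rewrite ler0c.
  rewrite -rmorphM lecR /= mulrCA ger_pMr // ler_pdivrMr ?mul1r ?ltr_wpDl //.
  by rewrite lerDl.
set X := _ - S in key *.
have XE : `|X| = (complex.Re `|X|)%:C%C by rewrite normc_def.
rewrite XE lecR; apply/ler_addgt0Pr => e e0; rewrite -lecR -XE; exact: key.
Qed.

End ComplexExp.

(** * The Laurent expansion of the kernel *)

Section Kernel.
Variable R : realType.
Local Notation C := R[i].
Implicit Types (a : R) (z w : C) (n D : nat).
Local Notation twopii := (2 * pi%:C%C * 'i%C : C).

Lemma exp_quotM z : z * exp_quot z = cexp z - 1.
Proof.
rewrite /exp_quot; case: eqP => [->|/eqP z0]; first by rewrite cexp0 subrr mul0r.
by rewrite mulrCA divff ?mulr1.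
Qed.

Definition phi_minus a z : C := cexp (- (a%:C%C / z)).

Lemma phi_minus_neq0 a z : phi_minus a z != 0. Proof. exact: cexp_neq0. Qed.

(* The three terms come from [1 - (w/z)^n], from the factor [e^(a z)] and from the
   factor [e^(- a / z)] of the symbol, each divided by [z - w]. *)
Definition conj_kernel a n z w : C :=
  - (\sum_(j < n) z ^+ j / z ^+ n * w ^+ (n - j.+1)
     + a%:C%C * exp_quot (a%:C%C * (z - w))
     + (w / z) ^+ n / (z * w) * (a%:C%C * exp_quot (a%:C%C * (z^-1 - w^-1)))) / twopii.

Lemma twopii_neq0 : twopii != 0.
Proof.
have h2 : (2 : C) != 0 by rewrite pnatr_eq0.
have hp : (pi%:C%C : C) != 0 by rewrite fmorph_eq0 gt_eqF // pi_gt0.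
have hi : ('i%C : C) != 0 by rewrite eq_complex /= oner_eq0 andbF.
by rewrite !mulf_eq0 !negb_or h2 hp hi.
Qed.

(** With [E x = e^(a x)], the conjugated numerator is [(w/z)^n em(w)/em(z) - E(z)/E(w)]. Inserting 1
    and [(w/z)^n] with both signs splits it into three differences, each divisible by [z - w]. On
    the diagonal, [exp_quot 0 = 1] gives the prescribed value. *)
Lemma contour_kernelE (lambda : R) n z w : z != 0 -> w != 0 ->
  contour_kernel lambda n%:Z z w =
  phi_minus (Num.sqrt lambda) z * conj_kernel (Num.sqrt lambda) n z w / phi_minus (Num.sqrt lambda) w.
Proof.
move=> z0 w0; rewrite /contour_kernel; set a := Num.sqrt lambda; have P0 := twopii_neq0.
case: eqP => [<-|/eqP zw].
  rewrite [RHS]mulrAC divff ?phi_minus_neq0 // mul1r /conj_kernel; congr (- _ / _).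
  rewrite !subrr mulr0 /exp_quot eqxx mulr1 divff // expr1n.
  rewrite (eq_bigr (fun=> z^-1)) => [|j _].
    by rewrite sumr_const card_ord -[z^-1 *+ n]mulr_natr -pmulrn; field.
  apply: (mulIf z0); rewrite mulVf //.
  have -> : z ^+ n = z ^+ j * z ^+ (n - j.+1) * z.
    by rewrite -exprD -exprSr; congr (z ^+ _); have := ltn_ord j; lia.
  by field; rewrite z0 !expf_neq0.
have zw0 : z - w != 0 by rewrite subr_eq0.
rewrite -exprnN -exprnP /symbol.
pose em x := phi_minus a x; pose Ep x := cexp (a%:C%C * x).
have symE x : cexp (a%:C%C * (x - x^-1)) = Ep x * em x.
  by rewrite /Ep /em /phi_minus -cexpD mulrBr.
rewrite !symE.
have e1 : (\sum_(j < n) z ^+ j / z ^+ n * w ^+ (n - j.+1)) * (z - w) = 1 - w ^+ n / z ^+ n.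
  have zn : z ^+ n != 0 by rewrite expf_neq0.
  apply: (mulIf zn); rewrite mulrBl mul1r divfK // -[RHS]opprB subrXX -mulNr opprB [LHS]mulrAC mulrC.
  congr (_ * _); rewrite mulr_suml; apply: eq_bigr => j _.
  rewrite mulrAC divfK // mulrC; congr (w ^+ _ * _); lia.
have e2 : a%:C%C * exp_quot (a%:C%C * (z - w)) * (z - w) = Ep z / Ep w - 1.
  by rewrite mulrAC exp_quotM mulrBr cexpD cexpN.
have e3 : a%:C%C * exp_quot (a%:C%C * (z^-1 - w^-1)) * (z^-1 - w^-1) = em w / em z - 1.
  rewrite mulrAC exp_quotM mulrBr cexpD /em /phi_minus !cexpN invrK.
  by rewrite mulrC.
rewrite -/(em z) -/(em w) /conj_kernel.
set S1 := \sum_(j < n) _ in e1 *; set S2 := a%:C%C * exp_quot _ in e2 *.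
set S3 := a%:C%C * exp_quot _ in e3 *.
have ez : em z != 0 := phi_minus_neq0 _ _.
have ew : em w != 0 := phi_minus_neq0 _ _.
have Ez : Ep z != 0 := cexp_neq0 _.
have Ew : Ep w != 0 := cexp_neq0 _.
have e4 : (w / z) ^+ n / (z * w) * S3 * (z - w) = - (w ^+ n / z ^+ n) * (em w / em z - 1).
  rewrite -e3 expr_div_n; have -> : z^-1 - w^-1 = - (z - w) / (z * w) by field; rewrite z0 w0.
  by field; rewrite z0 w0 expf_neq0.
have zn : z ^+ n != 0 by rewrite expf_neq0.
have key : - (S1 + S2 + (w / z) ^+ n / (z * w) * S3) * (z - w) = w ^+ n / z ^+ n * (em w / em z) - Ep z / Ep w.
  by rewrite mulNr !mulrDl e1 e2 e4; ring.
have -> : em z * (- (S1 + S2 + (w / z) ^+ n / (z * w) * S3) / twopii) / em w =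
  em z / em w * (- (S1 + S2 + (w / z) ^+ n / (z * w) * S3) * (z - w)) / (twopii * (z - w)).
  move: (- _) twopii P0 => X P P0; field; by rewrite ew zw0 P0.
rewrite key; congr (_ / _).
by field; rewrite ew ez Ew zn.
Qed.

(* Indexed by the exponents of [fourier_exp]: [-n, ..., -1], then [0, ..., D - 1], then
   [- n - 1, ..., - n - D]. *)
Definition fourier_mx a n D : 'M[R]_(n + (D + D)) :=
  block_mx (- 1%:M) 0
    (col_mx (\matrix_(r, j) - frob a r (n - j.+1)) (\matrix_(i, j) - frob a i j))
    (block_mx 0 (- \matrix_(r, i) frob a r (n + i)) (- \matrix_(r, i) frob a r (n + i)) 0).

Definition fourier_exp n D : 'rV[int]_(n + (D + D)) :=
  row_mx (\row_j (j%:Z - n%:Z)) (row_mx (\row_r (r : nat)%:Z) (\row_i (- (n + i.+1)%:Z))).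

Lemma fourier_expl n D (j : 'I_n) : fourier_exp n D ord0 (lshift _ j) = j%:Z - n%:Z.
Proof. by rewrite /fourier_exp row_mxEl mxE. Qed.
Lemma fourier_expa n D (r : 'I_D) : fourier_exp n D ord0 (rshift n (lshift D r)) = (r : nat)%:Z.
Proof. by rewrite /fourier_exp row_mxEr row_mxEl mxE. Qed.
Lemma fourier_expc n D (i : 'I_D) : fourier_exp n D ord0 (rshift n (rshift D i)) = - (n + i.+1)%:Z.
Proof. by rewrite /fourier_exp row_mxEr row_mxEr mxE. Qed.
Definition fourier_expE := (fourier_expl, fourier_expa, fourier_expc).

Lemma fourier_exp_inj n D : injective (fourier_exp n D ord0).
Proof.
move=> b b'.
case: (split_ordP b) => j ->; case: (split_ordP b') => j' ->.
- rewrite !fourier_expE => e; congr lshift; apply: val_inj; move: e => /=; lia.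
- case: (split_ordP j') => i ->; rewrite !fourier_expE; have := ltn_ord j; lia.
- case: (split_ordP j) => i ->; rewrite !fourier_expE; have := ltn_ord j'; lia.
- case: (split_ordP j) => i ->; case: (split_ordP j') => i' ->; rewrite !fourier_expE => e; try lia.
  + by congr (rshift _ (lshift _ _)); apply: val_inj; move: e => /=; lia.
  + by congr (rshift _ (rshift _ _)); apply: val_inj; move: e => /=; lia.
Qed.

(** The exponent [- e b' - 1] makes the second monomial dual to [w ^ e b'] under contour
    integration: for injective [e], composing such kernels is multiplying the matrices [kap]. *)
Definition laurent_kernel W (kap : 'M[R]_W) (e : 'I_W -> int) z w : C :=
  (\sum_b \sum_b' (kap b b')%:C%C * z ^ e b * w ^ (- e b' - 1)) / twopii.

(** The powers with [c < n] fall into the columns of exponents [-n, ..., -1], in reverse order for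
    the first double sum; the following [D] fall into the opposite block. This is why [c] runs up to
    [n + D]. *)
Lemma laurent_fourierE a n D z w : z != 0 -> w != 0 ->
  laurent_kernel (fourier_mx a n D) (fourier_exp n D ord0) z w =
  - (\sum_(j < n) z ^+ j / z ^+ n * w ^+ (n - j.+1)
     + \sum_(r < D) \sum_(c < n + D) (frob a r c)%:C%C * z ^+ r * w ^+ c
     + (w / z) ^+ n / (z * w) *
       \sum_(r < D) \sum_(c < n + D) (frob a r c)%:C%C * z^-1 ^+ r * w^-1 ^+ c) / twopii.
Proof.
move=> z0 w0; rewrite /laurent_kernel; congr (_ / _).
have wE (j : 'I_n) : w ^ (- (j%:Z - n%:Z) - 1) = w ^+ (n - j.+1).
  by rewrite exprnP; congr (w ^ _); have := ltn_ord j; lia.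
rewrite big_split_ord /= [X in _ + X]big_split_ord /= !opprD -addrA; congr (_ + _); last congr (_ + _).
- rewrite -sumrN; apply: eq_bigr => j _.
  rewrite big_split_ord /= [X in _ + X]big1 ?addr0; last first.
    by move=> b _; rewrite /fourier_mx block_mxEur mxE rmorph0 !mul0r.
  rewrite (bigD1 j) //= big1 ?addr0 => [|j' jj]; last first.
    by rewrite /fourier_mx block_mxEul !mxE eq_sym (negbTE jj) oppr0 !mul0r.
  rewrite !fourier_expE wE /fourier_mx block_mxEul !mxE eqxx rmorphN1 mulN1r mulNr.
  by rewrite expfzDr // -exprnN.
- rewrite -sumrN; apply: eq_bigr => r _.
  rewrite big_split_ord /= [in RHS]big_split_ord /= opprD; congr (_ + _).
    rewrite -sumrN [RHS](reindex_inj rev_ord_inj) /=; apply: eq_bigr => j _.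
    rewrite !fourier_expE wE /fourier_mx block_mxEdl col_mxEu mxE.
    by rewrite rmorphN !mulNr.
  rewrite big_split_ord /= big1 ?add0r => [|r' _]; last first.
    by rewrite /fourier_mx block_mxEdr block_mxEul mxE rmorph0 !mul0r.
  rewrite -sumrN; apply: eq_bigr => i _.
  rewrite !fourier_expE /fourier_mx block_mxEdr block_mxEur !mxE.
  by rewrite rmorphN !mulNr opprK -exprnP [w ^+ _]exprnP; congr (- (_ * w ^ _)); lia.
rewrite -mulrN -sumrN mulr_sumr; apply: eq_bigr => i _.
have cE (c : nat) : (w / z) ^+ n / (z * w) * - ((frob a i c)%:C%C * z^-1 ^+ i * w^-1 ^+ c) =
  - (frob a i c)%:C%C * z ^ (- (n + i.+1)%:Z) * w ^ (n%:Z - c%:Z - 1).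
  rewrite -exprnN addnS exprSr exprD expfzDr // expfzDr // -[w ^ (- c%:Z)]exprnN expr_div_n !exprVn.
  rewrite -[w ^ (-1)]/(w^-1) -exprnP.
  have zn : z ^+ n != 0 by rewrite expf_neq0.
  have zi : z ^+ i != 0 by rewrite expf_neq0.
  have wc : w ^+ c != 0 by rewrite expf_neq0.
  by field; rewrite z0 w0 zn zi wc.
rewrite -sumrN mulr_sumr (eq_bigr _ (fun (c : 'I_(n + D)) _ => cE c)).
rewrite big_split_ord /= [in RHS]big_split_ord /=; congr (_ + _).
  apply: eq_bigr => j _.
  rewrite !fourier_expE /fourier_mx block_mxEdl col_mxEd mxE.
  by rewrite rmorphN; congr (_ * _ * w ^ _); lia.
rewrite big_split_ord /= [X in _ + X]big1 ?addr0 => [|r' _]; last first.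
  by rewrite /fourier_mx block_mxEdr block_mxEdr mxE rmorph0 !mul0r.
apply: eq_bigr => r _.
rewrite !fourier_expE /fourier_mx block_mxEdr block_mxEdl !mxE.
by rewrite rmorphN; congr (_ * _ * w ^ _); lia.
Qed.

Lemma norm_twopii : `|twopii| = (2 * pi)%:C%C.
Proof.
rewrite !normrM normr_nat (_ : `|'i%C : C| = 1); last by rewrite normc_def /= expr0n /= add0r expr1n sqrtr1.
by rewrite mulr1 norm_real_complex ?pi_ge0 // rmorphM /= rmorph_nat.
Qed.

Lemma norm_div_twopii z (e : R) : `|z| <= e%:C%C -> `|z / twopii| <= e%:C%C.
Proof.
move=> h; rewrite normrM normfV norm_twopii ler_pdivrMr; last by rewrite -[0]/(0%:C%C) ltcR two_pi_gt0.
have e0 : 0 <= e by rewrite -ler0c; apply: le_trans h.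
apply: le_trans h _; rewrite -rmorphM lecR /=.
by rewrite ler_peMr //; have := pi_ge2 R; lra.
Qed.

Lemma conj_kernel_approx a n D z w : 0 <= a -> `|z| = 1 -> `|w| = 1 ->
  `|conj_kernel a n z w - laurent_kernel (fourier_mx a n D) (fourier_exp n D ord0) z w|
  <= (2 ^- D * (2 * a * expR (2 * a) ^+ 2))%:C%C.
Proof.
move=> a0 nz nw.
have z0 : z != 0 by rewrite -normr_eq0 nz oner_eq0.
have w0 : w != 0 by rewrite -normr_eq0 nw oner_eq0.
rewrite laurent_fourierE // /conj_kernel -mulrBl; apply: norm_div_twopii.
have h1 := exp_quot_rect a0 nz nw (leq_addl n D).
have nzV : `|z^-1| = 1 by rewrite normfV nz invr1.
have nwV : `|w^-1| = 1 by rewrite normfV nw invr1.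
have h2 := exp_quot_rect a0 nzV nwV (leq_addl n D).
move: (\sum_(j < n) _) (a%:C%C * _) (a%:C%C * _) (\sum_(r < D) _) (\sum_(r < D) _) h1 h2 => S1 A3 A2 B3 B2 h1 h2.
have -> : - (S1 + A2 + (w / z) ^+ n / (z * w) * A3) - - (S1 + B2 + (w / z) ^+ n / (z * w) * B3) =
  (B2 - A2) + (w / z) ^+ n / (z * w) * (B3 - A3) by ring.
apply: le_trans (ler_normD _ _) _.
have nn : `|(w / z) ^+ n / (z * w)| = 1.
  by rewrite normrM normfV normrX !normrM nzV nz nw !mulr1 expr1n invr1 mulr1.
rewrite normrM nn mul1r.
rewrite (_ : 2 ^- D * _ = 2 ^- D * (a * expR (2 * a) ^+ 2) + 2 ^- D * (a * expR (2 * a) ^+ 2)); last by ring.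
by rewrite rmorphD lerD // distrC.
Qed.

Lemma laurent_kernel_bound W (kap : 'M[R]_W) (e : 'I_W -> int) z w (S : R) : `|z| = 1 -> `|w| = 1 ->
  \sum_b \sum_b' `|kap b b'| <= S -> `|laurent_kernel kap e z w| <= S%:C%C.
Proof.
move=> nz nw hS; apply: norm_div_twopii; apply: (@le_trans _ _ (\sum_b \sum_b' `|kap b b'|)%:C%C); last by rewrite lecR.
apply: le_trans (ler_norm_sum _ _ _) _; rewrite rmorph_sum /=; apply: ler_sum => b _.
apply: le_trans (ler_norm_sum _ _ _) _; rewrite rmorph_sum /=; apply: ler_sum => b' _.
have nX (v : C) (m : int) : `|v| = 1 -> `|v ^ m| = 1.
  by move=> nv; case: m => k; rewrite ?NegzE -?exprnN -?exprnP ?normfV normrX nv expr1n ?invr1.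
by rewrite !normrM !nX // !mulr1 normc_def /= expr0n addr0 sqrtr_sqr.
Qed.

Lemma sum_norm_frob a N N' : 0 <= a -> \sum_(r < N) \sum_(c < N') `|frob a r c| <= a * expR a ^+ 2.
Proof.
move=> a0; apply: (@le_trans _ _ (\sum_(r < N) \sum_(c < N') a * (ec a r * ec a c))).
  by apply: ler_sum => r _; apply: ler_sum => c _; apply: frob_bound.
rewrite (_ : \sum_(r < N) _ = a * ((\sum_(r < N) ec a r) * (\sum_(c < N') ec a c))); last first.
  rewrite big_distrlr /= mulr_sumr; apply: eq_bigr => r _.
  by rewrite mulr_sumr.
apply: ler_wpM2l => //; rewrite expr2.
by apply: ler_pM; rewrite ?sum_ec_le // sumr_ge0 // => i _; rewrite ec_ge0.
Qed.

Lemma sum_norm_fourier_mx a n D : 0 <= a ->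
  \sum_b \sum_b' `|fourier_mx a n D b b'| <= n%:R + 2 * (a * expR a ^+ 2).
Proof.
move=> a0; rewrite big_split_ord /= [X in _ + X]big_split_ord /=.
rewrite mulr2n mulrDl mul1r; apply: lerD; last apply: lerD.
- rewrite (eq_bigr (fun=> 1)) ?sumr_const ?card_ord // => j _.
  rewrite big_split_ord /= [X in _ + X]big1 ?addr0; last first.
    by move=> b _; rewrite /fourier_mx block_mxEur mxE normr0.
  rewrite (bigD1 j) //= big1 ?addr0 => [|j' jj]; last first.
    by rewrite /fourier_mx block_mxEul !mxE eq_sym (negbTE jj) oppr0 normr0.
  by rewrite /fourier_mx block_mxEul !mxE eqxx normrN1.
- apply: le_trans (sum_norm_frob D (n + D) a0); apply: ler_sum => r _.
  rewrite !big_split_ord /=; apply: lerD.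
    rewrite le_eqVlt; apply/orP; left; apply/eqP.
    rewrite [RHS](reindex_inj rev_ord_inj) /=; apply: eq_bigr => j _.
    by rewrite /fourier_mx block_mxEdl col_mxEu mxE normrN.
  rewrite big1 ?add0r => [|r' _]; last by rewrite /fourier_mx block_mxEdr block_mxEul mxE normr0.
  by apply: ler_sum => i _; rewrite /fourier_mx block_mxEdr block_mxEur !mxE normrN.
- apply: le_trans (sum_norm_frob D (n + D) a0); apply: ler_sum => r _.
  rewrite !big_split_ord /=; apply: lerD.
    by apply: ler_sum => j _; rewrite /fourier_mx block_mxEdl col_mxEd mxE normrN.
  rewrite [X in _ + X]big1 ?addr0 => [|r' _]; last by rewrite /fourier_mx block_mxEdr block_mxEdr mxE normr0.
  by apply: ler_sum => i _; rewrite /fourier_mx block_mxEdr block_mxEdl !mxE normrN.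
Qed.

End Kernel.

(** * The Fredholm series as a limit of finite determinants *)

Section MinorSum.
Variable R : realType.
Local Notation C := R[i].
Local Notation twopii := (2 * pi%:C%C * 'i%C : C).
Implicit Types (W k : nat).

(** This is [k!] times the sum of the principal minors of size [k], the finite counterpart of the
    k-fold integral in the Fredholm series. *)
Definition minor_sum W (kap : 'M[R]_W) k : R :=
  \sum_(f : {ffun 'I_k -> 'I_W}) \det (\matrix_(i, j) kap (f i) (f j)).

(** For injective [f] the row sums of the minor are at most the full row sums of [kap], and summing
    their product over all maps gives a k-th power. The bound does not involve [W], so it serves for
    all truncations at once. *)
Lemma minor_sum_bound W (kap : 'M[R]_W) k (S : R) : \sum_b \sum_b' `|kap b b'| <= S ->
  `|minor_sum kap k| <= S ^+ k.
Proof.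
move=> hS; pose rho b := \sum_b' `|kap b b'|.
have rho0 b : 0 <= rho b by apply: sumr_ge0.
apply: le_trans (ler_norm_sum _ _ _) _.
apply: (@le_trans _ _ (\sum_(f : {ffun 'I_k -> 'I_W}) \prod_i rho (f i))).
  apply: ler_sum => f _; case: (boolP (injectiveb f)) => [/injectiveP fI|/injectivePn[x [y xy e]]]; last first.
    rewrite (determinant_alternate xy) ?normr0; first by apply: prodr_ge0.
    by move=> j; rewrite !mxE e.
  apply: le_trans (det_row_bound _) _; apply: ler_prod => i _; rewrite sumr_ge0 //=.
  under eq_bigr => j _ do rewrite mxE.
  rewrite -(big_imset (h := f) (A := predT) (fun b => `|kap (f i) b|)) /=; last by move=> x y _ _; apply: fI.
  by rewrite big_mkcond /=; apply: ler_sum => b _; case: ifP.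
rewrite -(bigA_distr_bigA (fun _ b => rho b)) /= prodr_const card_ord.
have h0 : 0 <= \sum_b rho b by apply: sumr_ge0.
by apply: lerXn2r; rewrite ?nnegrE // (le_trans h0).
Qed.

Lemma minor_sum0 W (kap : 'M[R]_W) k : (W < k)%N -> minor_sum kap k = 0.
Proof.
move=> Wk; apply: big1 => f _; case: (boolP (injectiveb f)) => [/injectiveP fI|/injectivePn[x [y xy e]]].
  by have := leq_card f fI; rewrite !card_ord leqNgt Wk.
by apply: (determinant_alternate xy) => j; rewrite !mxE e.
Qed.

Lemma det_minor_sum W (kap : 'M[R]_W) (s : R) K : (W < K)%N ->
  \det (1%:M - s *: kap) = \sum_(k < K) (- s) ^+ k / k`!%:R * minor_sum kap k.
Proof.
move=> WK; rewrite -scaleNr von_koch (big_ord_widen _ (fun k => (k`!%:R)^-1 *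
  \sum_(f : {ffun 'I_k -> 'I_W}) \det (\matrix_(i, j) (- s *: kap) (f i) (f j))) WK) big_mkcond /=.
apply: eq_bigr => k _; case: ifP => [_|/negbT]; last first.
  by rewrite -leqNgt => h; rewrite minor_sum0 ?mulr0.
rewrite [_ / _]mulrC -mulrA; congr (_ * _); rewrite mulr_sumr; apply: eq_bigr => f _.
by rewrite -detZ; congr (\det _); apply/matrixP => i j; rewrite !mxE.
Qed.

Lemma monomial_map k (F : 'I_k -> int) (s : seq C) : size s = k ->
  monomial [seq F i | i <- enum 'I_k] s = \prod_(i < k) s`_i ^ F i.
Proof.
move=> sk; have {1}-> : s = [seq s`_i | i : 'I_k <- enum 'I_k].
  apply: (@eq_from_nth _ 0); first by rewrite size_map size_enum_ord.
  move=> j; rewrite sk => jk; rewrite (nth_map (Ordinal jk)) ?size_enum_ord //.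
  by rewrite nth_enum_ord.
by rewrite /monomial zip_map big_map big_enum.
Qed.

(** One monomial per permutation and choice of matrix entries. The variable [i] occurs in row [i]
    and, as column variable, in the row that the permutation sends to [i]. *)
Definition det_terms W (kap : 'M[R]_W) (e : 'I_W -> int) k : seq (C * seq int) :=
  [seq (((-1) ^+ x.1 * \prod_i kap (x.2 i).1 (x.2 i).2)%:C%C / twopii ^+ k,
        [seq e (x.2 i).1 - e (x.2 (x.1^-1%g i)).2 - 1 | i <- enum 'I_k])
  | x : {perm 'I_k} * {ffun 'I_k -> 'I_W * 'I_W} <- enum {: {perm 'I_k} * {ffun 'I_k -> 'I_W * 'I_W}}].

Lemma det_terms_arity W (kap : 'M[R]_W) e k : lpoly_arity k (det_terms kap e k).
Proof. by apply/allP => _ /mapP[x _ ->] /=; rewrite size_map size_enum_ord. Qed.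

Lemma det_laurentE W (kap : 'M[R]_W) e k (s : seq C) : size s = k -> (forall w, w \in s -> w != 0) ->
  \det (\matrix_(i < k, j < k) laurent_kernel kap e s`_i s`_j) = lpoly (det_terms kap e k) s.
Proof.
move=> sk s0; rewrite /lpoly big_map big_enum /=.
have nz (i : 'I_k) : s`_i != 0 by apply: s0; rewrite mem_nth // sk.
rewrite -(pair_big xpredT xpredT (fun (x1 : {perm 'I_k}) (x2 : {ffun 'I_k -> 'I_W * 'I_W}) =>
  ((-1) ^+ x1 * \prod_i kap (x2 i).1 (x2 i).2)%:C%C / twopii ^+ k *
  monomial [seq e (x2 i).1 - e (x2 (x1^-1%g i)).2 - 1 | i <- enum 'I_k] s)) /=.
rewrite /determinant; apply: eq_bigr => sg _.
transitivity ((-1) ^+ sg * \sum_(h : {ffun 'I_k -> 'I_W * 'I_W}) \prod_i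
   ((kap (h i).1 (h i).2)%:C%C * s`_i ^ e (h i).1 * s`_(sg i) ^ (- e (h i).2 - 1) / twopii)).
  congr (_ * _); rewrite -(bigA_distr_bigA (fun (i : 'I_k) p => (kap p.1 p.2)%:C%C * s`_i ^ e p.1 * s`_(sg i) ^ (- e p.2 - 1) / twopii)) /=.
  apply: eq_bigr => i _; rewrite mxE /laurent_kernel mulr_suml.
  rewrite -(pair_big xpredT xpredT (fun b b' => (kap b b')%:C%C * s`_i ^ e b * s`_(sg i) ^ (- e b' - 1) / twopii)) /=.
  by apply: eq_bigr => b _; rewrite mulr_suml.
rewrite mulr_sumr; apply: eq_bigr => h _; rewrite monomial_map //.
rewrite !big_split /= prodr_const card_ord exprVn.
have -> : \prod_(i < k) s`_i ^ (e (h i).1 - e (h (sg^-1%g i)).2 - 1) =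
  (\prod_(i < k) s`_i ^ e (h i).1) * \prod_(i < k) s`_(sg i) ^ (- e (h i).2 - 1).
  rewrite [X in _ * X](reindex_inj (@perm_inj _ sg^-1%g)) -big_split /=; apply: eq_bigr => i _.
  by rewrite permKV -expfzDr // addrA.
rewrite rmorphM rmorphXn rmorphN1 rmorph_prod /=.
have aux (x p q r v : C) : x * (p * q * r * v) = x * p * v * (q * r) by ring.
exact: aux.
Qed.

(** All exponents are -1 exactly when the column index chosen in row [i] is the row index chosen in
    row [sg i], by injectivity of [e]. The choice is then [(f i, f (sg i))], and a Leibniz term of a
    minor of [kap] remains. *)
Lemma det_terms_oint W (kap : 'M[R]_W) e k : injective e ->
  lpoly_oint k (det_terms kap e k) = (minor_sum kap k)%:C%C.
Proof.
move=> eI; rewrite /lpoly_oint big_map big_enum /=.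
have all1 (sg : {perm 'I_k}) (h : {ffun 'I_k -> 'I_W * 'I_W}) :
   all (pred1 (-1)) [seq e (h i).1 - e (h (sg^-1%g i)).2 - 1 | i <- enum 'I_k] =
   [forall i, (h i).2 == (h (sg i)).1].
  rewrite all_map; apply/allP/forallP => [H i|H i _] /=.
    have := H (sg i); rewrite mem_enum /= permK => /(_ isT).
    by rewrite -subr_eq0 opprK subrK subr_eq0 (inj_eq eI) eq_sym.
  have /eqP := H (sg^-1%g i); rewrite permKV => ->.
  by rewrite subrr sub0r.
rewrite -(pair_big xpredT xpredT (fun (x1 : {perm 'I_k}) (x2 : {ffun 'I_k -> 'I_W * 'I_W}) =>
  if all (pred1 (-1)) [seq e (x2 i).1 - e (x2 (x1^-1%g i)).2 - 1 | i <- enum 'I_k]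
  then ((-1) ^+ x1 * \prod_i kap (x2 i).1 (x2 i).2)%:C%C / twopii ^+ k * twopii ^+ k else 0)) /=.
rewrite /minor_sum rmorph_sum /= /determinant.
under [RHS]eq_bigr do rewrite rmorph_sum /=.
rewrite [RHS]exchange_big /=; apply: eq_bigr => sg _.
under eq_bigr => h _ do rewrite all1 divfK ?expf_neq0 ?twopii_neq0 //.
rewrite -big_mkcond /=.
rewrite (reindex_onto (fun f : {ffun 'I_k -> 'I_W} => [ffun i => (f i, f (sg i))] : {ffun 'I_k -> 'I_W * 'I_W})
   (fun h => [ffun i => (h i).1])) /=; last first.
  move=> h /forallP H; apply/ffunP => i; rewrite !ffunE -(eqP (H i)).
  by case: (h i).
apply: eq_big => [f|f _].
  apply/andP; split; first by apply/forallP => i; rewrite !ffunE.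
  by apply/eqP/ffunP => i; rewrite !ffunE.
by congr (_%:C%C); congr (_ * _); apply: eq_bigr => i _; rewrite !mxE !ffunE.
Qed.

End MinorSum.

(** * Fredholm series of a kernel conjugate to a limit of Laurent kernels *)

Section FredholmLimit.
Variable R : realType.
Local Notation C := R[i].
Variables (Ker : C -> C -> C) (em : C -> C) (Kt : C -> C -> C).
Variables (W : nat -> nat) (kap : forall D, 'M[R]_(W D)) (e : forall D, 'I_(W D) -> int).
Variables (S K0 : R).
Hypothesis em0 : forall z, em z != 0.
Hypothesis KerE : forall z w, z != 0 -> w != 0 -> Ker z w = em z * Kt z w / em w.
Hypothesis eI : forall D, injective (e (D := D)).
Hypothesis KtE : forall D z w, `|z| = 1 -> `|w| = 1 ->
  `|Kt z w - laurent_kernel (kap D) (e (D := D)) z w| <= (2 ^- D * K0)%:C%C.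
Hypothesis kapS : forall D, \sum_b \sum_b' `|kap D b b'| <= S.
Hypothesis K00 : 0 <= K0.

Let S0 : 0 <= S. Proof. by apply: le_trans (kapS 0); apply: sumr_ge0 => b _; apply: sumr_ge0. Qed.

Let two_pow_le1 D : 2 ^- D <= 1 :> R.
Proof. by rewrite invf_le1 ?exprn_gt0 // exprn_ege1 // ler1n. Qed.

Definition trace_form k : C := iter_oint k (fun z => \det (\matrix_(i < k, j < k) Ker z`_i z`_j)).

Lemma det_conj k (s : seq C) : size s = k -> (forall w, w \in s -> w != 0) ->
  \det (\matrix_(i < k, j < k) Ker s`_i s`_j) = \det (\matrix_(i < k, j < k) Kt s`_i s`_j).
Proof.
move=> sk s0.
have nz (i : 'I_k) : s`_i != 0 by apply: s0; rewrite mem_nth // sk.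
have -> : \matrix_(i < k, j < k) Ker s`_i s`_j =
  \matrix_(i, j) (em s`_i * (\matrix_(i < k, j < k) Kt s`_i s`_j) i j * (em s`_j)^-1).
  by apply/matrixP => i j; rewrite !mxE KerE.
rewrite det_scale prodfV mulrAC divff ?mul1r //.
by apply/prodf_neq0 => i _; apply: em0.
Qed.

Definition det_err k : R := k%:R * (k%:R * K0 * (1 + k%:R * (S + K0)) ^+ k).

Lemma det_approx k D (s : seq C) : size s = k -> circle_seq s ->
  `|\det (\matrix_(i < k, j < k) Ker s`_i s`_j) - lpoly (det_terms (kap D) (e (D := D)) k) s|
  <= (2 ^- D * det_err k)%:C%C.
Proof.
move=> sk hs.
have s1 (i : 'I_k) : `|s`_i| = 1.
  by have [|t ->] := hs s`_i; [rewrite mem_nth // sk | rewrite normr_circle].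
have s0 w : w \in s -> w != 0 by case/hs => t ->; apply: circle_neq0.
rewrite det_conj // -det_laurentE //.
have v0 : 0 <= 2 ^- D :> R by rewrite invr_ge0 exprn_ge0.
have SK0 : 0 <= S + K0 by rewrite addr_ge0.
(* The entries of both matrices are at most [S + K0]; the added 1 provides [1 <= b] for
   [det_sub_bound]. *)
set b : C := (1 + k%:R * (S + K0))%:C%C.
have b1 : 1 <= b by rewrite -[1]/(1%:C%C) lecR lerDl mulr_ge0.
have sumb (F : 'I_k -> C) : (forall j, `|F j| <= (S + K0)%:C%C) -> \sum_j `|F j| <= b.
  move=> hF; apply: (@le_trans _ _ (\sum_(j < k) (S + K0)%:C%C)); first exact: ler_sum.
  rewrite sumr_const card_ord -[leLHS]mulr_natl -(rmorph_nat (real_complex R)) -rmorphM lecR /=.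
  by rewrite lerDr.
have hL (i j : 'I_k) : `|laurent_kernel (kap D) (e (D := D)) s`_i s`_j| <= S%:C%C.
  exact: laurent_kernel_bound.
have hK (i j : 'I_k) := KtE D (s1 i) (s1 j).
apply: le_trans (det_sub_bound (b := b) (d := (k%:R * (2 ^- D * K0))%:C%C) b1 _ _ _) _.
- move=> i; apply: sumb => j; rewrite mxE.
  rewrite -[X in `|X|](subrK (laurent_kernel (kap D) (e (D := D)) s`_i s`_j)).
  apply: le_trans (ler_normD _ _) _; rewrite addrC rmorphD lerD //.
  by apply: le_trans (hK i j) _; rewrite lecR ler_piMl.
- by move=> i; apply: sumb => j; rewrite mxE; apply: le_trans (hL i j) _; rewrite lecR lerDl.
- move=> i; apply: (@le_trans _ _ (\sum_(j < k) (2 ^- D * K0)%:C%C)).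
    by apply: ler_sum => j _; rewrite !mxE.
  by rewrite sumr_const card_ord -[leLHS]mulr_natl -(rmorph_nat (real_complex R)) -rmorphM.
rewrite le_eqVlt; apply/orP; left; apply/eqP.
rewrite /det_err /b -(rmorph_nat (real_complex R)) -!rmorphXn -!rmorphM; congr (_%:C%C) => /=.
ring.
Qed.

Lemma det_err_ge0 k : 0 <= det_err k.
Proof. by rewrite /det_err !mulr_ge0 // exprn_ge0 // addr_ge0 // mulr_ge0 // addr_ge0. Qed.

Lemma trace_form_approx k D :
  `|trace_form k - (minor_sum (kap D) k)%:C%C| <= (2 ^- D * ((8 * pi) ^+ k * det_err k))%:C%C.
Proof.
rewrite -(det_terms_oint _ _ (@eI D)) mulrCA; apply: iter_oint_approx.
- move=> d d0; have [D' hD'] := half_pow_small (det_err_ge0 k) d0.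
  exists (det_terms (kap D') (e (D := D')) k); first exact: det_terms_arity.
  move=> s sk hs; apply: le_trans (det_approx D' sk hs) _.
  by rewrite lecR; apply: hD'.
- exact: det_terms_arity.
- by move=> s sk hs; apply: det_approx.
Qed.

Definition trace_real k : R := complex.Re (trace_form k).

Lemma trace_err_ge0 k : 0 <= (8 * pi) ^+ k * det_err k :> R.
Proof. by rewrite mulr_ge0 ?det_err_ge0 // exprn_ge0 // mulr_ge0 // pi_ge0. Qed.

Lemma small_eq0 (x K : R) : 0 <= K -> (forall D, `|x| <= 2 ^- D * K) -> x = 0.
Proof.
move=> K1 h; apply/eqP; rewrite -normr_le0; apply/ler_addgt0Pr => d d0; rewrite add0r.
by have [D hD] := half_pow_small K1 d0; apply: le_trans (h D) (hD D _).
Qed.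

(** The matrices [kap] are real, so the imaginary part is smaller than every error of
    approximation. *)
Lemma trace_formE k : trace_form k = (trace_real k)%:C%C.
Proof.
apply: complexP => //=; apply: (small_eq0 (trace_err_ge0 k)) => D.
by have := normC_Im_le (trace_form_approx k D); rewrite complexImD complexImN /= subr0.
Qed.

Lemma trace_real_approx k D :
  `|trace_real k - minor_sum (kap D) k| <= 2 ^- D * ((8 * pi) ^+ k * det_err k).
Proof. by have := normC_Re_le (trace_form_approx k D); rewrite complexReD complexReN. Qed.

Lemma trace_real_bound k : `|trace_real k| <= S ^+ k.
Proof.
apply/ler_addgt0Pr => d d0; have [D hD] := half_pow_small (trace_err_ge0 k) d0.
rewrite -[X in `|X|](subrK (minor_sum (kap D) k)); apply: le_trans (ler_normD _ _) _.
rewrite addrC lerD ?minor_sum_bound //.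
by apply: le_trans (trace_real_approx k D) (hD D _).
Qed.

Definition fredholm_term (s : R) (k : nat) : R := (- s) ^+ k / k`!%:R * trace_real k.

Lemma fredholm_term_bound s k : `|fredholm_term s k| <= exp_coeff (`|s| * S) k.
Proof.
rewrite /fredholm_term !normrM normrX normrN normfV normr_nat /exp_coeff /= exprMn mulrAC.
by apply: ler_wpM2r; [rewrite invr_ge0 | apply: ler_wpM2l; [exact: exprn_ge0 | exact: trace_real_bound]].
Qed.

Lemma fredholm_series_cvg s : cvgn (series (fredholm_term s)).
Proof.
apply: normed_cvg; apply: (@series_le_cvg _ _ (exp_coeff (`|s| * S))).
- by move=> k /=.
- by move=> k; apply: exp_coeff_ge0; rewrite mulr_ge0.
- by move=> k; apply: fredholm_term_bound.
- exact: is_cvg_series_exp_coeff.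
Qed.

Lemma fredholm_detE (s : R) :
  fredholm_det Ker s%:C%C = (limn (series (fredholm_term s)))%:C%C.
Proof.
rewrite /fredholm_det.
have -> : (fun k : nat => (- s%:C%C) ^+ k / k`!%:R * iter_oint k (fun z => \det (\matrix_(i < k, j < k) Ker z`_i z`_j)))
  = (fun k => (fredholm_term s k)%:C%C).
  apply/funext => k; rewrite -/(trace_form k) trace_formE /fredholm_term.
  by rewrite rmorphM fmorph_div rmorphXn rmorphN /= rmorph_nat.
have -> : series (fun k => (fredholm_term s k)%:C%C) = (fun k => (series (fredholm_term s) k)%:C%C).
  by apply/funext => k; rewrite /series /= rmorph_sum.
by rewrite /climn /= lim_cst.
Qed.

(** Dominated convergence by hand: the tails of both series are below that of [expR (|s| * S)]
    uniformly in [D], and the finitely many terms before [N0] converge one by one. *)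
Lemma fredholm_limit (s : R) :
  (\det (1%:M - s *: kap D) @[D --> \oo] --> limn (series (fredholm_term s)))%classic.
Proof.
set F := limn _; have hF : (series (fredholm_term s) k @[k --> \oo] --> F)%classic := @fredholm_series_cvg s.
pose B := `|s| * S; have B0 : 0 <= B by rewrite mulr_ge0.
have hE : (series (exp_coeff B) k @[k --> \oo] --> expR B)%classic := is_cvg_series_exp_coeff B.
apply/cvgrPdist_le => d d0; have d4 : 0 < d / 4 by rewrite divr_gt0.
have [N0 _ hN0] : (\forall k \near \oo, `|expR B - series (exp_coeff B) k| <= d / 4)%classic.
  by move/cvgrPdist_le : hE; apply.
pose Q : R := \sum_(k < N0) `|s| ^+ k / k`!%:R * ((8 * pi) ^+ k * det_err k).
have Q0 : 0 <= Q by apply: sumr_ge0 => k _; rewrite mulr_ge0 ?trace_err_ge0 // divr_ge0 // exprn_ge0.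
have [D0 hD0] := half_pow_small Q0 d4.
exists D0 => // D hD.
have tail (K : nat) : (N0 <= K)%N -> \sum_(N0 <= k < K) exp_coeff B k <= d / 4.
  move=> hK; have := hN0 N0 (leqnn N0).
  have le : series (exp_coeff B) K <= expR B.
    have := nondecreasing_cvgn_le _ (is_cvg_series_exp_coeff B) K; apply.
    by apply: nondecreasing_series => j _ _; apply: exp_coeff_ge0.
  have : series (exp_coeff B) K = series (exp_coeff B) N0 + \sum_(N0 <= k < K) exp_coeff B k.
    by rewrite /series /= -big_cat_nat.
  move=> e1 h1; have := le_trans (ler_norm _) h1; lra.
have part (K : nat) : (N0 <= K)%N -> (W D < K)%N -> `|series (fredholm_term s) K - \det (1%:M - s *: kap D)| <= 3 * (d / 4).
  move=> hK WK; rewrite (det_minor_sum _ _ WK) /series /= big_mkord -sumrB.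
  apply: le_trans (ler_norm_sum _ _ _) _.
  rewrite -(big_mkord xpredT (fun k => `|fredholm_term s k - (- s) ^+ k / k`!%:R * minor_sum (kap D) k|)).
  rewrite (big_cat_nat (n := N0)) //= big_mkord.
  have h1 : \sum_(k < N0) `|fredholm_term s k - (- s) ^+ k / k`!%:R * minor_sum (kap D) k| <= d / 4.
    apply: le_trans (hD0 D hD); rewrite mulr_sumr; apply: ler_sum => k _.
    rewrite /fredholm_term -mulrBr !normrM normrX normrN normfV normr_nat [leRHS]mulrCA.
    apply: ler_wpM2l; first by rewrite divr_ge0 // exprn_ge0.
    exact: trace_real_approx.
  have h2 : \sum_(N0 <= k < K) `|fredholm_term s k - (- s) ^+ k / k`!%:R * minor_sum (kap D) k| <= d / 4 + d / 4.
    apply: le_trans (lerD (tail _ hK) (tail _ hK)); rewrite -big_split /=; apply: ler_sum => k _.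
    apply: le_trans (ler_normB _ _) _; apply: lerD; first exact: fredholm_term_bound.
    rewrite !normrM normrX normrN normfV normr_nat /exp_coeff /= exprMn [leRHS]mulrAC.
    by apply: ler_wpM2l; [rewrite divr_ge0 // exprn_ge0 | exact: minor_sum_bound].
  by apply: le_trans (lerD h1 h2) _; lra.
have [N1 _ hN1] : (\forall k \near \oo, `|F - series (fredholm_term s) k| <= d / 4)%classic.
  by move/cvgrPdist_le : hF; apply.
(* Beyond [W D] the minors vanish, so a partial sum up to [K] contains the whole finite
   determinant. *)
pose K := maxn N1 (maxn N0 (W D).+1).
have k1 : (N1 <= K)%N by rewrite leq_maxl.
have k2 : (N0 <= K)%N by rewrite /K !leq_max leqnn orbT.
have k3 : (W D < K)%N by rewrite /K !leq_max ltnSn !orbT.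
rewrite -[X in `|X|](subrKA (series (fredholm_term s) K)).
apply: le_trans (ler_normD _ _) _; apply: le_trans (lerD (hN1 _ k1) (part _ k2 k3)) _; lra.
Qed.

End FredholmLimit.

(** * The limit of large boxes *)

Lemma sum_alt_bin (F : comNzRingType) N r :
  \sum_(j < r.+1) (-1) ^+ j * 'C(N.+1, j)%:R = (-1) ^+ r * 'C(N, r)%:R :> F.
Proof.
elim: r => [|r IH]; first by rewrite big_ord_recl big_ord0 /= !bin0 addr0.
by rewrite big_ord_recr /= IH binS natrD exprS; ring.
Qed.

Lemma det_block11 (F : comNzRingType) m p (B : 'M[F]_(m, p)) (B' : 'M[F]_(p, m)) :
  \det (block_mx 1%:M B B' 1%:M) = \det (1%:M - B' *m B).
Proof.
have -> : \det (block_mx 1%:M B B' 1%:M) = \det (block_mx 1%:M 0 (- B') 1%:M *m block_mx 1%:M B B' 1%:M).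
  by rewrite det_mulmx det_lblock !det1 !mul1r.
rewrite mulmx_block !mul1mx !mul0mx !addr0 mulmx1 addNr mulNmx addrC.
by rewrite det_ublock det1 mul1r.
Qed.

Section Assembly.
Variable R : realType.
Implicit Types (a s t lambda : R) (n D M : nat).

(** The entry is a truncated alternating sum of binomial coefficients, evaluated by [sum_alt_bin].
    In this closed form the combinatorial side meets the coefficients [frob] of the kernel. *)
Lemma THE a n D (r i : 'I_D) :
  TH a n D r i = (-1) ^+ r * a ^+ (r + (n + i)).+1 / ((r + (n + i)).+1 * (r`! * (n + i)`!))%:R.
Proof.
rewrite mxE; under eq_bigr => q _ do rewrite !mxE.
rewrite (eq_bigr (fun q : 'I_D => if (q < r.+1)%N then ec (- a) (r - q) * ec a (q + i + n).+1 else 0)); last first.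
  by move=> q _; rewrite expcE ltnS; case: ifP => // _; rewrite mul0r.
rewrite -big_mkcond /= -(big_ord_widen _ (fun q => ec (- a) (r - q) * ec a (q + i + n).+1)) //.
rewrite (reindex_inj rev_ord_inj) /=.
set N := (r + (n + i))%N.
have f0 j : j`!%:R != 0 :> R by rewrite pnatr_eq0 -lt0n fact_gt0.
transitivity (\sum_(j < r.+1) a ^+ N.+1 / N.+1`!%:R * ((-1) ^+ j * 'C(N.+1, j)%:R)).
  apply: eq_bigr => j _; have jr : (j <= r)%N by rewrite -ltnS.
  rewrite subSS subKn // /ec (exprNn a).
  have jN : (j <= N.+1)%N by rewrite (leq_trans (ltnW (ltn_ord j))) // ltnS leq_addr.
  have -> : (r - j + i + n).+1 = (N.+1 - j)%N by have := ltn_ord j; rewrite /N; lia.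
  have -> : a ^+ N.+1 = a ^+ j * a ^+ (N.+1 - j) by rewrite -exprD subnKC.
  rewrite -(bin_fact jN) !natrM.
  have := f0 j; have := f0 (N.+1 - j)%N.
  have b0 : 'C(N.+1, j)%:R != 0 :> R by rewrite pnatr_eq0 -lt0n bin_gt0.
  move: (_ ^+ _) (_ ^+ _) (_ ^+ _) => s1 s2 s3 h1 h2.
  by field; rewrite b0 h1 h2.
rewrite -mulr_sumr sum_alt_bin factS.
have rN : (r <= N)%N by rewrite leq_addr.
have eN : (N - r = n + i)%N by rewrite /N addKn.
rewrite -(bin_fact rN) eN !natrM.
have := f0 r; have := f0 (n + i)%N.
have b0 : 'C(N, r)%:R != 0 :> R by rewrite pnatr_eq0 -lt0n bin_gt0.
have k0 : N.+1%:R != 0 :> R by rewrite pnatr_eq0.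
move: (_ ^+ _) (_ ^+ _) => s1 s2 h1 h2.
by field; rewrite b0 h1 h2 nat1r k0.
Qed.

Lemma frob_TH a n D (r i : 'I_D) : frob a r (n + i) = (-1) ^+ (n + r) * TH a n D r i * (-1) ^+ i.
Proof.
rewrite THE /frob !exprD; have := sqrr_sign R r; rewrite expr2 => e.
rewrite -!mulrA; set X := _ * _^-1.
rewrite [RHS](_ : _ = (-1) ^+ r * (-1) ^+ r * ((-1) ^+ n * ((-1) ^+ i * X))); last by rewrite /X; ring.
by rewrite e mul1r.
Qed.

(** The diagonal block of exponents [-n, ..., -1] gives [(1 + s) ^+ n]. The other one is
    off-diagonal with two equal blocks, so only the square of [s] survives, whence the square root
    of [t] in the theorem. The signs relating [frob] to [TH] form a diagonal conjugation and a
    global sign, lost in the square. *)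
Lemma det_fourier_mx a n D s :
  \det (1%:M - s *: fourier_mx a n D) =
  (1 + s) ^+ n * \det (1%:M - s ^+ 2 *: (TH a n D *m TH a n D)).
Proof.
pose X : 'M[R]_D := \matrix_(r, i) frob a r (n + i).
rewrite /fourier_mx -/X scale_block_mx opp_block_mx scalar_mx_block add_block_mx scaler0 oppr0 addr0.
rewrite det_lblock; congr (_ * _).
  have -> : 1%:M - s *: - 1%:M = (1 + s)%:M :> 'M[R]_n.
    by apply/matrixP => i j; rewrite !mxE; case: eqP => _ /=; ring.
  by rewrite det_scalar.
rewrite scale_block_mx opp_block_mx scalar_mx_block add_block_mx !scaler0 !oppr0 !addr0 !add0r !scalerN !opprK.
rewrite det_block11 -scalemxAl -scalemxAr scalerA -expr2.
have -> : 1%:M - s ^+ 2 *: (X *m X) =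
  \matrix_(r, i) ((-1) ^+ r * (1%:M - s ^+ 2 *: (TH a n D *m TH a n D)) r i * (-1) ^+ i).
  apply/matrixP => r i; rewrite !mxE.
  have -> : \sum_j X r j * X j i = (-1) ^+ r * (\sum_j TH a n D r j * TH a n D j i) * (-1) ^+ i.
    rewrite mulr_sumr mulr_suml; apply: eq_bigr => j _; rewrite ![X _ _]mxE !frob_TH !exprD.
    have := sqrr_sign R j; have := sqrr_sign R n; rewrite !expr2 => e1 e2.
    rewrite [LHS](_ : _ = ((-1) ^+ n * (-1) ^+ n) * ((-1) ^+ j * (-1) ^+ j) *
       ((-1) ^+ r * (TH a n D r j * TH a n D j i) * (-1) ^+ i)); last by ring.
    by rewrite e1 e2 !mul1r.
  case: eqP => [->|_]; last by rewrite /=; ring.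
  have := sqrr_sign R i; rewrite expr2 => e /=.
  rewrite mulrBr mulrBl mulr1 e; ring.
rewrite det_scale mulrAC -big_split /= big1 ?mul1r // => i _.
by rewrite -expr2 sqrr_sign.
Qed.

(** Yields the derivative of the generating function from a quadratic remainder, without
    differentiating the Fredholm determinant. *)
Lemma derivable_quad (G : R -> R) (c K : R) :
  (forall h, `|h| <= 1 -> `|G (1 + h) - G 1 - h * c| <= K * h ^+ 2) ->
  derivable G 1 1 /\ (derive1 G 1 = c).
Proof.
move=> hG.
have K0 : 0 <= K by have := hG 1; rewrite normr1 expr1n mulr1 => /(_ (lexx _)); apply: le_trans.
have key : (h^-1 *: ((G \o shift 1) (h *: (1 : R)) - G 1) @[h --> 0^'] --> c)%classic.
  apply/cvgrPdist_le => d d0.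
  have K1 : 0 < K + 1 by rewrite ltr_wpDl.
  near=> h.
  have h0 : h != 0 by near: h; exact: nbhs_dnbhs_neq.
  have hle : `|h| <= Num.min 1 (d / (K + 1)).
    near: h; apply: dnbhs0_le; rewrite lt_min ltr01 divr_gt0 //.
  move: hle; rewrite le_min => /andP[h1 h2].
  rewrite /= /GRing.scale /= mulr1 [h + 1]addrC distrC.
  have -> : h^-1 * (G (1 + h) - G 1) - c = h^-1 * (G (1 + h) - G 1 - h * c) by field.
  rewrite normrM normfV ler_pdivrMl ?normr_gt0 //.
  apply: le_trans (hG _ h1) _; rewrite -real_normK ?num_real // expr2 mulrCA mulrC [leRHS]mulrC.
  rewrite ler_wpM2r //; apply: (@le_trans _ _ ((K + 1) * `|h|)).
    by rewrite ler_wpM2r // lerDl.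
  by rewrite mulrC -ler_pdivlMr.
split; first by apply/cvg_ex; exists c.
by rewrite derive1E; apply: cvg_lim.
Unshelve. all: end_near. Qed.

(** * Passage to infinite boxes and the generating function of the theorem *)

Section Limits.
Variables (lambda : R) (n : nat).
Hypothesis lambda_gt0 : 0 < lambda.
Let a := Num.sqrt lambda.

Let a_gt0 : 0 < a. Proof. by rewrite sqrtr_gt0. Qed.
Let aE : a ^+ 2 = lambda. Proof. by rewrite sqr_sqrtr // ltW. Qed.

Lemma box_gf0 M : box_gf n lambda 0 M = box_sum (fun=> true) lambda M.
Proof.
rewrite /box_gf /box_sum; apply: eq_big => [mu|mu _]; first by rewrite andbT.
rewrite /cutoff_weight big1 ?mulr1 // => i _.
by rewrite subr0 if_same.
Qed.

Lemma box_gf_limit s (L : R) : 0 <= s ->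
  (\det (1%:M - s *: fourier_mx a n D) @[D --> \oo] --> L)%classic ->
  (box_gf n lambda (s ^+ 2) M @[M --> \oo] --> expR lambda * ((1 + s) ^- n * L))%classic.
Proof.
move=> s0 hL; set t := s ^+ 2.
have sp : (1 + s) ^+ n != 0 by rewrite expf_neq0 // gt_eqF // ltr_wpDr.
pose d M := \det (1%:M - t *: (TH a n M *m TH a n M)).
have hd : (d M @[M --> \oo] --> (1 + s) ^- n * L)%classic.
  have -> : d = (fun M => (1 + s) ^- n * \det (1%:M - s *: fourier_mx a n M)).
    by apply/funext => M; rewrite det_fourier_mx mulrA mulVf // mul1r.
  by apply: cvgM => //; exact: cvg_cst.
have h0 : (box_gf n lambda 0 M @[M --> \oo] --> expR lambda)%classic.
  under eq_fun do rewrite box_gf0.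
  rewrite -full_sumT; apply: box_sum_cvg; exact: ltW.
have hp : (box_gf n lambda 0 M * d M @[M --> \oo] --> expR lambda * ((1 + s) ^- n * L))%classic.
  exact: cvgM.
pose b := 2 * expR a ^+ 2 * (1 + `|t| * expR a ^+ 4).
pose K := 5 * `|t| * expR (256 * b * a) ^+ 6.
have K0 : 0 <= K.
  apply: mulr_ge0; first by apply: mulr_ge0; [exact: ler0n | exact: normr_ge0].
  by apply: exprn_ge0; apply: expR_ge0.
apply/cvgrPdist_le => e e0; have e2 : 0 < e / 2 by rewrite divr_gt0.
have [N1 _ h1] : (\forall M \near \oo, `|expR lambda * ((1 + s) ^- n * L) - box_gf n lambda 0 M * d M| <= e / 2)%classic.
  by move/cvgrPdist_le : hp; apply.
have [N2 h2] := half_pow_small K0 e2.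
exists (maxn n (maxn N1 N2)) => // M /=; rewrite !geq_max => /and3P[nM le1 le2].
rewrite -[X in `|X|](subrKA (box_gf n lambda 0 M * d M)).
rewrite [e]splitr; apply: le_trans (ler_normD _ _) _; apply: lerD; first exact: h1.
apply: le_trans (h2 M le2); rewrite distrC /= /d -aE !box_gf_det //.
rewrite [leRHS]mulrC; exact: (gram_det_bound nM (ltW a_gt0) (erefl b) (erefl _)).
Qed.

Definition fredholm_real s : R := limn (series (fredholm_term (contour_kernel lambda n%:Z) s)).

Lemma fredholm_realP s :
  fredholm_det (contour_kernel lambda n%:Z) s%:C%C = (fredholm_real s)%:C%C /\
  (\det (1%:M - s *: fourier_mx a n D) @[D --> \oo] --> fredholm_real s)%classic.
Proof.
have a0 := ltW a_gt0.
have h1 := phi_minus_neq0 a.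
have h2 := @contour_kernelE R lambda n.
have h3 D : injective (fourier_exp n D ord0) by exact: fourier_exp_inj.
have h4 D (z w : R[i]) (nz : `|z| = 1) (nw : `|w| = 1) := conj_kernel_approx n D a0 nz nw.
have h5 D := sum_norm_fourier_mx n D a0.
have h6 : 0 <= 2 * a * expR (2 * a) ^+ 2 by rewrite !mulr_ge0 // exprn_ge0 // expR_ge0.
split.
  exact: (fredholm_detE h1 h2 h3 h4 h5 h6).
exact: (fredholm_limit h1 h2 h3 h4 h5 h6).
Qed.

Definition row_gf t : R := (1 + Num.sqrt t) ^- n * fredholm_real (Num.sqrt t).

Lemma box_gf_row_gf t : 0 <= t ->
  (box_gf n lambda t M @[M --> \oo] --> expR lambda * row_gf t)%classic.
Proof.
move=> t0; have := box_gf_limit (sqrtr_ge0 t) (fredholm_realP (Num.sqrt t)).2.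
by rewrite sqr_sqrtr.
Qed.

(** The inequality for finite boxes passes to the limit. [|1 - t| <= 1] makes [t] nonnegative, so
    its square root squares back to [t], and division by [expR lambda] restores the Poisson
    normalization. *)
Lemma row_gf_quad t : `|1 - t| <= 1 ->
  `|row_gf t - phi 1 n lambda - (1 - t) * (phi 2 n.+1 lambda - phi 1 n lambda)| <= (1 - t) ^+ 2.
Proof.
move=> t1; have l0 := ltW lambda_gt0.
have t0 : 0 <= t by move: t1; rewrite ler_norml => /andP[_]; lra.
have h1 := @box_sum_cvg R (fun r => (r 0 <= n)%N) lambda l0.
have h2 := @box_sum_cvg R (fun r => (r 1 <= n.+1)%N) lambda l0.
have h3 := @box_sum_cvg R (fun=> true) lambda l0; rewrite full_sumT in h3.
have hG := box_gf_row_gf t0.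
rewrite !phiE //=.
set p1 := limn (full_sum (fun r => (r 0 <= n)%N) lambda) in h1 *.
set p2 := limn (full_sum (fun r => (r 1 <= n.+1)%N) lambda) in h2 *.
have e0 : 0 < expR lambda := expR_gt0 _.
have key : `|expR lambda * row_gf t - p1 - (1 - t) * (p2 - p1)| <= (1 - t) ^+ 2 * expR lambda.
  have hl : (`|box_gf n lambda t M - box_sum (fun r => (r 0 <= n)%N) lambda M
    - (1 - t) * (box_sum (fun r => (r 1 <= n.+1)%N) lambda M - box_sum (fun r => (r 0 <= n)%N) lambda M)|
     @[M --> \oo] --> `|expR lambda * row_gf t - p1 - (1 - t) * (p2 - p1)|)%classic.
    apply: cvg_norm; apply: cvgB; first exact: cvgB.
    by apply: cvgM; [exact: cvg_cst | exact: cvgB].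
  have hr : ((1 - t) ^+ 2 * box_sum (fun=> true) lambda M @[M --> \oo] --> (1 - t) ^+ 2 * expR lambda)%classic.
    by apply: cvgM => //; exact: cvg_cst.
  rewrite -(cvg_lim _ hl) // -(cvg_lim _ hr) //; apply: ler_lim.
  - by apply/cvg_ex; eexists; exact: hl.
  - by apply/cvg_ex; eexists; exact: hr.
  - by near=> M; exact: box_gf_quad.
rewrite -(ler_pM2r e0); apply: le_trans key.
rewrite -[in leLHS](gtr0_norm e0) -normrM expRN le_eqVlt; apply/orP; left; apply/eqP; congr `|_|.
by field; rewrite gt_eqF.
Unshelve. all: end_near. Qed.

End Limits.

End Assembly.

Theorem theorem1p1 (R : realType) (lambda : R) (hlambda : 0 < lambda) (n : nat) :
  (phi 1 n lambda)%:C%C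
    = 2 ^- n * fredholm_det (contour_kernel lambda n%:Z) 1
  /\
  let g : R -> R[i] := fun t =>
    (1 + (Num.sqrt t)%:C%C) ^- n
    * fredholm_det (contour_kernel lambda n%:Z) (Num.sqrt t)%:C%C in
  cderivable g 1 /\
  (phi 2 n.+1 lambda)%:C%C = (phi 1 n lambda)%:C%C + (- cderive1 g 1).
Proof.
have quad := row_gf_quad n hlambda.
have gE t : (1 + (Num.sqrt t)%:C%C) ^- n * fredholm_det (contour_kernel lambda n%:Z) (Num.sqrt t)%:C%C
    = (row_gf lambda n t)%:C%C.
  rewrite (fredholm_realP n hlambda (Num.sqrt t)).1 /row_gf rmorphM fmorphV rmorphXn rmorphD /=.
  by [].
(* At [t = 1] the remainder vanishes: this is the first formula. *)
have g1 : row_gf lambda n 1 = phi 1 n lambda.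
  have := quad 1; rewrite subrr normr0 ler01 expr0n /= mul0r subr0 => /(_ isT).
  by rewrite normr_le0 subr_eq0 => /eqP.
(* With [h = t - 1] the linear coefficient changes sign, which accounts for the minus in front of
   the derivative. *)
have hq h : `|h| <= 1 -> `|row_gf lambda n (1 + h) - row_gf lambda n 1
    - h * (phi 1 n lambda - phi 2 n.+1 lambda)| <= 1 * h ^+ 2.
  move=> h1; rewrite g1 mul1r.
  have := quad (1 + h); rewrite opprD addNKr normrN h1 sqrrN => /(_ isT).
  by congr (_ <= _); congr `|_|; ring.
have [dG dE] := derivable_quad hq.
split; first by rewrite -g1 -gE sqrtr1.
move=> g; have gE' : g = fun t => (row_gf lambda n t)%:C%C by apply/funext => t; exact: gE.
rewrite gE'; split.
  split => /=; first exact: dG.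
  exact: derivable_cst.
rewrite /cderive1 /= dE derive1_cst.
apply/eqP; rewrite eq_complex /= oppr0 addr0 eqxx andbT; apply/eqP; ring.
Qed.
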